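(* Let $k$ be a field and $s\ge 1$ an integer. The functors $\mathfrak{G}^s$, $(\mathfrak{G}^s)_1$ and $\mathfrak{G}^s_+$ from commutative unital $k$-algebras to groups (with group law the boxed convolution $\boxtimes$) are affine group schemes over $k$, and: (i) $\mathfrak{G}^s$ is represented by the Hopf algebra $A=k[X_1^{\pm1},\dots,X_s^{\pm1},X_w:|w|\ge 2]$, which is filtered by the subspaces $C_j(k)$, $j\in\mathbb{N}$, but is not co-connected; (ii) $(\mathfrak{G}^s)_1$ is represented by $k[X_1,X_1^{-1},\dots,X_s,X_s^{-1}]$, which is spanned by group-like elements; (iii) $\mathfrak{G}^s_+$ is represented by the Hopf algebra $k[\bar X_w:|w|\ge 2]$, which is co-connected; it is co-commutative for $s=1$ and not co-commutative for $s\ge 2$.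
   Context: Words: $[s]=\{1,\dots,s\}$; a word $w=(i_1\dots i_n)$ has length $|w|=n$. For a commutative unital ring $R$, $R_+\langle\langle z_1,\dots,z_s\rangle\rangle$ is the set of formal power series in $s$ non-commuting variables with zero constant term, $f=\sum_{|w|\ge1}X_w(f)z_w$, $z_w=z_{i_1}\cdots z_{i_n}$. $\operatorname{NC}(n)$ is the set of non-crossing partitions of $\{1,\dots,n\}$; $|\pi|$ is the number of blocks. The Kreweras complement $K(\pi)$ of $\pi\in\operatorname{NC}(n)$ is the maximal (for the order in which $\sigma\le\pi$ iff every block of $\sigma$ lies in a block of $\pi$) non-crossing partition of $\{\bar1,\dots,\bar n\}$ (identified with $\{1,\dots,n\}$) such that $\pi\cup K(\pi)$ is a non-crossing partition of $1<\bar1<2<\bar2<\dots<n<\bar n$. For $w=(i_1\dots i_n)$ and $V=\{v_1<\dots<v_m\}\subseteq\{1,\dots,n\}$, $w|V=(i_{v_1}\dots i_{v_m})$, and $X_{w,\pi}=\prod_{V\in\pi}X_{w|V}$. The boxed convolution on $R_+\langle\langle z_1,\dots,z_s\rangle\rangle$ is given by $X_w(f\boxtimes g)=\sum_{\pi\in\operatorname{NC}(|w|)}X_{w,\pi}(f)\,X_{w,K(\pi)}(g)$. $\mathfrak{G}^s(R)$ is the set of $f\in R_+\langle\langle z_1,\dots,z_s\rangle\rangle$ with $X_i(f)\in R^\times$ for $i=1,\dots,s$; $\mathfrak{G}^s_+(R)$ is the subset with $X_i(f)=1$ for $i=1,\dots,s$; $(\mathfrak{G}^s)_1(R)=\{\sum_{i=1}^s\alpha_iz_i:\alpha_i\in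 R^\times\}$ (truncation to words of length $1$). The functors act on morphisms coefficientwise. The Hopf algebra structures are those induced by $\boxtimes$ on coordinate functions: $\Delta X_w=\sum_{\pi\in\operatorname{NC}(|w|)}X_{w,\pi}\otimes X_{w,K(\pi)}$, $\varepsilon(X_i)=1$, $\varepsilon(X_w)=0$ for $|w|\ge2$; $\bar X_w$ denotes the class of $X_w$ modulo $\langle X_1-1,\dots,X_s-1\rangle$, so $\bar X_i=1$. Weights: $X_w$ has weight $|w|-1$, and $X_i^{\pm1}$ has weight $0$; $C_j(k)$ is the $k$-span of the monomials in $X_1^{\pm1},\dots,X_s^{\pm1},X_w$ ($|w|\ge2$) of total weight at most $j$. ''Filtered by $C_j(k)$'' means $C_0\subseteq C_1\subseteq\cdots$, $\bigcup_jC_j=A$, $C_mC_n\subseteq C_{m+n}$ and $\Delta(C_n)\subseteq\sum_{j=0}^nC_j\otimes C_{n-j}$. A Hopf algebra $H$ over $k$ is co-connected if there is an ascending filtration by subspaces $H_0\subseteq H_1\subseteq\dots$ with $H_0=k$, $\bigcup_jH_j=H$ and $\Delta(H_n)\subseteq\sum_{j=0}^nH_j\otimes H_{n-j}$ for all $n$. An element $g$ is group-like if $\Delta g=g\otimes g$ and $\varepsilon(g)=1$. *)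

(* Defs.v *)
From HB Require Import structures.
From mathcomp Require Import all_boot all_order all_algebra finmap.
From mathcomp.classical Require Import boolp.
From mathcomp.multinomials Require Import monalg.

Set Implicit Arguments.
Unset Strict Implicit.
Unset Printing Implicit Defensive.

Import GRing.Theory.
Local Open Scope ring_scope.
Local Open Scope quotient_scope.

Definition is_bilinear (k : fieldType) (A B V : lmodType k) (b : A -> B -> V) :=
  (forall y, linear (b ^~ y)) /\ (forall x, linear (b x)).

Section Tensor.
Variables (k : fieldType) (A B : lmodType k).

Definition formal_eval (V : lmodType k) (b : A -> B -> V) (l : seq (A * B)) : V :=
  \sum_(p <- l) b p.1 p.2.

(* The formal sums [:: (a1, b1); ...; (an, bn)] and l' represent the same
   tensor iff every bilinear map identifies them. *)
Definition tensor_rel (l l' : seq (A * B)) : bool :=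
  `[< forall (V : lmodType k) (b : A -> B -> V),
        is_bilinear b -> formal_eval b l = formal_eval b l' >].

Lemma tensor_rel_equiv : equiv_class_of tensor_rel.
Proof.
split=> [l|l l'|l' l l''].
- exact/asboolP.
- by apply/asboolP/asboolP => h V b hb; rewrite h.
- by move=> /asboolP h /asboolP h'; apply/asboolP => V b hb; rewrite h ?h'.
Qed.

Canonical tensor_equiv := EquivRelPack tensor_rel_equiv.

Definition tensor := {eq_quot tensor_equiv}.
HB.instance Definition _ := Choice.on tensor.
HB.instance Definition _ := EqQuotient.on tensor.

Definition tens (a : A) (b : B) : tensor := \pi_tensor [:: (a, b)].

(* The linear map A (x) B -> V induced by b (meaningful for bilinear b). *)
Definition tlift (V : lmodType k) (b : A -> B -> V) (x : tensor) : V :=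
  formal_eval b (repr x).

Lemma tlift_pi (V : lmodType k) (b : A -> B -> V) l :
  is_bilinear b -> tlift b (\pi_tensor l) = formal_eval b l.
Proof. by move=> hb; have /eqmodP/asboolP/(_ V b hb) := reprK (\pi_tensor l). Qed.

Lemma tlift_tens (V : lmodType k) (b : A -> B -> V) x y :
  is_bilinear b -> tlift b (tens x y) = b x y.
Proof. by move=> hb; rewrite tlift_pi // /formal_eval big_seq1. Qed.

Lemma tensorP (x y : tensor) :
  (forall (V : lmodType k) (b : A -> B -> V), is_bilinear b ->
     tlift b x = tlift b y) -> x = y.
Proof.
by move=> h; rewrite -[x]reprK -[y]reprK; apply/eqmodP/asboolP => V b /h.
Qed.

Definition tensor_zero : tensor := \pi_tensor [::].
Definition tensor_add (x y : tensor) : tensor := \pi_tensor (repr x ++ repr y).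
Definition tensor_scale (c : k) (x : tensor) : tensor :=
  \pi_tensor [seq (c *: p.1, p.2) | p <- repr x].
Definition tensor_opp (x : tensor) : tensor := tensor_scale (-1) x.

Section Lift.
Variables (V : lmodType k) (b : A -> B -> V).
Hypothesis hb : is_bilinear b.

Lemma bilin0l y : b 0 y = 0.
Proof. by have := hb.1 y (-1) 0 0; rewrite scaler0 addr0 scaleN1r addNr. Qed.
Lemma bilinDl x x' y : b (x + x') y = b x y + b x' y.
Proof. by have := hb.1 y 1 x x'; rewrite !scale1r. Qed.
Lemma bilinZl c x y : b (c *: x) y = c *: b x y.
Proof. by have := hb.1 y c x 0; rewrite !addr0 bilin0l addr0. Qed.
Lemma bilin0r x : b x 0 = 0.
Proof. by have := hb.2 x (-1) 0 0; rewrite scaler0 addr0 scaleN1r addNr. Qed.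
Lemma bilinDr x y y' : b x (y + y') = b x y + b x y'.
Proof. by have := hb.2 x 1 y y'; rewrite !scale1r. Qed.
Lemma bilinZr c x y : b x (c *: y) = c *: b x y.
Proof. by have := hb.2 x c y 0; rewrite !addr0 bilin0r addr0. Qed.

Lemma tlift0 : tlift b tensor_zero = 0.
Proof. by rewrite tlift_pi // /formal_eval big_nil. Qed.
Lemma tliftD x y : tlift b (tensor_add x y) = tlift b x + tlift b y.
Proof. by rewrite tlift_pi // /formal_eval big_cat. Qed.
Lemma tliftZ c x : tlift b (tensor_scale c x) = c *: tlift b x.
Proof.
rewrite tlift_pi // /formal_eval big_map scaler_sumr.
by apply: eq_bigr => p _; rewrite bilinZl.
Qed.
Lemma tliftN x : tlift b (tensor_opp x) = - tlift b x.
Proof. by rewrite tliftZ scaleN1r. Qed.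
End Lift.

Fact tensor_addA : associative tensor_add.
Proof. by move=> x y z; apply: tensorP => V b hb; rewrite !tliftD // addrA. Qed.
Fact tensor_addC : commutative tensor_add.
Proof. by move=> x y; apply: tensorP => V b hb; rewrite !tliftD // addrC. Qed.
Fact tensor_add0 : left_id tensor_zero tensor_add.
Proof. by move=> x; apply: tensorP => V b hb; rewrite tliftD // tlift0 // add0r. Qed.
Fact tensor_addN : left_inverse tensor_zero tensor_opp tensor_add.
Proof.
by move=> x; apply: tensorP => V b hb; rewrite tliftD // tliftN // tlift0 // addNr.
Qed.

HB.instance Definition _ :=
  GRing.isZmodule.Build tensor tensor_addA tensor_addC tensor_add0 tensor_addN.

Fact tensor_scaleA a c x :
  tensor_scale a (tensor_scale c x) = tensor_scale (a * c) x.
Proof. by apply: tensorP => V b hb; rewrite !tliftZ // scalerA. Qed.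
Fact tensor_scale1 : left_id 1 tensor_scale.
Proof. by move=> x; apply: tensorP => V b hb; rewrite tliftZ // scale1r. Qed.
Fact tensor_scaleDr : right_distributive tensor_scale +%R.
Proof.
by move=> c x y; apply: tensorP => V b hb; rewrite tliftZ // !tliftD // !tliftZ // scalerDr.
Qed.
Fact tensor_scaleDl x : {morph tensor_scale^~ x : a c / a + c}.
Proof.
by move=> a c; apply: tensorP => V b hb; rewrite tliftZ // !tliftD // !tliftZ // scalerDl.
Qed.

HB.instance Definition _ := GRing.Zmodule_isLmodule.Build k tensor
  tensor_scaleA tensor_scale1 tensor_scaleDr tensor_scaleDl.

Lemma tlift_is_linear (V : lmodType k) (b : A -> B -> V) :
  is_bilinear b -> linear (tlift b).
Proof. by move=> hb c x y; rewrite tliftD // tliftZ. Qed.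

Lemma linear_tlift (W W' : lmodType k) (f : W -> W') (d : A -> B -> W) x :
  linear f -> f (tlift d x) = tlift (fun u v => f (d u v)) x.
Proof.
move=> hf; have f0 : f 0 = 0.
  by have := hf (-1) 0 0; rewrite scaler0 addr0 scaleN1r addNr.
have fD : {morph f : u v / u + v}.
  by move=> u v; have := hf 1 u v; rewrite !scale1r.
by rewrite /tlift /formal_eval (big_morph f fD f0).
Qed.

Lemma tens_bilinear : is_bilinear tens.
Proof.
split=> [y c x x'|x c y y']; apply: tensorP => V b hb;
  rewrite tliftD // tliftZ // !tlift_tens //.
  by rewrite (hb.1 y).
by rewrite (hb.2 x).
Qed.

End Tensor.

Notation "a ⊗ b" := (tens a b) (at level 40, left associativity).

Section TensorMaps.
Variable k : fieldType.

Definition tmap (A B A' B' : lmodType k) (f : A -> A') (g : B -> B') :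
    tensor A B -> tensor A' B' :=
  tlift (fun a b => f a ⊗ g b).

Definition tswap (A B : lmodType k) : tensor A B -> tensor B A :=
  tlift (fun a b => b ⊗ a).

Definition tassoc (A B C : lmodType k) :
    tensor (tensor A B) C -> tensor A (tensor B C) :=
  tlift (fun x c => tlift (fun a b => a ⊗ (b ⊗ c)) x).

End TensorMaps.

Section TensorAlgebra.
Variables (k : fieldType) (A B : comAlgType k).
Local Notation T := (tensor A B).

Definition tensor_one : T := 1 ⊗ 1.
Definition tensor_mul (x y : T) : T :=
  tlift (fun a b => tlift (fun a' b' => (a * a') ⊗ (b * b')) y) x.

Lemma bilin_mulr (V : lmodType k) (b : A -> B -> V) x y :
  is_bilinear b -> is_bilinear (fun x' y' => b (x * x') (y * y')).
Proof.
move=> hb; split=> [z c u v|z c u v].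
  by rewrite mulrDr -scalerAr (hb.1 _).
by rewrite mulrDr -scalerAr (hb.2 _).
Qed.

Lemma bilin_mull (V : lmodType k) (b : A -> B -> V) (t : T) :
  is_bilinear b ->
  is_bilinear (fun x y => tlift (fun x' y' => b (x * x') (y * y')) t).
Proof.
move=> hb; rewrite -[t]reprK; split=> [z c u v|z c u v];
  rewrite !tlift_pi; do ?exact: bilin_mulr;
  rewrite /formal_eval scaler_sumr -big_split; apply: eq_bigr => p _ /=;
  rewrite mulrDl -scalerAl.
  by rewrite (hb.1 _).
by rewrite (hb.2 _).
Qed.

Lemma tlift_mul (V : lmodType k) (b : A -> B -> V) (x y : T) :
  is_bilinear b ->
  tlift b (tensor_mul x y) =
  tlift (fun u v => tlift (fun u' v' => b (u * u') (v * v')) y) x.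
Proof.
move=> hb; rewrite /tensor_mul (linear_tlift _ _ (tlift_is_linear hb)).
congr (tlift _ x); apply/funext => u; apply/funext => v.
rewrite (linear_tlift _ _ (tlift_is_linear hb)).
congr (tlift _ y); apply/funext => u'; apply/funext => v'.
by rewrite tlift_tens.
Qed.

Fact tensor_mulA : associative tensor_mul.
Proof.
move=> x y z; apply: tensorP => V b hb.
rewrite tlift_mul // [RHS]tlift_mul // tlift_mul; last exact: bilin_mull.
congr (tlift _ x); apply/funext => u; apply/funext => v.
rewrite tlift_mul; last exact: bilin_mulr.
congr (tlift _ y); apply/funext => u'; apply/funext => v'.
by congr (tlift _ z); apply/funext => u''; apply/funext => v''; rewrite !mulrA.
Qed.

Fact tensor_mulC : commutative tensor_mul.
Proof.
move=> x y; apply: tensorP => V b hb; rewrite !tlift_mul //.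
rewrite /tlift /formal_eval exchange_big; apply: eq_bigr => p _.
by apply: eq_bigr => q _ /=; rewrite mulrC [q.2 * _]mulrC.
Qed.

Fact tensor_mul1 : left_id tensor_one tensor_mul.
Proof.
move=> x; apply: tensorP => V b hb; rewrite tlift_mul //.
rewrite tlift_tens; last exact: bilin_mull.
by congr (tlift _ x); apply/funext => u; apply/funext => v; rewrite !mul1r.
Qed.

Fact tensor_mulDl : left_distributive tensor_mul +%R.
Proof.
move=> x y z; apply: tensorP => V b hb; rewrite tlift_mul // (tliftD hb).
by rewrite (tliftD (bilin_mull z hb)) !tlift_mul.
Qed.

HB.instance Definition _ := GRing.Zmodule_isComPzRing.Build T
  tensor_mulA tensor_mulC tensor_mul1 tensor_mulDl.

Lemma tens_mul (a a' : A) (b b' : B) :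
  (a ⊗ b) * (a' ⊗ b') = (a * a') ⊗ (b * b').
Proof.
apply: tensorP => V d hd; rewrite tlift_mul // (tlift_tens _ _ (bilin_mull _ hd)).
by rewrite (tlift_tens _ _ (bilin_mulr _ _ hd)) tlift_tens.
Qed.

End TensorAlgebra.

Definition lin_span (k : fieldType) (V : lmodType k) (S : V -> Prop) (v : V) :
    Prop :=
  exists (n : nat) (c : 'I_n -> k) (u : 'I_n -> V),
    (forall i, S (u i)) /\ v = \sum_(i < n) c i *: u i.

Definition is_subspace (k : fieldType) (V : lmodType k) (S : V -> Prop) : Prop :=
  S 0 /\ forall (c : k) u v, S u -> S v -> S (c *: u + v).

Record hopf_algebra (k : fieldType) (H : comAlgType k) := HopfAlgebra {
  comul : {lrmorphism H -> tensor H H};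
  counit : {lrmorphism H -> k^o};
  antipode : {linear H -> H};
  comulA : forall x, tassoc (tmap comul idfun (comul x)) = tmap idfun comul (comul x);
  counitl : forall x, tlift (fun a b => counit a *: b) (comul x) = x;
  counitr : forall x, tlift (fun a b => counit b *: a) (comul x) = x;
  antipodel : forall x, tlift (fun a b => antipode a * b) (comul x) = counit x *: 1;
  antipoder : forall x, tlift (fun a b => a * antipode b) (comul x) = counit x *: 1
}.

Section HopfNotions.
Variables (k : fieldType) (H : comAlgType k) (h : hopf_algebra H).

Definition group_like (g : H) : Prop := comul h g = g ⊗ g /\ counit h g = 1.

Definition cocommutative : Prop := forall x, tswap (comul h x) = comul h x.

(* \sum_(j <= n) F_j (x) F_(n - j) *)
Definition tensor_filtration (F : nat -> H -> Prop) (n : nat) :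
    tensor H H -> Prop :=
  lin_span (fun t => exists (j : nat) (a b : H),
    [/\ (j <= n)%N, F j a, F (n - j)%N b & t = a ⊗ b]).

Definition coalgebra_filtration (F : nat -> H -> Prop) : Prop :=
  [/\ forall n, is_subspace (F n),
      forall n x, F n x -> F n.+1 x,
      forall x, exists n, F n x
    & forall n x, F n x -> tensor_filtration F n (comul h x)].

Definition hopf_filtration (F : nat -> H -> Prop) : Prop :=
  coalgebra_filtration F /\
  forall m n x y, F m x -> F n y -> F (m + n)%N (x * y).

Definition co_connected : Prop :=
  exists F : nat -> H -> Prop,
    coalgebra_filtration F /\ (forall x, F 0%N x <-> exists c : k, x = c *: 1).

End HopfNotions.

(* The library's [comAlgType] excludes the zero ring, whereas the functors are
   evaluated on all commutative unital k-algebras; these are given here by a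
   possibly trivial commutative ring and its structure map. *)
Record kalg (k : fieldType) := KAlg {
  kalg_ring : comPzRingType;
  kalg_map : {rmorphism k -> kalg_ring}
}.

Definition kalg_sort (k : fieldType) (R : kalg k) : Type := kalg_ring R.
Coercion kalg_sort : kalg >-> Sortclass.

Section KAlgLmodule.
Variables (k : fieldType) (R : kalg k).

HB.instance Definition _ := GRing.ComPzRing.on (kalg_sort R).

Definition kalg_scale (c : k) (x : kalg_sort R) : kalg_sort R :=
  (kalg_map R c : kalg_sort R) * x.

Fact kalg_scaleA a b x : kalg_scale a (kalg_scale b x) = kalg_scale (a * b) x.
Proof. by rewrite /kalg_scale mulrA rmorphM. Qed.
Fact kalg_scale1 : left_id 1 kalg_scale.
Proof. by move=> x; rewrite /kalg_scale rmorph1 mul1r. Qed.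
Fact kalg_scaleDr : right_distributive kalg_scale +%R.
Proof. by move=> c x y; rewrite /kalg_scale mulrDr. Qed.
Fact kalg_scaleDl x : {morph kalg_scale^~ x : a b / a + b}.
Proof. by move=> a b; rewrite /kalg_scale rmorphD mulrDl. Qed.

HB.instance Definition _ := GRing.Zmodule_isLmodule.Build k (kalg_sort R)
  kalg_scaleA kalg_scale1 kalg_scaleDr kalg_scaleDl.

End KAlgLmodule.

Record kalg_hom (k : fieldType) (R S : kalg k) := KAlgHom {
  khom :> {rmorphism R -> S};
  khom_scalable : scalable khom
}.

(* The value at R is the set [fin R] of points of the ambient type [fob R]. *)
Record functor_with_law (k : fieldType) := FunctorWithLaw {
  fob : kalg k -> Type;
  fin : forall R, fob R -> Prop;
  flaw : forall R, fob R -> fob R -> fob R;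
  fmap : forall R S, kalg_hom R S -> fob R -> fob S
}.
Arguments fin {k} _ {R} _.
Arguments flaw {k} _ {R} _ _.
Arguments fmap {k} _ {R S} _ _.

Definition is_group (T : Type) (G : T -> Prop) (op : T -> T -> T) : Prop :=
  [/\ forall x y, G x -> G y -> G (op x y),
      forall x y z, G x -> G y -> G z -> op x (op y z) = op (op x y) z
    & exists e, [/\ G e,
        forall x, G x -> op e x = x /\ op x e = x
      & forall x, G x -> exists y, [/\ G y, op y x = e & op x y = e]]].

Definition is_group_functor (k : fieldType) (F : functor_with_law k) : Prop :=
  [/\ forall R : kalg k, is_group (@fin k F R) (@flaw k F R),
      forall (R S : kalg k) (phi : kalg_hom R S) x, fin F x -> fin F (fmap F phi x),
      forall (R S : kalg k) (phi : kalg_hom R S) x y, fin F x -> fin F y ->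
        fmap F phi (flaw F x y) = flaw F (fmap F phi x) (fmap F phi y),
      forall (R : kalg k) (phi : kalg_hom R R) x, phi =1 id -> fin F x ->
        fmap F phi x = x
    & forall (R S T : kalg k) (phi : kalg_hom R S) (psi : kalg_hom S T)
        (chi : kalg_hom R T) x, chi =1 psi \o phi -> fin F x ->
        fmap F chi x = fmap F psi (fmap F phi x)].

Definition represents (k : fieldType) (F : functor_with_law k) (H : comAlgType k)
    (eta : forall R : kalg k, {lrmorphism H -> R} -> fob F R) : Prop :=
  [/\ forall (R : kalg k) (phi : {lrmorphism H -> R}), fin F (eta R phi),
      forall (R : kalg k) (phi psi : {lrmorphism H -> R}),
        eta R phi = eta R psi -> phi =1 psi,
      forall (R : kalg k) (x : fob F R), fin F x ->
        exists phi : {lrmorphism H -> R}, eta R phi = x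
    & forall (R S : kalg k) (f : kalg_hom R S)
        (phi : {lrmorphism H -> R}) (psi : {lrmorphism H -> S}),
        psi =1 f \o phi -> eta S psi = fmap F f (eta R phi)].

Definition affine_group_scheme (k : fieldType) (F : functor_with_law k) : Prop :=
  is_group_functor F /\
  exists (H : comAlgType k) (eta : forall R : kalg k, {lrmorphism H -> R} -> fob F R),
    represents eta.

(* m_R \o (phi (x) psi) \o comul, the product of Hom(H, R). *)
Definition convolution (k : fieldType) (H : comAlgType k) (h : hopf_algebra H)
    (R : kalg k) (phi psi : {lrmorphism H -> R}) : H -> R :=
  fun x => tlift (fun a b => phi a * psi b) (comul h x).

Definition hopf_represents (k : fieldType) (F : functor_with_law k)
    (H : comAlgType k) (h : hopf_algebra H)
    (eta : forall R : kalg k, {lrmorphism H -> R} -> fob F R) : Prop :=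
  represents eta /\
  forall (R : kalg k) (phi psi : {lrmorphism H -> R}),
    exists2 chi : {lrmorphism H -> R}, chi =1 convolution h phi psi
      & eta R chi = flaw F (eta R phi) (eta R psi).

Definition noncrossing (n : nat) (P : {set {set 'I_n}}) : bool :=
  partition P [set: 'I_n] &&
  [forall U in P, forall V in P, forall a in U, forall b in V,
   forall c in U, forall d in V, [&& a < b, b < c & c < d]%N ==> (U == V)].

Definition refines (n : nat) (P Q : {set {set 'I_n}}) : bool :=
  [forall U in P, exists V in Q, U \subset V].

Fact even_pos_proof n (i : 'I_n) : (i.*2 < n.*2)%N.
Proof. by rewrite ltn_double. Qed.
Fact odd_pos_proof n (i : 'I_n) : (i.*2.+1 < n.*2)%N.
Proof. by rewrite ltn_Sdouble. Qed.

(* Positions of i and of its barred copy in 1 < 1' < 2 < 2' < ... < n < n'. *)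
Definition even_pos n (i : 'I_n) : 'I_(n.*2) := Ordinal (even_pos_proof i).
Definition odd_pos n (i : 'I_n) : 'I_(n.*2) := Ordinal (odd_pos_proof i).

Definition interleave n (P Q : {set {set 'I_n}}) : {set {set 'I_(n.*2)}} :=
  [set @even_pos n @: U | U : {set 'I_n} in P] :|:
  [set @odd_pos n @: V | V : {set 'I_n} in Q].

Definition kreweras_compatible n (P Q : {set {set 'I_n}}) : bool :=
  noncrossing Q && noncrossing (interleave P Q).

(* "The maximal" partition is read as the greatest one; it exists when P is
   non-crossing, so that the default [set0] is irrelevant. *)
Definition kreweras n (P : {set {set 'I_n}}) : {set {set 'I_n}} :=
  odflt set0 [pick Q | kreweras_compatible P Q &&
    [forall Q' : {set {set 'I_n}}, kreweras_compatible P Q' ==> refines Q' Q]].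

(* A family of coefficients indexed by words; power series without constant
   term are those vanishing at the empty word. *)
Definition series (s : nat) (R : Type) := seq 'I_s -> R.

(* [enum V] lists the positions in V in increasing order. *)
Definition subword (s : nat) (w : seq 'I_s) (V : {set 'I_(size w)}) : seq 'I_s :=
  [seq tnth (in_tuple w) i | i <- enum V].

Definition part_coef (s : nat) (R : comPzRingType) (f : series s R)
    (w : seq 'I_s) (P : {set {set 'I_(size w)}}) : R :=
  \prod_(V in P) f (subword V).

Definition boxed_conv (s : nat) (R : comPzRingType) (f g : series s R) :
    series s R :=
  fun w => if w is [::] then 0 else
    \sum_(P : {set {set 'I_(size w)}} | noncrossing P)
      part_coef f P * part_coef g (kreweras P).

Definition invertible (R : comPzRingType) (x : R) : Prop := exists y, x * y = 1.

Definition linear_series (s : nat) (R : comPzRingType) (a : 'I_s -> R) :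
    series s R :=
  fun w => if w is [:: i] then a i else 0.

Section GroupFunctors.
Variables (k : fieldType) (s : nat).

Definition series_functor (G : forall R : kalg k, series s R -> Prop) :
    functor_with_law k :=
  @FunctorWithLaw k (fun R => series s R) G
    (fun R f g => boxed_conv f g) (fun R S phi f => phi \o f).

Definition GG : functor_with_law k := series_functor (fun R f =>
  f [::] = 0 /\ forall i, invertible (f [:: i])).

Definition GG1 : functor_with_law k := series_functor (fun R f =>
  exists2 a : 'I_s -> R, (forall i, invertible (a i)) & f = linear_series a).

Definition GGplus : functor_with_law k := series_functor (fun R f =>
  f [::] = 0 /\ forall i, f [:: i] = 1).

End GroupFunctors.

(* The commutative monoid of monomials is written additively, so that the
   exponents of Laurent monomials are allowed ([{malg k[M]}] is a ring only for
   monoids M in which 1 is the only invertible element). *)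
Definition monoid_algebra (k : fieldType) (M : nmodType) : Type := {malg k[M]}.

Section MonoidAlgebra.
Variables (k : fieldType) (M : nmodType).
Local Notation A := (monoid_algebra k M).

HB.instance Definition _ := GRing.Lmodule.copy A {malg k[M]}.

Definition mono (m : M) : A := << m >>.

Local Open Scope fset_scope.

Definition mono_mul (f g : A) : A :=
  \sum_(m <- msupp f) \sum_(n <- msupp g) << f@_m * g@_n *g (m + n)%R >>.

Lemma mono_mulw (d1 d2 : {fset M}) (f g : A) :
  msupp f `<=` d1 -> msupp g `<=` d2 ->
  mono_mul f g = \sum_(m <- d1) \sum_(n <- d2) << f@_m * g@_n *g (m + n)%R >>.
Proof.
move=> le1 le2; rewrite /mono_mul (big_fset_incl _ le1) /=.
  apply: eq_bigr => m _; apply: big_fset_incl => // n _ /mcoeff_outdom ->.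
  by rewrite mulr0 monalgU0.
move=> m _ /mcoeff_outdom fm.
by rewrite big1 // => n _; rewrite fm mul0r monalgU0.
Qed.

Lemma mono_mulUU (a b : k) (m n : M) :
  mono_mul << a *g m >> << b *g n >> = << a * b *g (m + n)%R >>.
Proof. by rewrite (mono_mulw msuppU_le msuppU_le) !big_seq_fset1 !mcoeffUU. Qed.

Fact mono_mulC : commutative mono_mul.
Proof.
move=> f g; rewrite /mono_mul exchange_big; apply: eq_bigr => m _.
by apply: eq_bigr => n _; rewrite mulrC addrC.
Qed.

Fact mono_mulDl : left_distributive mono_mul +%R.
Proof.
move=> f1 f2 g; have leg := fsubset_refl (msupp g).
rewrite (mono_mulw (fsubsetUl (msupp f1) (msupp f2)) leg).
rewrite (mono_mulw (fsubsetUr (msupp f1) (msupp f2)) leg).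
rewrite (mono_mulw (msuppD_le f1 f2) leg) -big_split; apply: eq_bigr => m _ /=.
rewrite -big_split; apply: eq_bigr => n _ /=.
by rewrite mcoeffD mulrDl monalgUD.
Qed.

Lemma mono_mulDr : right_distributive mono_mul +%R.
Proof. by move=> f g1 g2; rewrite !(mono_mulC f) mono_mulDl. Qed.

Lemma mono_mul0l f : mono_mul 0 f = 0.
Proof. by apply: (addrI (mono_mul 0 f)); rewrite -mono_mulDl !addr0. Qed.

Lemma mono_mul0r f : mono_mul f 0 = 0.
Proof. by rewrite mono_mulC mono_mul0l. Qed.

Lemma mono_mul_suml (I : Type) (r : seq I) (F : I -> A) g :
  mono_mul (\sum_(i <- r) F i) g = \sum_(i <- r) mono_mul (F i) g.
Proof.
exact: (big_morph (mono_mul^~ g) (fun x y => mono_mulDl x y g) (mono_mul0l g)).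
Qed.

Lemma mono_mul_sumr (I : Type) (r : seq I) (F : I -> A) g :
  mono_mul g (\sum_(i <- r) F i) = \sum_(i <- r) mono_mul g (F i).
Proof. exact: (big_morph (mono_mul g) (mono_mulDr g) (mono_mul0r g)). Qed.

Lemma mono_mulEl f g :
  mono_mul f g = \sum_(m <- msupp f) mono_mul << f@_m *g m >> g.
Proof. by rewrite {1}(monalgE f) mono_mul_suml. Qed.

Lemma mono_mulEr f g :
  mono_mul f g = \sum_(m <- msupp g) mono_mul f << g@_m *g m >>.
Proof. by rewrite {1}(monalgE g) mono_mul_sumr. Qed.

Fact mono_mulA : associative mono_mul.
Proof.
move=> f g h; rewrite (mono_mulEl f g) (mono_mulEl f) mono_mul_suml.
apply: eq_bigr => m _; rewrite (mono_mulEl g) (mono_mulEr _ g) mono_mul_suml mono_mul_sumr.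
apply: eq_bigr => n _; rewrite !(mono_mulEr _ h) mono_mul_sumr.
by apply: eq_bigr => p _; rewrite !mono_mulUU mulrA addrA.
Qed.

Fact mono_mul1 : left_id (mono 0) mono_mul.
Proof.
move=> f; rewrite (monalgE f) mono_mul_sumr; apply: eq_bigr => m _.
by rewrite mono_mulUU mul1r add0r.
Qed.

Fact mono_one_neq0 : mono 0 != 0.
Proof. by rewrite monalgU_eq0 oner_eq0. Qed.

HB.instance Definition _ := GRing.Zmodule_isComNzRing.Build A
  mono_mulA mono_mulC mono_mul1 mono_mulDl mono_one_neq0.

Fact mono_scaleAl (c : k) (f g : A) : c *: (f * g) = (c *: f) * g.
Proof.
have ZU a (m : M) : c *: << a *g m >> = << c * a *g m >> :> A.
  by apply/malgP => n; rewrite mcoeffZ !mcoeffU mulrnAr.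
transitivity (mono_mul (c *: f) g) => //.
rewrite (mono_mulw (msuppZ_le c f) (fsubset_refl _)).
transitivity (c *: mono_mul f g) => //.
rewrite /mono_mul scaler_sumr; apply: eq_bigr => m _.
by rewrite scaler_sumr; apply: eq_bigr => n _; rewrite ZU mcoeffZ mulrA.
Qed.

HB.instance Definition _ := GRing.Lmodule_isLalgebra.Build k A mono_scaleAl.
HB.instance Definition _ := GRing.Lalgebra_isComAlgebra.Build k A.

End MonoidAlgebra.

Lemma mono_mulE (k : fieldType) (M : nmodType) (m n : M) :
  mono k m * mono k n = mono k (m + n).
Proof. by rewrite [LHS]mono_mulUU mulr1. Qed.

HB.instance Definition _ (I : choiceType) :=
  GRing.isNmodule.Build {cmonom I} (@mulmA _) (@mulmC _) (@mul1m _).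

Definition long_word (s : nat) : choiceType := {w : seq 'I_s | (1 < size w)%N}.

Section CoordinateAlgebras.
Variables (k : fieldType) (s : nat).

Definition laurent_exp : zmodType := {ffun 'I_s -> int}.
Definition poly_exp : nmodType := {cmonom (long_word s)}.

(* k[X_1^{+-1}, ..., X_s^{+-1}] *)
Definition laurent_algebra : comAlgType k := monoid_algebra k laurent_exp.
(* k[bar X_w : |w| >= 2] *)
Definition bar_algebra : comAlgType k := monoid_algebra k poly_exp.
(* k[X_1^{+-1}, ..., X_s^{+-1}, X_w : |w| >= 2] *)
Definition coord_algebra : comAlgType k :=
  monoid_algebra k (laurent_exp * poly_exp)%type.

Definition unit_exp (i : 'I_s) : laurent_exp := [ffun j => (j == i)%:R].
Definition word_exp (w : long_word s) : poly_exp := ucm w.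

(* The series of coordinate functions: the coefficient at w is the class of X_w
   in the respective algebra, where X_w = 0 for |w| >= 2 on linear series and
   bar X_i = 1. *)
Definition coord_series : series s coord_algebra := fun w =>
  if insub w is Some v then mono k ((0, word_exp v) : laurent_exp * poly_exp)
  else if w is [:: i] then mono k ((unit_exp i, 0) : laurent_exp * poly_exp)
  else 0.

Definition laurent_series : series s laurent_algebra :=
  linear_series (fun i => mono k (unit_exp i)).

Definition bar_series : series s bar_algebra := fun w =>
  if insub w is Some v then mono k (word_exp v)
  else if w is [:: i] then 1
  else 0.

Definition weight (m : laurent_exp * poly_exp) : nat :=
  (\sum_(w <- finsupp (m.2 : {cmonom (long_word s)}))
    (m.2 : {cmonom (long_word s)}) w * (size (val w)).-1)%N.

Definition weight_filtration (j : nat) : coord_algebra -> Prop :=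
  lin_span (fun x => exists2 m, (weight m <= j)%N & x = mono k m).

End CoordinateAlgebras.

Section Coordinates.
Variables (k : fieldType) (s : nat) (H : comAlgType k).

(* phi |-> \sum_w phi(X_w) z_w for the series X of coordinate functions *)
Definition coord_point (X : series s H) (R : kalg k) (phi : {lrmorphism H -> R}) :
    series s R :=
  phi \o X.

Definition induced_by_boxed_conv (h : hopf_algebra H) (X : series s H) : Prop :=
  forall w : seq 'I_s, (0 < size w)%N ->
    comul h (X w) = \sum_(P : {set {set 'I_(size w)}} | noncrossing P)
                      part_coef X P ⊗ part_coef X (kreweras P)
    /\ counit h (X w) = if size w == 1%N then 1 else 0.

End Coordinates.

Definition is_quotient_map (k : fieldType) (A B : comAlgType k) (n : nat)
    (g : 'I_n -> A) (q : {lrmorphism A -> B}) : Prop :=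
  (forall y, exists x, q x = y) /\
  (forall x, q x = 0 <-> exists a : 'I_n -> A, x = \sum_(i < n) a i * g i).

(* Main.v *)
(* The barred points i and j are joined in K(p) iff every pair of points lying in
   one block of p is separated by i exactly when it is separated by j.  Taking
   this inside the blocks of p gives a relative complement K_p(s) for s <= p, and
   (s, p) |-> (s, K_p(s)) is a bijection onto the pairs (s, t) with t <= K(s), with
   K_{K(s)}(K_p(s)) = K(p): this is the associativity of boxed convolution.
   Inverses are computed recursively on the length of words.

   The coordinate algebras are monoid algebras, so their points are the series of
   the three functors.  Coproduct, counit and antipode are the points given by the
   product of the two tensor inclusions of the universal point, the unit and the
   inverse of the universal point; the Hopf axioms compare two algebra maps on
   coordinate functions.

   The identity |p| + |K(p)| = n + 1 makes the coproduct compatible with weights.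
   A group-like element of a co-connected Hopf algebra is 1, which excludes X_1 in
   the first algebra.  For s = 1 reflecting the circle exchanges p and K(p), whence
   co-commutativity; for s >= 2 it fails already on the word 1 2 1. *)

From HB Require Import structures.
Require Import Defs.
From mathcomp Require Import all_boot all_order all_algebra zify finmap.
From mathcomp.classical Require Import boolp.
From mathcomp.multinomials Require Import monalg.

Set Implicit Arguments.
Unset Strict Implicit.
Unset Printing Implicit Defensive.

Import GRing.Theory.
Local Open Scope ring_scope.

(** * Non-crossing partitions and the Kreweras complement *)

(** The combinatorics rests on the Boolean [sep i x y]: the barred point i cuts the pair x, y. Two
    chords with distinct ends cross exactly when the ends of one cut the other differently. Once
    partitions are replaced by their relations [same_block], questions about crossings become parity
    statements about a few positions, which linear arithmetic decides. The obstacle is dependent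
    typing: a block of a block, hence a subword of a subword, would live over a new ordinal type.
    Partitions are therefore taken of subsets D of one fixed ['I_n], and nested subwords are moved
    into it. On the algebraic side, tensor products and test rings are only known to be possibly
    zero commutative rings. Algebra maps are therefore treated as predicates on plain functions and
    bundled only where a structure must be exhibited. Commutativity of the target makes the product
    of two algebra maps an algebra map. *)

Section Blocks.
Variable T : finType.
Implicit Types (P Q : {set {set T}}) (U V D : {set T}).

Definition same_block P x y := [exists U in P, (x \in U) && (y \in U)].

Lemma same_blockP P x y :
  reflect (exists U, [/\ U \in P, x \in U & y \in U]) (same_block P x y).
Proof.
by apply: (iffP exists_inP) => [[U UP /andP[]]|[U [UP xU yU]]]; exists U; rewrite ?xU.
Qed.

Lemma same_block_in P U x y : U \in P -> x \in U -> y \in U -> same_block P x y.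
Proof. by move=> UP xU yU; apply/same_blockP; exists U. Qed.

Lemma same_blockC P x y : same_block P x y = same_block P y x.
Proof. by apply/same_blockP/same_blockP => -[U []]; exists U. Qed.

Lemma same_blockE P U x y :
  trivIset P -> U \in P -> x \in U -> same_block P x y = (y \in U).
Proof.
move=> tP UP xU; apply/same_blockP/idP => [[W [WP xW yW]]|yU]; last by exists U.
by rewrite -(def_pblock tP UP xU) (def_pblock tP WP xW).
Qed.

Lemma same_block_trans P : trivIset P -> transitive (same_block P).
Proof.
move=> tP y x z /same_blockP[U [UP xU yU]]; rewrite (same_blockE _ tP UP yU) => zU.
exact: same_block_in zU.
Qed.

Lemma same_block_refl P D x : partition P D -> same_block P x x = (x \in D).
Proof.
move=> /and3P[/eqP <- tP _]; apply/same_blockP/bigcupP => [[U [UP xU _]]|[U UP xU]];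
by exists U.
Qed.

Lemma same_block_sub P Q D : partition P D -> partition Q D ->
  (forall x y, same_block P x y = same_block Q x y) -> P \subset Q.
Proof.
move=> pP pQ e; apply/subsetP => U UP.
case/and3P: (pP) => /eqP cP tP /negP nP; case/and3P: (pQ) => /eqP cQ tQ _.
have [x xU] : exists x, x \in U by apply/set0Pn; apply/eqP => U0; rewrite U0 in UP.
have xD : x \in D by rewrite -cP; apply/bigcupP; exists U.
have /bigcupP[W WQ xW] : x \in cover Q by rewrite cQ.
suff -> : U = W by [].
by apply/setP => y; rewrite -(same_blockE _ tP UP xU) e (same_blockE _ tQ WQ xW).
Qed.

(** The usual way below to identify two partitions: compare their relations. *)
Lemma same_block_inj P Q D : partition P D -> partition Q D ->
  (forall x y, same_block P x y = same_block Q x y) -> P = Q.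
Proof.
move=> pP pQ e; apply/eqP; rewrite eqEsubset (same_block_sub pP pQ) //=.
by apply: (same_block_sub pQ pP) => x y; rewrite e.
Qed.

Lemma same_block_equivalence_partition (R : rel T) D x y : equivalence_rel R ->
  same_block (equivalence_partition R D) x y = [&& x \in D, y \in D & R x y].
Proof.
move=> eR; apply/same_blockP/and3P => [[U [/imsetP[z zD ->]]]|[xD yD Rxy]].
  rewrite !inE => /andP[xD Rzx] /andP[yD Rzy]; split=> //.
  by have [_ <-] := eR z x y.
exists [set z in D | R x z]; rewrite !inE xD yD Rxy; split=> //.
  by apply/imsetP; exists x.
by have [-> _] := eR x x x.
Qed.

Lemma partition_equivalence (R : rel T) D : equivalence_rel R ->
  partition (equivalence_partition R D) D.
Proof. by move=> eR; apply: equivalence_partitionP => x y z _ _ _; apply: eR. Qed.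

End Blocks.

Section Crossings.
Variable n : nat.
Implicit Types (P Q : {set {set 'I_n}}) (U V D : {set 'I_n}) (i j x y a b c d : 'I_n).

Definition crossfree P : bool :=
  [forall U in P, forall V in P, forall a in U, forall b in V,
   forall c in U, forall d in V, [&& a < b, b < c & c < d]%N ==> (U == V)].

Lemma crossfreeP P : reflect
  (forall U V a b c d, U \in P -> V \in P -> a \in U -> b \in V -> c \in U ->
     d \in V -> a < b -> b < c -> c < d -> U = V)%N (crossfree P).
Proof.
apply: (iffP forall_inP) => h U.
  move=> V a b c d UP VP aU bV cU dV ab bc cd.
  have /forall_inP/(_ V VP)/forall_inP/(_ a aU)/forall_inP/(_ b bV) := h U UP.
  by move=> /forall_inP/(_ c cU)/forall_inP/(_ d dV); rewrite ab bc cd => /eqP.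
move=> UP; apply/forall_inP => V VP; apply/forall_inP => a aU.
apply/forall_inP => b bV; apply/forall_inP => c cU; apply/forall_inP => d dV.
by apply/implyP => /and3P[ab bc cd]; apply/eqP; apply: (h U V a b c d).
Qed.

(** The domain D is an argument because the blocks of a coarser partition carry non-crossing
    partitions of their own; on the full set this is convertible to [noncrossing]. *)
Definition nc D P := partition P D && crossfree P.

(* i, standing for the barred copy of i, lies between the points x and y. *)
Definition sep i x y : bool := (x <= i)%N (+) (y <= i)%N.

(* For i < j this says that the interval (i, j] is a union of blocks of P. *)
Definition krel P i j : bool :=
  [forall x, forall y, same_block P x y ==> (sep i x y == sep j x y)].

Definition kr D P := equivalence_partition (krel P) D.

Lemma krelP P i j :
  reflect (forall x y, same_block P x y -> sep i x y = sep j x y) (krel P i j).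
Proof.
apply: (iffP forallP) => h x; last by apply/forallP=> y; apply/implyP => /h ->.
by move=> y; have /forallP/(_ y)/implyP h' := h x => /h'/eqP.
Qed.

Lemma krel_equiv P : equivalence_rel (krel P).
Proof.
move=> x y z; split=> [|/krelP h]; first by apply/krelP.
by apply/krelP/krelP => h' a b ab; rewrite -h' // h.
Qed.

Lemma kr_partition D P : partition (kr D P) D.
Proof. exact/partition_equivalence/krel_equiv. Qed.

Lemma same_block_kr D P i j :
  same_block (kr D P) i j = [&& i \in D, j \in D & krel P i j].
Proof. exact/same_block_equivalence_partition/krel_equiv. Qed.

(** If a and b disagreed, each of the intervals (a, b], (b, c], (c, d] would contain exactly one of
    x and y, and these are only two points. *)
Lemma sep_cross (a b c d : 'I_n) x y : (a < b)%N -> (b < c)%N -> (c < d)%N ->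
  sep a x y = sep c x y -> sep b x y = sep d x y -> sep a x y = sep b x y.
Proof. rewrite /sep; lia. Qed.

Lemma crossfree_rel (R : rel 'I_n) D : equivalence_rel R ->
  (forall a b c d, (a < b -> b < c -> c < d -> R a c -> R b d -> R a b)%N) ->
  crossfree (equivalence_partition R D).
Proof.
move=> eR h; apply/crossfreeP => U V a b c d UP VP aU bV cU dV ab bc cd.
have sbE := fun x y => @same_block_equivalence_partition _ R D x y eR.
have := same_block_in UP aU cU; rewrite sbE => /and3P[aD cD Rac].
have := same_block_in VP bV dV; rewrite sbE => /and3P[bD dD Rbd].
have Rab := h _ _ _ _ ab bc cd Rac Rbd.
have tP : trivIset (equivalence_partition R D).
  by have /and3P[] := partition_equivalence D eR.
have : same_block (equivalence_partition R D) a b by rewrite sbE aD bD.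
rewrite (same_blockE _ tP UP aU) => bU.
by rewrite -(def_pblock tP UP bU) (def_pblock tP VP bV).
Qed.

Lemma kr_nc D P : nc D (kr D P).
Proof.
rewrite /nc kr_partition /=; apply: crossfree_rel; first exact: krel_equiv.
move=> a b c d ab bc cd /krelP hac /krelP hbd.
by apply/krelP => x y xy; apply: (sep_cross ab bc cd); auto.
Qed.

(** Otherwise the chords from x to y and from a to b, which belong to different blocks, would
    cross. *)
Lemma nc_sep D P x y a b : nc D P -> same_block P x y -> same_block P a b ->
  ~~ same_block P x a -> sep x a b = sep y a b.
Proof.
move=> /andP[pP /crossfreeP cf] /same_blockP[U [UP xU yU]] /same_blockP[V [VP aV bV]].
case/and3P: (pP) => _ tP _; rewrite (same_blockE _ tP UP xU) => aU.
have UV : U <> V by move=> e; rewrite e aV in aU.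
have xa : x != a by apply: contraNneq aU => <-.
have ya : y != a by apply: contraNneq aU => <-.
have bU : b \notin U.
  by apply/negP => bU; case: UV; rewrite -(def_pblock tP UP bU) (def_pblock tP VP bV).
have xb : x != b by apply: contraNneq bU => <-.
have yb : y != b by apply: contraNneq bU => <-.
have VU : V <> U by move=> e; apply: UV.
move: xa xb ya yb; rewrite -!val_eqE /= /sep => xa xb ya yb.
apply/eqP; apply/negPn/negP => ne.
(* The eight orders in which the ends of two crossing chords can occur. *)
have : (x < a < y)%N && (y < b)%N || (x < b < y)%N && (y < a)%N ||
   (y < a < x)%N && (x < b)%N || (y < b < x)%N && (x < a)%N ||
   (a < x < b)%N && (b < y)%N || (a < y < b)%N && (b < x)%N ||
   (b < x < a)%N && (a < y)%N || (b < y < a)%N && (a < x)%N by lia.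
by do ![case/orP]; move=> /andP[/andP[h1 h2] h3];
  first [exact: UV (cf _ _ _ _ _ _ UP VP _ _ _ _ h1 h2 h3)
       | exact: VU (cf _ _ _ _ _ _ VP UP _ _ _ _ h1 h2 h3)].
Qed.

(* The barred point i just before the first element of a block U is joined in
   the Kreweras complement to the barred copy of the last element of U. *)
Lemma sep_block D P U i m M a b : nc D P -> U \in P -> m \in U -> M \in U ->
    (forall x, x \in U -> m <= x <= M)%N -> (i < m)%N ->
    (a <= i)%N || (m <= a)%N -> (b <= i)%N || (m <= b)%N ->
  same_block P a b -> sep i a b = sep M a b.
Proof.
move=> ncP UP mU MU bd im ha hb sab.
have /andP[/and3P[_ tP _] _] := ncP.
have [aU|aU] := boolP (a \in U).
  have bU : b \in U by rewrite -(same_blockE _ tP UP aU).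
  by move: (bd a aU) (bd b bU); rewrite /sep; lia.
have nma : ~~ same_block P m a by rewrite (same_blockE _ tP UP mU).
have := nc_sep ncP (same_block_in UP mU MU) sab nma.
have : m != a by apply: contraNneq aU => <-.
have : m != b.
  by apply: contraNneq nma => ->; rewrite same_blockC.
by rewrite -!val_eqE /= /sep; lia.
Qed.

Lemma set_min (A : {set 'I_n}) x : x \in A ->
  exists2 m, m \in A & forall y, y \in A -> (m <= y)%N.
Proof. by move=> xA; case: (arg_minnP (fun y : 'I_n => val y) xA) => m; exists m. Qed.

Lemma set_max (A : {set 'I_n}) x : x \in A ->
  exists2 m, m \in A & forall y, y \in A -> (y <= m)%N.
Proof. by move=> xA; case: (arg_maxnP (fun y : 'I_n => val y) xA) => m; exists m. Qed.

Lemma block_bounds P D x : partition P D -> x \in D ->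
  exists U m M, [/\ U \in P, x \in U, m \in U, M \in U
    & forall y, y \in U -> (m <= y <= M)%N].
Proof.
move=> /and3P[/eqP <- tP _] /bigcupP[U UP xU].
have [m mU hm] := set_min xU; have [M MU hM] := set_max xU.
by exists U, m, M; split=> // y yU; rewrite hm ?hM.
Qed.

End Crossings.

(** * Duality between a partition and its complement, and the block count *)

Section Kreweras.
Variable n : nat.
Implicit Types (P Q : {set {set 'I_n}}) (U V D : {set 'I_n}) (i j x y a b c d : 'I_n).

Lemma krel_block P U i m M : nc [set: 'I_n] P -> U \in P -> m \in U -> M \in U ->
  (forall x, x \in U -> m <= x <= M)%N -> i.+1 = m :> nat -> krel P i M.
Proof.
move=> ncP UP mU MU bd im; apply/krelP => x y.
by apply: (sep_block ncP UP mU MU bd); lia.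
Qed.

(** The two barred points are the ends of the gap, read cyclically, of the block of i that contains
    j. They are joined in the complement because no other block of a non-crossing partition leaves
    such a gap. *)
Lemma krel_separates P i j : nc [set: 'I_n] P -> (i < j)%N -> ~~ same_block P i j ->
  exists a b, krel P a b /\ sep a i j != sep b i j.
Proof.
move=> ncP ij; have /andP[pP _] := ncP; have /and3P[_ tP _] := pP.
have [U [m [M [UP iU mU MU bd]]]] := block_bounds pP (in_setT i).
rewrite (same_blockE _ tP UP iU) => jU.
have iUj : i \in [set x in U | (x < j)%N] by rewrite inE iU.
have [u] := set_max iUj; rewrite inE => /andP[uU uj] hu.
have iu : (i <= u)%N := hu i iUj.
have [hex|/existsPn hno] := boolP [exists x, (x \in U) && (j < x)%N].
  case/existsP: hex => x0 hx0.
  have x0U : x0 \in [set x in U | (j < x)%N] by rewrite inE.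
  have [u'] := set_min x0U; rewrite inE => /andP[u'U ju'] hu'.
  (* The gap of U around j runs from u to u', with barred ends u and u' - 1. *)
  have yn : (u'.-1 < n)%N := leq_ltn_trans (leq_pred _) (ltn_ord _).
  exists u, (Ordinal yn); split; last by move: iu uj ju'; clear; rewrite /sep /=; lia.
  have gap z : z \in U -> (z <= u)%N || (u' <= z)%N.
    move=> zU; have [zj|jz] := ltnP z j; first by rewrite hu // inE zU.
    rewrite hu' ?orbT // inE zU ltn_neqAle jz andbT.
    by apply: contraNneq jU => /val_inj ->.
  apply/krelP => a b sab.
  have [aU|aU] := boolP (a \in U).
    have bU : b \in U by rewrite -(same_blockE _ tP UP aU).
    by move: (gap a aU) (gap b bU) iu uj ju'; clear; rewrite /sep /=; lia.
  have bU : b \notin U.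
    by apply: contra aU => bU; rewrite -(same_blockE _ tP UP bU) same_blockC.
  have nua : ~~ same_block P u a by rewrite (same_blockE _ tP UP uU).
  have := nc_sep ncP (same_block_in UP uU u'U) sab nua.
  have : u' != a by apply: contraNneq aU => <-.
  have : u' != b by apply: contraNneq bU => <-.
  by move: ju'; clear; rewrite -!val_eqE /= /sep /=; lia.
have uM : u = M.
  apply/val_inj/eqP; rewrite eqn_leq; have /andP[_ ->] := bd u uU; apply: hu.
  rewrite inE MU ltn_neqAle /= leqNgt; have := hno M; rewrite MU /= => ->.
  by rewrite andbT; apply: contraNneq jU => /val_inj <-.
subst u; have /andP[mi _] := bd i iU.
(* U lies entirely before j, so the gap goes round the circle: its ends are the last element of U
   and the barred point before m, which for m = 0 is the last barred point. *)
have [m0|m0] := posnP m.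
  have yn : (n.-1 < n)%N by rewrite ltn_predL (leq_ltn_trans (leq0n i)).
  exists M, (Ordinal yn); split; last first.
    by rewrite /sep /=; have := ltn_ord j; have := ltn_ord i; lia.
  apply/krelP => a b sab.
  have [aU|aU] := boolP (a \in U).
    have bU : b \in U by rewrite -(same_blockE _ tP UP aU).
    by move: (bd a aU) (bd b bU) (ltn_ord a) (ltn_ord b); clear; rewrite /sep /=; lia.
  have bU : b \notin U.
    by apply: contra aU => bU; rewrite -(same_blockE _ tP UP bU) same_blockC.
  have nua : ~~ same_block P m a by rewrite (same_blockE _ tP UP mU).
  have := nc_sep ncP (same_block_in UP mU MU) sab nua.
  have : m != a by apply: contraNneq aU => <-.
  have : m != b by apply: contraNneq bU => <-.
  move: m0 (ltn_ord a) (ltn_ord b); clear.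
  by rewrite -!val_eqE /= /sep /=; lia.
have yn : (m.-1 < n)%N := leq_ltn_trans (leq_pred _) (ltn_ord _).
exists (Ordinal yn), M; split; last by move: m0 mi iu ij uj; clear; rewrite /sep /=; lia.
by apply: (krel_block ncP UP mU MU bd); rewrite /= prednK.
Qed.

(* P is recovered from its Kreweras relation by the dual separation rule. *)
Lemma same_block_dual P i j : nc [set: 'I_n] P ->
  reflect (forall a b, krel P a b -> sep a i j = sep b i j) (same_block P i j).
Proof.
move=> ncP; apply: (iffP idP) => [sij a b /krelP|h]; first by apply.
have /andP[pP _] := ncP.
apply: contraT => nij.
have ij : i != j by apply: contraNneq nij => ->; rewrite (same_block_refl _ pP) inE.
have [ltij|ltji|eij] := ltngtP i j; last by case/eqP: ij; apply: val_inj.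
  by have [a [b [/h -> /eqP]]] := krel_separates ncP ltij nij.
have nji : ~~ same_block P j i by rewrite same_blockC.
have [a [b [/h + /eqP]]] := krel_separates ncP ltji nji.
by rewrite /sep addbC [in X in _ = X -> _]addbC.
Qed.

Lemma kr_inj P Q : nc [set: 'I_n] P -> nc [set: 'I_n] Q ->
  kr setT P = kr setT Q -> P = Q.
Proof.
move=> ncP ncQ e; have /andP[pP _] := ncP; have /andP[pQ _] := ncQ.
have ek a b : krel P a b = krel Q a b.
  by have := same_block_kr setT P a b; rewrite e same_block_kr !inE.
apply: (same_block_inj pP pQ) => x y.
by apply/(same_block_dual _ _ ncP)/(same_block_dual _ _ ncQ) => h a b;
  [rewrite -ek|rewrite ek]; apply: h.
Qed.

(* [leads val P] and [leads (fun z => n - z) P] single out the first and the last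
   elements of the blocks of P. *)
Definition leads (f : 'I_n -> nat) P x := [forall y, same_block P x y ==> (f x <= f y)%N].

Lemma card_leads (f : 'I_n -> nat) P : injective f -> partition P [set: 'I_n] ->
  #|P| = #|[set x | leads f P x]|.
Proof.
move=> injf pP; have /and3P[/eqP cP tP n0] := pP.
have cPx x : x \in cover P by rewrite cP inE.
have blk x : pblock P x \in P by rewrite pblock_mem.
have eP : pblock P @: [set x | leads f P x] = P.
  apply/setP => U; apply/imsetP/idP => [[x _ ->] //|UP].
  have [x0 x0U] : exists x, x \in U.
    by apply/set0Pn; apply: contraNneq n0 => <-.
  case: (arg_minnP f x0U) => m mU hm; exists m; last by rewrite (def_pblock tP UP mU).
  rewrite inE; apply/forallP => y; apply/implyP.
  by rewrite (same_blockE _ tP UP mU) => /hm.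
rewrite -{1}eP card_in_imset // => x y; rewrite !inE => /forallP hx /forallP hy e.
have xU : x \in pblock P x by rewrite mem_pblock.
have yU : y \in pblock P x by rewrite e mem_pblock.
apply: injf; apply/eqP; rewrite eqn_leq.
by rewrite (implyP (hx y)) ?(implyP (hy x)) //; apply: (same_block_in (blk x)).
Qed.

End Kreweras.

(** If x begins its block, the barred point before x is joined to the last element of that block.
    Conversely, a barred i joined to a later j encloses x in a union of blocks whose least element
    is x. *)
Lemma krel_leads n (P : {set {set 'I_n}}) (i x : 'I_n) : nc [set: 'I_n] P ->
  i.+1 = x :> nat -> leads val P x = ~~ leads (fun z => n - z)%N (kr setT P) i.
Proof.
move=> ncP ix; have /andP[pP _] := ncP.
apply/idP/idP => [/forallP h|/forallPn[j]].
  have [U [m [M [UP xU mU MU bd]]]] := block_bounds pP (in_setT x).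
  have xm : x = m.
    apply/val_inj/eqP; rewrite eqn_leq; have /andP[-> _] := bd x xU.
    by rewrite andbT; apply: (implyP (h m)); apply: (same_block_in UP).
  subst m; apply/forallPn; exists M; rewrite negb_imply same_block_kr !inE.
  rewrite (krel_block ncP UP mU MU bd ix) /=.
  by have := bd x xU; have := ltn_ord M; lia.
rewrite negb_imply same_block_kr !inE /= => /andP[/krelP kij hlt].
apply/forallP => y; apply/implyP => xy; have := kij _ _ xy.
by rewrite /sep; have := ltn_ord i; have := ltn_ord j; lia.
Qed.

Lemma card_setE (T : finType) (p : pred T) : #|[set x | p x]| = (\sum_x p x)%N.
Proof.
by rewrite -sum1_card big_mkcond; apply: eq_bigr => x _; rewrite inE; case: (p x).
Qed.

(** The first point always begins its block and the last barred point always ends its own, which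
    accounts for 2. The others form n pairs, a barred point and the point after it, and each pair
    contributes exactly 1 by [krel_leads]. *)
Lemma card_kr n (P : {set {set 'I_n.+1}}) : nc [set: 'I_n.+1] P ->
  (#|P| + #|kr setT P| = n.+2)%N.
Proof.
move=> ncP; have /andP[pP _] := ncP.
have inj1 : injective (val : 'I_n.+1 -> nat) by apply: val_inj.
have inj2 : injective (fun z : 'I_n.+1 => n.+1 - z)%N.
  move=> x y e; apply: val_inj; move: (ltn_ord x) (ltn_ord y) e; clear => /=; lia.
rewrite (card_leads inj1 pP) (card_leads inj2 (kr_partition _ _)) !card_setE.
rewrite big_ord_recl [in X in (_ + X)%N]big_ord_recr /=.
have -> : leads val P ord0 by apply/forallP => y; apply/implyP.
have -> : leads (fun z : 'I_n.+1 => n.+1 - z)%N (kr setT P) ord_max.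
  apply/forallP => y; apply/implyP => _ /=.
  by apply: leq_sub2l; rewrite -ltnS.
rewrite add1n addn1 addSn addnS -big_split /= -[n in RHS]card_ord -sum1_card.
congr _.+2; apply: eq_bigr => i _.
rewrite (@krel_leads _ P (widen_ord (leqnSn n) i) (lift ord0 i) ncP) //.
by case: (leads _ (kr _ _) _).
Qed.

(** * Complements relative to a coarser partition *)

Section Relative.
Variable n : nat.
Implicit Types (P Q p s t : {set {set 'I_n}}) (U V D : {set 'I_n}) (i j x y a b c d : 'I_n).
Local Notation setI := [set: 'I_n].

Lemma refinesP D P Q : partition P D -> trivIset Q -> reflect
  (forall x y, same_block P x y -> same_block Q x y) (refines P Q).
Proof.
move=> /and3P[_ tP n0] tQ; apply: (iffP forall_inP) => h.
  move=> x y /same_blockP[U [UP xU yU]]; have /exists_inP[V VQ /subsetP UV] := h U UP.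
  by apply: (same_block_in VQ); apply: UV.
move=> U UP; have [x xU] : exists x, x \in U.
  by apply/set0Pn; apply: contraNneq n0 => <-.
have /h /same_blockP[V [VQ xV _]] := same_block_in UP xU xU.
apply/exists_inP; exists V => //; apply/subsetP => y yU.
by rewrite -(same_blockE _ tQ VQ xV); apply/h/(same_block_in UP).
Qed.

(* The Kreweras complement of s taken separately inside each block of p. *)
Definition rel_krel p s x y : bool := same_block p x y &&
  [forall a, forall b, same_block p x a && same_block s a b ==> (sep x a b == sep y a b)].

Lemma rel_krelP p s x y : reflect
  (same_block p x y /\
   forall a b, same_block p x a -> same_block s a b -> sep x a b = sep y a b)
  (rel_krel p s x y).
Proof.
apply: (iffP andP) => -[pxy h]; split=> //.
  by move=> a b xa ab; have /forallP/(_ a)/forallP/(_ b) := h; rewrite xa ab => /eqP.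
by apply/forallP => a; apply/forallP => b; apply/implyP => /andP[xa ab]; rewrite h.
Qed.

Lemma rel_krel_equiv p s : partition p setI -> equivalence_rel (rel_krel p s).
Proof.
move=> pp x y z; have /and3P[_ tp _] := pp; split.
  by apply/rel_krelP; rewrite (same_block_refl _ pp) inE.
move=> /rel_krelP[pxy h]; apply/rel_krelP/rel_krelP => -[pxz h']; split.
- by apply: (same_block_trans tp) pxz; rewrite same_blockC.
- move=> a b ya ab; have xa := same_block_trans tp pxy ya.
  by rewrite -h // h'.
- exact: (same_block_trans tp) pxz.
- move=> a b xa ab; rewrite h //; apply: h' => //.
  by apply: (same_block_trans tp) xa; rewrite same_blockC.
Qed.

Definition rel_kr p s := equivalence_partition (rel_krel p s) setI.

Lemma same_block_rel_kr p s x y : partition p setI ->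
  same_block (rel_kr p s) x y = rel_krel p s x y.
Proof.
by move=> pp; rewrite same_block_equivalence_partition ?inE //; apply: rel_krel_equiv.
Qed.

Lemma rel_kr_nc p s : nc setI p -> nc setI (rel_kr p s).
Proof.
move=> ncp; have /andP[pp cp] := ncp; have /and3P[_ tp _] := pp.
rewrite /nc partition_equivalence /=; last exact: rel_krel_equiv.
apply: crossfree_rel; first exact: rel_krel_equiv.
move=> a b c d ab bc cd /rel_krelP[pac hac] /rel_krelP[pbd hbd].
have pab : same_block p a b.
  have [U [UP aU cU]] := same_blockP _ _ _ pac.
  have [V [VP bV dV]] := same_blockP _ _ _ pbd.
  have UV := crossfreeP _ cp _ _ _ _ _ _ UP VP aU bV cU dV ab bc cd.
  by rewrite (same_blockE _ tp UP aU) UV.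
apply/rel_krelP; split=> // x y ax xy; apply: (sep_cross ab bc cd); auto.
by apply: hbd => //; apply: (same_block_trans tp) ax; rewrite same_blockC.
Qed.

(** Pairs inside the block of p containing x and y are covered by [rel_krel]; for pairs in another
    block, p being non-crossing gives the equality. *)
Lemma rel_krel_krel p s x y : nc setI p ->
  (forall a b, same_block s a b -> same_block p a b) ->
  rel_krel p s x y -> krel s x y.
Proof.
move=> ncp le /rel_krelP[pxy h]; apply/krelP => a b sab.
have [xa|xa] := boolP (same_block p x a); first exact: h.
exact: (nc_sep ncp pxy (le _ _ sab) xa).
Qed.

(** For the converse, suppose that a pair x, y in a block V of p has exactly one member in (i, j].
    Then V has a gap over i or over j. The element of V before that gap is joined in K_p(s) to the
    last element of the block of s that starts after the gap. This pair also has exactly one member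
    in (i, j], against the assumption. *)
Lemma krel_rel_krel p s i j : nc setI p -> nc setI s ->
  (forall a b, same_block s a b -> same_block p a b) ->
  krel p i j = rel_krel (kr setI s) (rel_kr p s) i j.
Proof.
move=> ncp ncs le; have /andP[pp _] := ncp; have /and3P[_ tp _] := pp.
have /andP[ps _] := ncs.
apply/krelP/rel_krelP => [h|].
  split; first by rewrite same_block_kr !inE; apply/krelP => x y /le /h.
  by move=> a b _; rewrite same_block_rel_kr // => /rel_krelP[/h].
wlog ij : i j / (i < j)%N => [W [kij h]|[kij h]].
  have [|ji|] := ltngtP i j; first by move/W; apply.
    move=> x y pxy; symmetry; apply: (W j i) => //; split; first by rewrite same_blockC.
    move=> a b ja ab; symmetry; apply: h => //.
    by apply: same_block_trans ja => //; have /and3P[] := kr_partition setI s.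
  by move/val_inj ->.
move=> x y pxy; move: kij; rewrite same_block_kr !inE => /= /krelP kij.
have {}h a b : krel s i a -> rel_krel p s a b -> sep i a b = sep j a b.
  by move=> ia ab; apply: h; rewrite ?same_block_kr ?inE // same_block_rel_kr.
apply/eqP; apply: contraT => ne.
(* Exactly one of x and y lies in (i, j]; call it x. *)
wlog [xi xj] : x y pxy ne / ((i < x)%N /\ (x <= j)%N) => [W|].
  have [xij|xij] := boolP ((i < x)%N && (x <= j)%N).
    by apply: (W x y) => //; apply/andP.
  apply: (W y x); rewrite 1?same_blockC //.
    by move: ne; rewrite /sep addbC [in X in _ != X]addbC.
  by move: ne ij xij; clear; rewrite /sep; lia.
have yij : ~~ ((i < y)%N && (y <= j)%N).
  by move: ne ij xi xj; clear; rewrite /sep; lia.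
have /same_blockP[V [VP xV yV]] := pxy.
have inV U z : U \in s -> z \in U -> z \in V -> {subset U <= V}.
  move=> Us zU zV w wU; rewrite -(same_blockE _ tp VP zV).
  exact/le/(same_block_in Us).
(* The last premise says that no element of V lies strictly between a and m, so that, seen from V,
   the barred point a sits just before U. *)
have relV a U m M : a \in V -> U \in s -> U \subset V -> m \in U -> M \in U ->
    (forall z, z \in U -> m <= z <= M)%N -> (a < m)%N ->
    (forall z, z \in V -> (z <= a)%N || (m <= z)%N) -> rel_krel p s a M.
  move=> aV Us /subsetP UV mU MU bd am gap.
  have pV z : same_block p a z = (z \in V) by rewrite (same_blockE _ tp VP aV).
  apply/rel_krelP; rewrite pV UV //; split=> // c d; rewrite pV => cV scd.
  have dV : d \in V.
    rewrite -pV; apply: (same_block_trans tp) (le _ _ scd).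
    by rewrite pV.
  exact: (sep_block ncs Us mU MU bd am (gap c cV) (gap d dV) scd).
(* If V has elements up to i, its gap over i runs from b to m. *)
have [hex|/existsPn hno] := boolP [exists z, (z \in V) && (z <= i)%N].
  have /existsP[z0 z0V] := hex.
  have z0A : z0 \in [set z in V | (z <= i)%N] by rewrite inE.
  have [b] := set_max z0A; rewrite inE => /andP[bV bi] hb.
  have xA : x \in [set z in V | (i < z)%N] by rewrite inE xV.
  have [m] := set_min xA; rewrite inE => /andP[mV im] hm.
  have [U [m' [M [Us mU m'U MU bd]]]] := block_bounds ps (in_setT m).
  have UV := inV _ _ Us mU mV.
  have Uij z : z \in U -> (i < z <= j)%N.
    move=> zU; have mj : (m <= j)%N by apply: leq_trans xj; apply: hm; rewrite inE xV.
    have := kij _ _ (same_block_in Us mU zU).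
    by move: im mj ij; clear; rewrite /sep; lia.
  have em : m' = m.
    apply/val_inj/eqP; rewrite eqn_leq; have /andP[-> _] /= := bd m mU.
    by apply: hm; rewrite inE UV //; have /andP[-> _] := Uij m' m'U.
  subst m'.
  have rbM : rel_krel p s b M.
    apply: (relV b U m M) => //; first exact/subsetP.
      by apply: leq_ltn_trans im.
    move=> z zV; have [zi|iz] := leqP z i; first by rewrite hb ?inE ?zV.
    by rewrite hm ?orbT // inE zV.
  have kbM := rel_krel_krel ncp le rbM.
  have /andP[iM Mj] := Uij M MU.
  have kiM : krel s i M.
    apply/krelP => c d scd; have := kij _ _ scd; move/krelP/(_ c d scd): kbM.
    by move: bi iM Mj ij; clear; rewrite /sep; lia.
  have rMb : rel_krel p s M b.
    by have [_ <-] := rel_krel_equiv s pp b M b; have [->] := rel_krel_equiv s pp b b b.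
  have := h M b kiM rMb.
  by move: bi iM Mj ij; clear; rewrite /sep; lia.
(* Now V lies beyond i, so y lies beyond j, and the gap of V over j is used instead. *)
have jV z : z \in V -> (i < z)%N.
  by move=> zV; have := hno z; rewrite zV /= -ltnNge.
have jy : (j < y)%N by move: yij; rewrite jV //= ltnNge.
have yA : y \in [set z in V | (j < z)%N] by rewrite inE yV.
have [m] := set_min yA; rewrite inE => /andP[mV jm] hm.
have xA : x \in [set z in V | (z <= j)%N] by rewrite inE xV.
have [a] := set_max xA; rewrite inE => /andP[aV aj] ha.
have [U [m' [M [Us mU m'U MU bd]]]] := block_bounds ps (in_setT m).
have UV := inV _ _ Us mU mV.
have Uj z : z \in U -> (j < z)%N.
  move=> zU; have := kij _ _ (same_block_in Us mU zU); have := jV z (UV z zU).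
  by move: jm ij; clear; rewrite /sep; lia.
have em : m' = m.
  apply/val_inj/eqP; rewrite eqn_leq; have /andP[-> _] /= := bd m mU.
  by apply: hm; rewrite inE UV //; apply: Uj.
subst m'.
have raM : rel_krel p s a M.
  apply: (relV a U m M) => //; first exact/subsetP.
    exact: leq_ltn_trans jm.
  move=> z zV; have [zj|jz] := leqP z j; first by rewrite ha ?inE ?zV.
  by rewrite hm ?orbT // inE zV.
have kaM := rel_krel_krel ncp le raM.
have jM := Uj M MU; have ia := jV a aV.
have kia : krel s i a.
  apply/krelP => c d scd; have := kij _ _ scd; move/krelP/(_ c d scd): kaM.
  by move: ia aj jM ij; clear; rewrite /sep; lia.
have := h a M kia raM.
by move: ia aj jM ij; clear; rewrite /sep; lia.
Qed.

Lemma kr_rel_kr p s : nc setI p -> nc setI s -> refines s p ->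
  rel_kr (kr setI s) (rel_kr p s) = kr setI p.
Proof.
move=> ncp ncs; have /andP[pp _] := ncp; have /andP[ps _] := ncs.
have /and3P[_ tp _] := pp => /(refinesP ps tp) le.
have pk := kr_partition setI s.
apply: (@same_block_inj _ _ _ setI).
- exact/partition_equivalence/rel_krel_equiv.
- exact: kr_partition.
by move=> x y; rewrite same_block_rel_kr // same_block_kr !inE /= -krel_rel_krel.
Qed.

Lemma rel_kr_refines p s : nc setI p -> nc setI s -> refines s p ->
  refines (rel_kr p s) (kr setI s).
Proof.
move=> ncp ncs; have /andP[pp _] := ncp; have /andP[ps _] := ncs.
have /and3P[_ tp _] := pp => /(refinesP ps tp) le.
have /and3P[_ tk _] := kr_partition setI s.
apply/(refinesP _ tk); first exact/partition_equivalence/rel_krel_equiv.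
move=> x y; rewrite same_block_rel_kr // same_block_kr !inE /=.
exact: rel_krel_krel.
Qed.

End Relative.

(** * Convolution over sets of positions and its associativity *)

Section SetBox.
Variables (n : nat) (R : comPzRingType).
Implicit Types (P Q p s t : {set {set 'I_n}}) (U V D : {set 'I_n}) (i j x y a b c d : 'I_n)
  (F G H : {set 'I_n} -> R).
Local Notation setI := [set: 'I_n].

(* Boxed convolution on functions of sets of positions: nesting it never leaves
   the fixed ambient type 'I_n, unlike subwords of subwords. *)
Definition setbox F G V : R :=
  \sum_(Q | nc V Q) (\prod_(U in Q) F U) * \prod_(U in kr V Q) G U.

Lemma restrict_partition p t V : partition p setI -> partition t setI ->
  refines t p -> V \in p -> partition (t ::&: V) V.
Proof.
move=> pp pt /forall_inP le Vp; have /and3P[_ tp _] := pp; have /and3P[/eqP ct tt n0] := pt.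
apply/and3P; split; last 2 first.
- exact: trivIsetI.
- by rewrite inE (negbTE n0).
rewrite eqEsubset; apply/andP; split; apply/subsetP => x.
  by move=> /bigcupP[U]; rewrite inE => /andP[_ /subsetP UV] /UV.
move=> xV; have : x \in cover t by rewrite ct inE.
move=> /bigcupP[U Ut xU]; apply/bigcupP; exists U => //; rewrite inE Ut /=.
have /exists_inP[W Wp UW] := le U Ut.
by rewrite -(def_pblock tp Vp xV) (def_pblock tp Wp) // (subsetP UW).
Qed.

Lemma same_block_restrict p t V x y : trivIset p -> refines t p -> V \in p ->
  same_block (t ::&: V) x y = [&& x \in V, y \in V & same_block t x y].
Proof.
move=> tp /forall_inP le Vp; apply/same_blockP/and3P => [[U []]|[xV yV]].
  rewrite inE => /andP[Ut /subsetP UV] xU yU; split; [exact: UV|exact: UV|].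
  exact: (same_block_in Ut).
move=> /same_blockP[U [Ut xU yU]]; exists U; split=> //; rewrite inE Ut.
have /exists_inP[W Wp UW] := le U Ut.
by rewrite -(def_pblock tp Vp xV) (def_pblock tp Wp) // (subsetP UW).
Qed.

Lemma big_restrict p t (G : {set 'I_n} -> R) : partition p setI -> partition t setI ->
  refines t p -> \prod_(V in p) \prod_(U in t ::&: V) G U = \prod_(U in t) G U.
Proof.
move=> pp pt /forall_inP le; have /and3P[_ tp _] := pp; have /and3P[_ _ n0] := pt.
rewrite (exchange_big_dep [in t]) /=; last by move=> V U _; rewrite inE => /andP[].
apply: eq_bigr => U Ut; have /exists_inP[W Wp UW] := le U Ut.
have [x xU] : exists x, x \in U by apply/set0Pn; apply: contraNneq n0 => <-.
rewrite (big_pred1 W) // => V /=; rewrite inE Ut /=; apply/andP/eqP => [[Vp UV]|->] //.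
rewrite -(def_pblock tp Vp (subsetP UV x xU)).
by rewrite (def_pblock tp Wp (subsetP UW x xU)).
Qed.

(** For x in V the pairs tested by [rel_krel] belong to blocks of s inside V, and these are the
    blocks of the restriction. *)
Lemma rel_kr_restrict p s V : nc setI p -> nc setI s -> refines s p -> V \in p ->
  rel_kr p s ::&: V = kr V (s ::&: V).
Proof.
move=> ncp ncs le Vp; have /andP[pp _] := ncp; have /and3P[_ tp _] := pp.
have pr : partition (rel_kr p s) setI by apply/partition_equivalence/rel_krel_equiv.
have ler : refines (rel_kr p s) p.
  by apply/(refinesP pr tp) => x y; rewrite same_block_rel_kr // => /rel_krelP[].
apply: (@same_block_inj _ _ _ V).
- exact: restrict_partition ler Vp.
- exact: kr_partition.
move=> x y; rewrite (same_block_restrict _ _ tp ler Vp) same_block_kr same_block_rel_kr //.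
have [xV|//] := boolP (x \in V); have [yV|//] := boolP (y \in V); rewrite /=.
apply/rel_krelP/krelP => [[_ h] a b|h].
  rewrite (same_block_restrict _ _ tp le Vp) => /and3P[aV bV]; apply: h.
  exact: (same_block_in Vp).
split=> [|a b xa ab]; first exact: (same_block_in Vp).
apply: h; rewrite (same_block_restrict _ _ tp le Vp) ab.
have aV : a \in V by rewrite -(same_blockE _ tp Vp xV).
rewrite aV -(same_blockE _ tp Vp xV) andbT /=; apply: (same_block_trans tp xa).
have /andP[ps _] := ncs; exact/(refinesP ps tp).
Qed.

(** Gluing creates no crossing: if two blocks of s cross, so do the blocks of p around them, which
    therefore coincide, and the crossing already occurs inside one block of p. *)
Lemma nc_restrict p s : nc setI p -> refines s p ->
  [forall V in p, nc V (s ::&: V)] = nc setI s.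
Proof.
move=> ncp le; have /andP[pp cp] := ncp; have /and3P[/eqP covp tp _] := pp.
apply/forall_inP/andP => [h|[ps cs] V Vp].
  have sV U : U \in s -> exists2 V, V \in p & U \in s ::&: V.
    move=> Us; have /exists_inP[V Vp UV] := forall_inP le U Us; exists V => //.
    by rewrite inE Us.
  have pV x : exists2 V, V \in p & x \in V.
    have : x \in cover p by rewrite covp inE.
    by case/bigcupP => V; exists V.
  have inV V V' W x : V \in p -> V' \in p -> x \in V -> x \in V' ->
      W \in s ::&: V' -> W \in s ::&: V.
    by move=> Vp V'p xV xV'; rewrite -(def_pblock tp Vp xV) (def_pblock tp V'p xV').
  split.
    apply/and3P; split.
    - rewrite eqEsubset subsetT; apply/subsetP => x _; have [V Vp xV] := pV x.
      have /andP[/and3P[/eqP cV _ _] _] := h V Vp; rewrite -cV in xV.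
      have /bigcupP[U] := xV; rewrite inE => /andP[Us _] xU.
      by apply/bigcupP; exists U.
    - apply/trivIsetP => U W Us Ws; apply: contraR => /pred0Pn[x /andP[xU xW]].
      have [V Vp UV] := sV U Us; have [V' V'p WV] := sV W Ws.
      have xV : x \in V by move: UV; rewrite inE => /andP[_ /subsetP]; apply.
      have xV' : x \in V' by move: WV; rewrite inE => /andP[_ /subsetP]; apply.
      have WV2 := inV _ _ _ _ Vp V'p xV xV' WV.
      have /andP[/and3P[_ tV _] _] := h V Vp.
      by rewrite -(def_pblock tV UV xU) (def_pblock tV WV2 xW).
    - apply/negP => s0; have [V Vp V0] := sV _ s0.
      by have /andP[/and3P[_ _ /negP]] := h V Vp.
  apply/crossfreeP => U W a b c d Us Ws aU bW cU dW ab bc cd.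
  have [V Vp UV] := sV U Us; have [V' V'p WV] := sV W Ws.
  have subV z : z \in U -> z \in V by move: UV z; rewrite inE => /andP[_ /subsetP].
  have subV' z : z \in W -> z \in V' by move: WV z; rewrite inE => /andP[_ /subsetP].
  have VV : V = V' := crossfreeP _ cp _ _ _ _ _ _ Vp V'p
    (subV a aU) (subV' b bW) (subV c cU) (subV' d dW) ab bc cd.
  rewrite -VV in WV; have /andP[_ cV] := h V Vp.
  exact: (crossfreeP _ cV _ _ _ _ _ _ UV WV aU bW cU dW ab bc cd).
rewrite /nc (restrict_partition pp ps le Vp) /=; apply/crossfreeP => U W a b c d.
by rewrite !inE => /andP[Us _] /andP[Ws _]; apply: (crossfreeP _ cs).
Qed.

(** Expanding the product gives one term for each family of non-crossing partitions of the blocks of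
    p. Restriction and union match these families with the non-crossing partitions s below p. *)
Lemma big_nc_distr p (E : {set 'I_n} -> {set {set 'I_n}} -> R) : nc setI p ->
  \prod_(V in p) (\sum_(Q | nc V Q) E V Q) =
  \sum_(s | nc setI s && refines s p) \prod_(V in p) E V (s ::&: V).
Proof.
move=> ncp; have /andP[pp _] := ncp; have /and3P[_ tp _] := pp.
(* Off p the families take the default value [set0] used by the distributivity lemma. *)
pose res s : {ffun {set 'I_n} -> {set {set 'I_n}}} :=
  [ffun V => if V \in p then s ::&: V else set0].
pose glue (f : {ffun {set 'I_n} -> {set {set 'I_n}}}) := \bigcup_(V in p) f V.
rewrite (big_distr_big_dep set0) (reindex_onto res glue) /=; last first.
  move=> f /pfamilyP[supf ncf]; apply/ffunP => V; rewrite ffunE.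
  case: ifP => Vp; last first.
    by apply/esym/eqP/negPn/negP => fV; have := subsetP supf V; rewrite inE fV Vp => /(_ isT).
  apply/setP => U; rewrite !inE; apply/andP/idP => [[/bigcupP[W Wp UW] UV]|UV].
    suff -> : V = W by [].
    have /andP[/and3P[/eqP cW _ nW] _] := ncf W Wp.
    have [x xU] : exists x, x \in U by apply/set0Pn; apply: contraNneq nW => <-.
    rewrite -(def_pblock tp Vp (subsetP UV x xU)) (def_pblock tp Wp) //.
    by rewrite -cW; apply/bigcupP; exists U.
  split; first by apply/bigcupP; exists V.
  have /andP[/and3P[/eqP <- _ _] _] := ncf V Vp; exact: bigcup_sup.
have resE s V : V \in p -> res s V = s ::&: V by move=> Vp; rewrite ffunE Vp.
have glueE s : (glue (res s) == s) = refines s p.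
  apply/eqP/forall_inP => [<- U /bigcupP[V Vp]|le].
    by rewrite resE // inE => /andP[_ UV]; apply/exists_inP; exists V.
  apply/setP => U; apply/bigcupP/idP => [[V Vp]|Us].
    by rewrite resE // inE => /andP[].
  have /exists_inP[V Vp UV] := le U Us; exists V => //.
  by rewrite resE // inE Us.
apply: eq_big => [s|s _]; last by apply: eq_bigr => V Vp; rewrite resE.
rewrite glueE andbC [RHS]andbC; have [le|//] := boolP (refines s p); rewrite /=.
rewrite -(nc_restrict ncp le); apply/pfamilyP/forall_inP => [[_ h] V Vp|h].
  by have := h V Vp; rewrite resE.
split=> [|V Vp]; last by rewrite resE //; apply: h.
by apply/subsetP => V; rewrite inE ffunE; case: ifP => //; rewrite eqxx.
Qed.

(** This brings relative complements into associativity: the blockwise complements of the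
    restrictions of s assemble to [rel_kr p s]. *)
Lemma prod_setbox p F G : nc setI p ->
  \prod_(V in p) setbox F G V =
  \sum_(s | nc setI s && refines s p)
    (\prod_(U in s) F U) * \prod_(U in rel_kr p s) G U.
Proof.
move=> ncp; rewrite /setbox big_nc_distr //; apply: eq_bigr => s /andP[ncs le].
have /andP[pp _] := ncp; have /andP[ps _] := ncs; have /and3P[_ tp _] := pp.
have pr : partition (rel_kr p s) setI by apply/partition_equivalence/rel_krel_equiv.
have ler : refines (rel_kr p s) p.
  by apply/(refinesP pr tp) => x y; rewrite same_block_rel_kr // => /rel_krelP[].
rewrite big_split /=; congr (_ * _); first exact: big_restrict.
rewrite -(big_restrict _ pp pr ler); apply: eq_bigr => V Vp.
by rewrite rel_kr_restrict.
Qed.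

(* The pairs (s, p) with s <= p embed into the pairs (s, t) with t <= kr s by
   t = rel_kr p s; since kr is injective, there are at least as many of the
   former as of the latter, so this embedding is a bijection. *)
Lemma setboxA F G H : setbox (setbox F G) H setI = setbox F (setbox G H) setI.
Proof.
rewrite /setbox -/(setbox F G) -/(setbox G H).
pose S1 := [set x : {set {set 'I_n}} * {set {set 'I_n}} |
  [&& nc setI x.1, nc setI x.2 & refines x.1 x.2]].
pose S2 := [set x : {set {set 'I_n}} * {set {set 'I_n}} |
  [&& nc setI x.1, nc setI x.2 & refines x.2 (kr setI x.1)]].
pose phi (x : {set {set 'I_n}} * {set {set 'I_n}}) := (x.1, rel_kr x.2 x.1).
pose psi (x : {set {set 'I_n}} * {set {set 'I_n}}) := (x.2, kr setI x.1).
have phi_inj : {in S1 &, injective phi}.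
  move=> [s p] [s' p']; rewrite !inE /= => /and3P[ns np le] /and3P[ns' np' le'] [es et].
  subst s'; congr (_, _); apply: kr_inj => //.
  by rewrite -(kr_rel_kr np ns le) -(kr_rel_kr np' ns le') et.
have psi_inj : {in S2 &, injective psi}.
  move=> [s t] [s' t']; rewrite !inE /= => /and3P[ns _ _] /and3P[ns' _ _] [-> ek].
  by congr (_, _); apply: kr_inj.
have phiS : phi @: S1 = S2.
  apply/eqP; rewrite eqEcard; apply/andP; split.
    apply/subsetP => _ /imsetP[[s p] + ->]; rewrite !inE /= => /and3P[ns np le].
    by rewrite ns rel_kr_nc //= rel_kr_refines.
  rewrite card_in_imset // -(card_in_imset psi_inj); apply: subset_leq_card.
  apply/subsetP => _ /imsetP[[s t] + ->]; rewrite !inE /= => /and3P[ns nt le].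
  by rewrite nt kr_nc.
transitivity (\sum_(x in S1) (\prod_(U in x.1) F U) *
    ((\prod_(U in rel_kr x.2 x.1) G U) * \prod_(U in kr setI x.2) H U)).
  rewrite (eq_bigl (fun x : _ * _ => nc setI x.2 && (nc setI x.1 && refines x.1 x.2)));
    last by move=> x; rewrite inE andbCA.
  rewrite (reindex_onto (fun x : _ * _ => (x.2, x.1)) (fun x : _ * _ => (x.2, x.1)));
    last by case.
  rewrite (eq_bigl (fun x : _ * _ => nc setI x.1 && (nc setI x.2 && refines x.2 x.1)));
    last by move=> [x y]; rewrite /= eqxx andbT.
  rewrite -(pair_big_dep (nc setI) (fun p s => nc setI s && refines s p)
     (fun p s => (\prod_(U in s) F U) *
       ((\prod_(U in rel_kr p s) G U) * \prod_(U in kr setI p) H U))) /=.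
  apply: eq_bigr => p np; rewrite prod_setbox // mulr_suml; apply: eq_bigr => s _.
  by rewrite mulrA.
transitivity (\sum_(x in S2) (\prod_(U in x.1) F U) *
    ((\prod_(U in x.2) G U) * \prod_(U in rel_kr (kr setI x.1) x.2) H U)).
  rewrite -phiS big_imset //; apply: eq_bigr => -[s p]; rewrite inE /= => /and3P[ns np le].
  by rewrite kr_rel_kr.
rewrite (eq_bigl (fun x : _ * _ => nc setI x.1 && (nc setI x.2 && refines x.2 (kr setI x.1))));
  last by move=> x; rewrite inE.
rewrite -(pair_big_dep (nc setI) (fun s t => nc setI t && refines t (kr setI s))
     (fun s t => (\prod_(U in s) F U) *
    ((\prod_(U in t) G U) * \prod_(U in rel_kr (kr setI s) t) H U))) /=.
by apply: eq_bigr => s ns; rewrite prod_setbox ?kr_nc // mulr_sumr.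
Qed.

End SetBox.

Lemma noncrossingE n (P : {set {set 'I_n}}) : noncrossing P = nc setT P.
Proof. by []. Qed.

(** * Agreement with the definition by interleaved points *)

Section Images.
Variables (m n : nat) (h : 'I_m -> 'I_n).
Hypothesis h_inj : injective h.
Implicit Types (P : {set {set 'I_m}}) (V : {set 'I_m}).

(** Applied to the even and odd places of the interleaved circle, to embeddings of subwords, and to
    reversal. *)
Definition im P : {set {set 'I_n}} := [set h @: (U : {set 'I_m}) | U in P].

Lemma same_block_im P x y : same_block (im P) (h x) (h y) = same_block P x y.
Proof.
apply/same_blockP/same_blockP => [[_ [/imsetP[U UP ->]]]|[U [UP xU yU]]].
  by rewrite !mem_imset // => xU yU; exists U.
by exists (h @: U); split; [exact: (imset_f (fun U : {set _} => h @: U))| |]; rewrite mem_imset.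
Qed.

Lemma partition_im P V : partition (im P) (h @: V) = partition P V.
Proof. exact: imset_partition. Qed.

Lemma im_inj : injective im.
Proof. exact/imset_inj/imset_inj. Qed.

End Images.

Section Kreweras.
Variable n : nat.
Implicit Types (P Q : {set {set 'I_n}}) (i j x y : 'I_n).

Lemma even_pos_inj : injective (@even_pos n).
Proof. by move=> x y /(congr1 val) /= /double_inj /val_inj. Qed.

Lemma odd_pos_inj : injective (@odd_pos n).
Proof. by move=> x y /(congr1 val) /= [/double_inj /val_inj]. Qed.

Lemma even_odd_pos x i : even_pos x <> odd_pos i.
Proof. by move=> /(congr1 val) /= /(congr1 odd); rewrite /= !odd_double. Qed.

Lemma posP (z : 'I_(n.*2)) : (exists x, z = even_pos x) \/ (exists i, z = odd_pos i).
Proof.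
have hz : (z./2 < n)%N by have := ltn_ord z; lia.
case oz: (odd z); [right|left]; exists (Ordinal hz); apply: val_inj => /=;
by rewrite -[LHS]odd_double_half oz.
Qed.

Lemma same_block_even P Q x y :
  same_block (interleave P Q) (even_pos x) (even_pos y) = same_block P x y.
Proof.
rewrite -(same_block_im even_pos_inj).
apply/same_blockP/same_blockP => -[U [UP xU yU]]; exists U; split=> //.
  case/setUP: UP => // /imsetP[V _ eU]; rewrite eU in xU.
  by case/imsetP: xU => z _ /even_odd_pos.
by rewrite inE; apply/orP; left.
Qed.

Lemma same_block_odd P Q x y :
  same_block (interleave P Q) (odd_pos x) (odd_pos y) = same_block Q x y.
Proof.
rewrite -(same_block_im odd_pos_inj).
apply/same_blockP/same_blockP => -[U [UP xU yU]]; exists U; split=> //.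
  case/setUP: UP => // /imsetP[V _ eU]; rewrite eU in xU.
  by case/imsetP: xU => z _ /esym/even_odd_pos.
by rewrite inE; apply/orP; right.
Qed.

Lemma same_block_odd_even P Q i x :
  same_block (interleave P Q) (odd_pos i) (even_pos x) = false.
Proof.
apply/same_blockP => -[U [/setUP[]/imsetP[V _ ->]]].
  by case/imsetP => z _ /esym/even_odd_pos.
by move=> _ /imsetP[z _ /even_odd_pos].
Qed.

Lemma trivIset_eltP (T : finType) (P : {set {set T}}) :
  (forall A B z, A \in P -> B \in P -> z \in A -> z \in B -> A = B) -> trivIset P.
Proof.
move=> h; apply/trivIsetP => A B AP BP; apply: contraR => /pred0Pn[z /andP[zA zB]].
by rewrite (h A B z).
Qed.

Lemma partition_interleave P Q : partition P setT -> partition Q setT ->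
  partition (interleave P Q) setT.
Proof.
move=> pP pQ; have /and3P[/eqP cP tP nP] := pP; have /and3P[/eqP cQ tQ nQ] := pQ.
apply/and3P; split.
- rewrite eqEsubset subsetT; apply/subsetP => z _.
  have [[x ->]|[i ->]] := posP z.
    have : x \in cover P by rewrite cP inE.
    case/bigcupP => U UP xU; apply/bigcupP; exists (@even_pos n @: U).
      by rewrite inE imset_f.
    exact: imset_f.
  have : i \in cover Q by rewrite cQ inE.
  case/bigcupP => U UP xU; apply/bigcupP; exists (@odd_pos n @: U).
    by rewrite inE [X in _ || X]imset_f ?orbT.
  exact: imset_f.
- have te : trivIset (im (@even_pos n) P) by rewrite imset_trivIset //; apply: even_pos_inj.
  have to : trivIset (im (@odd_pos n) Q) by rewrite imset_trivIset //; apply: odd_pos_inj.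
  apply: trivIset_eltP => A B z /setUP[] AP /setUP[] BP zA zB.
  + by rewrite -(def_pblock te AP zA) (def_pblock te BP zB).
  + case/imsetP: AP zA => U _ -> /imsetP[x _ ->] in zB *.
    by case/imsetP: BP zB => V _ -> /imsetP[y _ /even_odd_pos].
  + case/imsetP: AP zA => U _ -> /imsetP[x _ ->] in zB *.
    by case/imsetP: BP zB => V _ -> /imsetP[y _ /esym/even_odd_pos].
  + by rewrite -(def_pblock to AP zA) (def_pblock to BP zB).
- by rewrite inE !imset0mem negb_or nP nQ.
Qed.

(** A crossing between a block of P and a block of Q consists of a pair of points and a pair of
    barred points, and says that the two barred points separate the pair of points differently. *)
Lemma kreweras_compatibleP P Q : nc setT P -> reflect
  (nc setT Q /\ forall i j, same_block Q i j -> krel P i j) (kreweras_compatible P Q).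
Proof.
move=> ncP; have /andP[pP cP] := ncP.
apply: (iffP andP) => -[ncQ h]; split=> //.
  move=> i j ij; apply/krelP => x y xy.
  (* On doubled positions 2x <= 2i + 1 iff x <= i, so [sep] keeps its value on the interleaved
     circle. *)
  have := @nc_sep _ setT _ (odd_pos i) (odd_pos j) (even_pos x) (even_pos y) h.
  rewrite same_block_odd same_block_even same_block_odd_even ij xy.
  by move=> /(_ isT isT isT); rewrite /sep /= !leq_Sdouble.
have /andP[pQ cQ] := ncQ.
rewrite noncrossingE /nc partition_interleave //=; apply/crossfreeP.
have even_odd x y i j : same_block P x y -> same_block Q i j ->
    sep i x y = sep j x y by move=> xy /h/krelP; apply.
move=> _ _ a b c d /setUP[]/imsetP[U UP ->] /setUP[]/imsetP[V VP ->].
- move=> /imsetP[x xU ->] /imsetP[y yV ->] /imsetP[z zU ->] /imsetP[t tV ->] /=.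
  rewrite !ltn_double => xy yz zt.
  by rewrite (crossfreeP _ cP _ _ _ _ _ _ UP VP xU yV zU tV).
- move=> /imsetP[x xU ->] /imsetP[y yV ->] /imsetP[z zU ->] /imsetP[t tV ->] /=.
  have := even_odd _ _ _ _ (same_block_in UP xU zU) (same_block_in VP yV tV).
  by clear; rewrite /sep; lia.
- move=> /imsetP[x xU ->] /imsetP[y yV ->] /imsetP[z zU ->] /imsetP[t tV ->] /=.
  have := even_odd _ _ _ _ (same_block_in VP yV tV) (same_block_in UP xU zU).
  by clear; rewrite /sep; lia.
- move=> /imsetP[x xU ->] /imsetP[y yV ->] /imsetP[z zU ->] /imsetP[t tV ->] /=.
  rewrite !ltnS !ltn_double => xy yz zt.
  by rewrite (crossfreeP _ cQ _ _ _ _ _ _ UP VP xU yV zU tV).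
Qed.

(** Two greatest elements refine each other, so the partition found by [pick] is [kr]. From here on
    the interleaved circle no longer occurs. *)
Lemma krewerasE P : nc setT P -> kreweras P = kr setT P.
Proof.
move=> ncP; have pk := kr_partition setT P; have /and3P[_ tk _] := pk.
have ck : kreweras_compatible P (kr setT P).
  apply/(kreweras_compatibleP _ ncP); split; first exact: kr_nc.
  by move=> i j; rewrite same_block_kr => /and3P[].
have le Q : kreweras_compatible P Q -> refines Q (kr setT P).
  move=> /(kreweras_compatibleP _ ncP)[/andP[pQ _] h].
  by apply/(refinesP pQ tk) => x y /h; rewrite same_block_kr !inE.
rewrite /kreweras; case: pickP => [Q /andP[cQ /forallP h]|/(_ (kr setT P))]; last first.
  by rewrite ck => /negP[]; apply/forallP => Q; apply/implyP/le.
have /(kreweras_compatibleP _ ncP)[/andP[pQ _] _] := cQ; have /and3P[_ tQ _] := pQ.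
apply: (same_block_inj pQ pk) => x y; apply/idP/idP; last first.
  by have /implyP/(_ ck)/(refinesP pk tQ) := h (kr setT P); apply.
by have /(refinesP pQ tk) := le Q cQ; apply.
Qed.

End Kreweras.

(** * Invariance under increasing maps of positions *)

Section Transport.
Variables (m n : nat) (h : 'I_m -> 'I_n).
Hypothesis h_mono : forall x y, (h x <= h y)%N = (x <= y)%N.
Implicit Types (P : {set {set 'I_m}}) (V : {set 'I_m}).

Lemma mono_inj : injective h.
Proof. by move=> x y e; apply/val_inj/eqP; rewrite eqn_leq -!h_mono e leqnn. Qed.

Lemma sep_im i x y : sep (h i) (h x) (h y) = sep i x y.
Proof. by rewrite /sep !h_mono. Qed.

Lemma nc_im P V : nc (h @: V) (im h P) = nc V P.
Proof.
rewrite /nc partition_im //; last exact: mono_inj.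
congr (_ && _); have ltE x y : (h x < h y)%N = (x < y)%N by rewrite !ltnNge h_mono.
apply/crossfreeP/crossfreeP => cf.
  move=> U W a b c d UP WP aU bW cU dW ab bc cd.
  apply: (imset_inj mono_inj); apply: (cf _ _ (h a) (h b) (h c) (h d));
  by rewrite ?ltE //; apply: imset_f.
move=> _ _ a b c d /imsetP[U UP ->] /imsetP[W WP ->].
move=> /imsetP[x xU ->] /imsetP[y yW ->] /imsetP[z zU ->] /imsetP[t tW ->].
by rewrite !ltE => xy yz zt; rewrite (cf _ _ _ _ _ _ UP WP xU yW zU tW).
Qed.

Lemma krel_im P i j : krel (im h P) (h i) (h j) = krel P i j.
Proof.
apply/krelP/krelP => k x y; last first.
  case/same_blockP => _ [/imsetP[U UP ->] /imsetP[a aU ->] /imsetP[b bU ->]].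
  by rewrite !sep_im; apply/k/(same_block_in UP).
by rewrite -(same_block_im mono_inj) => /k; rewrite !sep_im.
Qed.

Lemma kr_im P V : kr (h @: V) (im h P) = im h (kr V P).
Proof.
apply: (@same_block_inj _ _ _ (h @: V)); first exact: kr_partition.
  by rewrite partition_im ?kr_partition //; apply: mono_inj.
move=> x y; rewrite same_block_kr; apply/and3P/idP => [[]|].
  move=> /imsetP[a aV ->] /imsetP[b bV ->]; rewrite krel_im => ab.
  by rewrite (same_block_im mono_inj) same_block_kr aV bV.
case/same_blockP => _ [/imsetP[U UP ->] /imsetP[a aU ->] /imsetP[b bU ->]].
have := same_block_in UP aU bU; rewrite same_block_kr => /and3P[aV bV ab].
by rewrite krel_im ab !imset_f.
Qed.

(** Being non-crossing and [kr] depend only on the order of the positions, so [im h] reindexes the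
    sum; its inverse takes preimages of blocks. *)
Lemma setbox_im (R : comPzRingType) (F G : {set 'I_n} -> R) :
  setbox (fun U => F (h @: U)) (fun U => G (h @: U)) setT = setbox F G (h @: setT).
Proof.
have prod_im (E : {set 'I_n} -> R) P :
    \prod_(U in P) E (h @: U) = \prod_(U in im h P) E U.
  by rewrite big_imset //= => U W _ _; apply: (imset_inj mono_inj).
have pre Q : partition Q (h @: setT) ->
    im h [set h @^-1: (U : {set 'I_n}) | U in Q] = Q.
  move=> pQ; have K U : U \in Q -> h @: (h @^-1: U) = U.
    move=> UQ; apply/setP => y; apply/imsetP/idP => [[x + ->]|yU]; first by rewrite inE.
    have /imsetP[x _ e] : y \in h @: setT by apply: (subsetP (partitionS pQ UQ)).
    by exists x; rewrite // inE -e.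
  apply/setP => U; apply/imsetP/idP => [[_ /imsetP[W WQ ->] ->]|UQ]; first by rewrite K.
  by exists (h @^-1: U); rewrite ?K // imset_f.
rewrite /setbox [RHS](reindex_onto (im h)
  (fun Q : {set {set 'I_n}} => [set h @^-1: (U : {set 'I_n}) | U in Q])) /=; last first.
  by move=> Q /andP[pQ _]; apply: pre.
apply: eq_big => [P|P _]; last by rewrite kr_im !prod_im.
rewrite nc_im; case ncP: (nc _ P) => //=; apply/esym/eqP.
apply: (im_inj mono_inj); apply: pre.
by rewrite partition_im; [have /andP[] := ncP|apply: mono_inj].
Qed.

End Transport.

(** * Boxed convolution of series *)

Lemma enum_sorted n (V : {set 'I_n}) : sorted (relpre val ltn) (enum V).
Proof.
rewrite {1}/enum_mem -enumT /=; apply: sorted_filter.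
  by move=> y x z /=; apply: ltn_trans.
by rewrite -sorted_map val_enum_ord iota_ltn_sorted.
Qed.

Section Enumeration.
Variables (m n : nat) (h : 'I_m -> 'I_n).
Hypothesis h_mono : forall x y, (h x <= h y)%N = (x <= y)%N.

Lemma enum_im (U : {set 'I_m}) : enum (h @: U) = [seq h x | x <- enum U].
Proof.
apply: (@irr_sorted_eq _ (relpre val ltn)).
- by move=> y x z /=; apply: ltn_trans.
- by move=> x /=; rewrite ltnn.
- exact: enum_sorted.
- rewrite sorted_map; apply: sub_sorted (enum_sorted U) => x y /=.
  by rewrite !ltnNge h_mono.
- move=> y; rewrite mem_enum; apply/imsetP/mapP => -[x xU ->]; exists x => //.
    by rewrite mem_enum.
  by rewrite -mem_enum.
Qed.

End Enumeration.

Section Subwords.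
Variables (s : nat) (w : seq 'I_s).
Implicit Types U V : {set 'I_(size w)}.

Lemma size_subword V : size (subword V) = #|V|.
Proof. by rewrite size_map -cardE. Qed.

Lemma subword_setT : subword [set: 'I_(size w)] = w.
Proof. by rewrite /subword enum_setT -enumT map_tnth_enum. Qed.

Lemma subword_set1 i : subword [set i] = [:: tnth (in_tuple w) i].
Proof. by rewrite /subword enum_set1. Qed.

(** The map sends r to the r-th element of V and is increasing because [enum] is sorted. It turns a
    nested subword into a subword of w itself, so that iterated convolutions are computed over a
    single type of positions. *)
Lemma subword_embedding V : exists h : 'I_(size (subword V)) -> 'I_(size w),
  [/\ forall x y, (h x <= h y)%N = (x <= y)%N, h @: setT = V
    & forall U : {set 'I_(size (subword V))}, subword U = subword (h @: U)].
Proof.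
pose e := size_subword V; pose h i := enum_val (cast_ord e i).
have hE d i : h i = nth d (enum V) i := enum_val_nth d (cast_ord e i).
have mono x y : (h x <= h y)%N = (x <= y)%N.
  have sub (x' y' : 'I_(size (subword V))) : (x' < y')%N -> (h x' < h y')%N.
    move=> xy; have szV (z : 'I_(size (subword V))) : (z < size (enum V))%N.
      by rewrite -cardE -e.
    pose d := h x'; rewrite (hE d x') (hE d y').
    have tr : transitive (relpre (val : 'I_(size w) -> nat) ltn).
      by move=> a b c /=; apply: ltn_trans.
    exact: (sorted_ltn_nth tr d (enum_sorted V) x' y' (szV x') (szV y') xy).
  have [xy|yx] := ltnP x y; first by rewrite (ltnW xy) (ltnW (sub _ _ xy)).
  move: yx; rewrite leq_eqVlt => /orP[/eqP/val_inj ->|yx]; first by rewrite !leqnn.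
  by rewrite leqNgt sub //= leqNgt yx.
exists h; split=> //.
  apply/setP => x; apply/imsetP/idP => [[i _ ->]|xV]; first exact: enum_valP.
  exists (cast_ord (esym e) (enum_rank_in xV x)) => //.
  by rewrite /h cast_ordKV enum_rankK_in.
move=> U; rewrite /subword enum_im // -map_comp; apply: eq_map => i /=.
rewrite (tnth_nth (tnth (in_tuple w) (h i))) /= (nth_map (h i)) -?hE //=.
by rewrite -cardE -e.
Qed.

End Subwords.

(** * The one-block and the discrete partition; linear factors *)

Section Discrete.
Variable n : nat.
Implicit Types (P Q : {set {set 'I_n.+1}}) (U : {set 'I_n.+1}).
Local Notation setI := [set: 'I_n.+1].

Lemma nc_coarse : nc setI [set setI].
Proof.
apply/andP; split; last first.
  by apply/crossfreeP => U V a b c d /set1P -> /set1P ->.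
by rewrite /partition cover1 eqxx trivIset1 inE eq_sym; apply/set0Pn; exists ord0.
Qed.

Lemma card1_coarse P : partition P setI -> (#|P| == 1%N) = (P == [set setI]).
Proof.
move=> /and3P[/eqP cP _ _]; apply/cards1P/eqP => [[U eP]|->]; last by exists setI.
by move: cP; rewrite eP cover1 => ->.
Qed.

(** Taken as the complement of the one-block partition, so that its being non-crossing and its
    number of blocks are instances of facts about [kr]; [discreteE] recovers the singletons. *)
Definition discrete : {set {set 'I_n.+1}} := kr setI [set setI].

Lemma nc_discrete : nc setI discrete. Proof. exact: kr_nc. Qed.

Lemma card_discrete : #|discrete| = n.+1.
Proof. by have := card_kr nc_coarse; rewrite cards1 add1n => -[]. Qed.

Lemma kr_discrete : kr setI discrete = [set setI].
Proof.
apply/eqP; rewrite -card1_coarse ?kr_partition //; have /eqP := card_kr nc_discrete.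
by rewrite card_discrete -[n.+2]addn1 eqn_add2l.
Qed.

Lemma card_eq_discrete P : nc setI P -> (#|P| == n.+1) = (P == discrete).
Proof.
move=> ncP; apply/eqP/eqP => [cP|->]; last exact: card_discrete.
apply: (kr_inj ncP nc_discrete); rewrite kr_discrete; apply/eqP.
rewrite -card1_coarse ?kr_partition //; have /eqP := card_kr ncP.
by rewrite cP -[n.+2]addn1 eqn_add2l.
Qed.

Lemma card_full P : partition P setI ->
  (#|P| == n.+1) = [forall U in P, #|U| == 1%N].
Proof.
move=> pP; have cU U : U \in P -> (1 <= #|U|)%N.
  by move=> /(partition_neq0 pP); rewrite card_gt0.
have e : n.+1 = \sum_(U in P) #|U| by rewrite -(card_partition pP) cardsT card_ord.
rewrite [X in _ == X]e -sum1_card.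
have /leqif_sum[_ ->] : forall U, U \in P -> (1 <= #|U| ?= iff (#|U| == 1))%N.
  by move=> U UP; split; [exact: cU|rewrite eq_sym].
by [].
Qed.

Lemma discreteE : discrete = [set [set x] | x in setI].
Proof.
have /andP[pd _] := nc_discrete; have /and3P[/eqP cd _ _] := pd.
have : [forall U in discrete, #|U| == 1%N] by rewrite -card_full // card_discrete.
move/forall_inP => h; apply/setP => U; apply/idP/imsetP => [UD|[x _ ->]].
  by have /cards1P[x ->] := h U UD; exists x.
have : x \in cover discrete by rewrite cd inE.
by case/bigcupP => W WD; have /cards1P[y eW] := h W WD; rewrite eW inE => /eqP ->; rewrite -eW.
Qed.

Lemma big_discrete (R : comPzRingType) (F : {set 'I_n.+1} -> R) :
  \prod_(U in discrete) F U = \prod_x F [set x].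
Proof.
rewrite discreteE big_imset /=; last by move=> x y _ _; apply: set1_inj.
by apply: eq_bigl => x; rewrite inE.
Qed.

Section Linear.
Variables (R : comPzRingType) (a : 'I_n.+1 -> R) (L : {set 'I_n.+1} -> R).
Hypothesis L1 : forall x, L [set x] = a x.
Hypothesis L0 : forall U, U != set0 -> #|U| != 1%N -> L U = 0.

Lemma prod_linear P : nc setI P ->
  \prod_(U in P) L U = if P == discrete then \prod_x a x else 0.
Proof.
move=> ncP; have /andP[pP _] := ncP; case: eqP => [->|/eqP].
  by rewrite big_discrete; apply: eq_bigr => x _.
rewrite -card_eq_discrete // card_full // => /forall_inPn[U UP U1].
by rewrite (bigD1 U) //= L0 ?mul0r // (partition_neq0 pP UP).
Qed.

Lemma setbox_linearl G : setbox L G setI = (\prod_x a x) * G setI.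
Proof.
rewrite /setbox (bigD1 discrete) ?nc_discrete //= prod_linear ?nc_discrete // eqxx.
rewrite kr_discrete big_set1 [X in _ + X]big1 ?addr0 // => Q /andP[ncQ /negbTE nQ].
by rewrite prod_linear // nQ mul0r.
Qed.

Lemma setbox_linearr F : setbox F L setI = F setI * \prod_x a x.
Proof.
rewrite /setbox (bigD1 [set setI]) ?nc_coarse //= prod_linear ?kr_nc // eqxx.
rewrite big_set1 [X in _ + X]big1 ?addr0 // => Q /andP[ncQ nQ].
rewrite prod_linear ?kr_nc // -card_eq_discrete ?kr_nc //.
have /andP[pQ _] := ncQ; case: eqP => [e|]; last by rewrite mulr0.
move/eqP: (card_kr ncQ); rewrite e -[n.+2]add1n eqn_add2r => /eqP cQ.
by rewrite -card1_coarse // cQ in nQ.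
Qed.

End Linear.
End Discrete.

(** Blocks are non-empty. The restriction to U != set0 matters because [boxed_conv] vanishes on the
    empty word, whereas [setbox] at [set0] is an empty product, equal to 1. *)
Lemma eq_setbox n (R : comPzRingType) (F F' G G' : {set 'I_n} -> R) V :
  (forall U, U != set0 -> F U = F' U) -> (forall U, U != set0 -> G U = G' U) ->
  setbox F G V = setbox F' G' V.
Proof.
move=> eF eG; apply: eq_bigr => Q /andP[pQ _]; congr (_ * _); apply: eq_bigr => U UQ.
  exact/eF/(partition_neq0 pQ).
exact/eG/(partition_neq0 (kr_partition V Q)).
Qed.

Section BoxedConvolution.
Variables (s : nat) (R : comPzRingType).
Implicit Types (f g h : series s R) (w u : seq 'I_s) (a b : 'I_s -> R).

Lemma boxed_conv_setbox f g w : (0 < size w)%N -> boxed_conv f g w =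
  setbox (fun U => f (@subword s w U)) (fun U => g (@subword s w U)) setT.
Proof.
case: w => // i w _; apply: eq_bigr => P ncP; by rewrite krewerasE.
Qed.

Lemma boxed_conv_subword f g w (V : {set 'I_(size w)}) : V != set0 ->
  boxed_conv f g (subword V) = setbox (fun U => f (subword U)) (fun U => g (subword U)) V.
Proof.
move=> V0; rewrite boxed_conv_setbox; last by rewrite size_subword card_gt0.
have [h [mono imh sub]] := subword_embedding V.
rewrite -[in RHS]imh -(setbox_im mono).
by apply: eq_setbox => U _; rewrite sub.
Qed.

Lemma boxed_convA f g h :
  boxed_conv f (boxed_conv g h) = boxed_conv (boxed_conv f g) h.
Proof.
apply/funext => w; have [/size0nil ->//|w0] := posnP (size w).
rewrite !boxed_conv_setbox //.
rewrite (@eq_setbox _ _ _ (fun U => f (subword U)) _ (setbox (fun U => g (subword U))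
  (fun U => h (subword U))) setT) //; last by move=> U /boxed_conv_subword ->.
rewrite -setboxA; apply: eq_setbox => // U /boxed_conv_subword ->.
by [].
Qed.

Lemma linear_subword w a (U : {set 'I_(size w)}) : U != set0 -> #|U| != 1%N ->
  linear_series a (subword U) = 0.
Proof.
rewrite -(size_subword U) -card_gt0 -size_subword.
by case: (subword U) => [|i [|j u]].
Qed.

Lemma boxed_conv_linearl a g i w :
  boxed_conv (linear_series a) g (i :: w) = (\prod_(j <- i :: w) a j) * g (i :: w).
Proof.
rewrite boxed_conv_setbox // big_tnth.
have L1 (x : 'I_(size w).+1) :
    linear_series a (@subword s (i :: w) [set x]) = a (tnth (in_tuple (i :: w)) x).
  by rewrite subword_set1.
have := @setbox_linearl (size w) R _ _ L1 (@linear_subword (i :: w) a)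
  (fun U => g (@subword s (i :: w) U)).
by rewrite (subword_setT (i :: w)).
Qed.

Lemma boxed_conv_linearr a f i w :
  boxed_conv f (linear_series a) (i :: w) = f (i :: w) * \prod_(j <- i :: w) a j.
Proof.
rewrite boxed_conv_setbox // big_tnth.
have L1 (x : 'I_(size w).+1) :
    linear_series a (@subword s (i :: w) [set x]) = a (tnth (in_tuple (i :: w)) x).
  by rewrite subword_set1.
have := @setbox_linearr (size w) R _ _ L1 (@linear_subword (i :: w) a)
  (fun U => f (@subword s (i :: w) U)).
by rewrite (subword_setT (i :: w)).
Qed.

Definition one_series : series s R := linear_series (fun _ => 1).

Lemma boxed_conv1l g : g [::] = 0 -> boxed_conv one_series g = g.
Proof.
by move=> g0; apply/funext => -[|i w]; rewrite ?g0 // boxed_conv_linearl big1 ?mul1r.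
Qed.

Lemma boxed_conv1r f : f [::] = 0 -> boxed_conv f one_series = f.
Proof.
by move=> f0; apply/funext => -[|i w]; rewrite ?f0 // boxed_conv_linearr big1 ?mulr1.
Qed.

Lemma boxed_conv_linear a b :
  boxed_conv (linear_series a) (linear_series b) = linear_series (fun i => a i * b i).
Proof.
apply/funext => -[|i w] //; rewrite boxed_conv_linearl.
by case: w => [|j w]; rewrite ?mulr0 // big_seq1.
Qed.

(** Every non-empty subword of a one-letter word is a letter, so f may be replaced by its linear
    part. *)
Lemma boxed_conv_letter f g i : boxed_conv f g [:: i] = f [:: i] * g [:: i].
Proof.
have -> : boxed_conv f g [:: i] =
    boxed_conv (linear_series (fun j => f [:: j])) g [:: i].
  rewrite !boxed_conv_setbox //; apply: eq_setbox => // U U0.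
  have : size (subword U) = 1%N.
    apply/eqP; rewrite size_subword eqn_leq card_gt0 U0 andbT.
    by rewrite -[X in (_ <= X)%N](card_ord 1) max_card.
  by case: (subword U) => [|j []].
by rewrite boxed_conv_linearl big_seq1.
Qed.

(* The terms of a boxed convolution other than that of the discrete partition
   involve the second factor only on words shorter than w. *)
Definition lower_terms f g w : R := if w is i :: u then
  \sum_(P : {set {set 'I_(size (i :: u))}} | nc setT P && (P != discrete (size u)))
    (\prod_(U in P) f (@subword s (i :: u) U)) *
    \prod_(U in kr setT P) g (@subword s (i :: u) U) else 0.

Lemma boxed_conv_lower f g i w : boxed_conv f g (i :: w) =
  (\prod_(j <- i :: w) f [:: j]) * g (i :: w) + lower_terms f g (i :: w).
Proof.
rewrite boxed_conv_setbox // /setbox (bigD1 (discrete (size w))) ?nc_discrete //=.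
congr (_ * _ + _); last by rewrite kr_discrete big_set1 subword_setT.
by rewrite big_discrete [RHS]big_tnth; apply: eq_bigr => x _; rewrite subword_set1.
Qed.

(** If a block of the complement is the whole set, the complement has one block, and the block count
    makes P discrete, which is excluded. All blocks thus give words shorter than w. *)
Lemma eq_lower_terms f g g' w :
  (forall u, (size u < size w)%N -> g u = g' u) -> lower_terms f g w = lower_terms f g' w.
Proof.
case: w => // i w eg; apply: eq_bigr => P /andP[ncP nP]; congr (_ * _).
apply: eq_bigr => U UP; apply: eg; rewrite size_subword.
rewrite -[X in (_ < X)%N]card_ord -cardsT; apply: proper_card.
rewrite properEneq subsetT andbT; apply: contraNneq nP => UT.
rewrite -card_eq_discrete //; have /eqP := card_kr ncP.
suff -> : kr setT P = [set setT] by rewrite cards1 -[(size w).+2]addn1 eqn_add2r.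
have /and3P[_ tk nk] := kr_partition [set: 'I_(size w).+1] P.
apply/setP => W; rewrite inE; apply/idP/eqP => [WP|->]; last by move: UP; rewrite UT.
have [x xW] : exists x, x \in W by apply/set0Pn; apply: contraNneq nk => <-.
by rewrite -(def_pblock tk WP xW) (def_pblock tk UP) ?UT ?inE.
Qed.

(** Solves for the top coefficient of an inverse, y being the inverses of the coefficients of f at
    letters. N is fuel, as subwords are not structurally smaller; by [inverse_upto_stable] any N at
    least the length gives the same value. *)
Fixpoint inverse_upto f (y : 'I_s -> R) (N : nat) : series s R :=
  if N is N'.+1 then fun w => if w is [::] then 0 else
    (\prod_(j <- w) y j) * (one_series w - lower_terms f (inverse_upto f y N') w)
  else fun _ => 0.

Lemma inverse_uptoS f y N i w : inverse_upto f y N.+1 (i :: w) =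
  (\prod_(j <- i :: w) y j) *
  (one_series (i :: w) - lower_terms f (inverse_upto f y N) (i :: w)).
Proof. by []. Qed.

Lemma inverse_upto_stable f y N M w : (size w <= N)%N -> (size w <= M)%N ->
  inverse_upto f y N w = inverse_upto f y M w.
Proof.
elim: N M w => [|N IH] [|M] [|i w] // hN hM; rewrite !inverse_uptoS.
congr (_ * (_ - _)).
by apply: eq_lower_terms => u hu; apply: IH;
  apply: leq_trans (_ : size w <= _)%N.
Qed.

Lemma boxed_conv_invr f : (forall i, invertible (f [:: i])) ->
  exists2 g, g [::] = 0 & boxed_conv f g = one_series.
Proof.
move=> invf; have [y fy] := choice invf.
pose g w := inverse_upto f y (size w) w.
exists g => //; apply/funext => -[|i w] //; rewrite boxed_conv_lower.
have -> : lower_terms f g (i :: w) = lower_terms f (inverse_upto f y (size w)) (i :: w).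
  by apply: eq_lower_terms => u hu; apply: inverse_upto_stable.
rewrite {1}/g inverse_uptoS mulrA -big_split /= big1 ?mul1r ?subrK //.
Qed.

End BoxedConvolution.

Lemma boxed_conv_morph (s : nat) (R S : comPzRingType) (phi : {rmorphism R -> S})
  (f g : series s R) : phi \o boxed_conv f g = boxed_conv (phi \o f) (phi \o g).
Proof.
apply/funext => -[|i w] /=; first exact: rmorph0.
rewrite rmorph_sum; apply: eq_bigr => P _.
by rewrite rmorphM /part_coef !rmorph_prod.
Qed.

(** * Commutativity in one variable, and the weights of complements *)

Section Reversal.
Variable n : nat.
Implicit Types (P : {set {set 'I_n}}).
Local Notation setI := [set: 'I_n].

Definition reversal P := im (@rev_ord n) P.

Lemma rev_setT : @rev_ord n @: setI = setI.
Proof. by apply/setP => x; rewrite inE -[x]rev_ordK imset_f. Qed.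

Lemma same_block_reversal P x y :
  same_block (reversal P) (rev_ord x) (rev_ord y) = same_block P x y.
Proof. exact/same_block_im/rev_ord_inj. Qed.

Lemma nc_reversal P : nc setI P -> nc setI (reversal P).
Proof.
move=> /andP[pP cP]; rewrite /nc -{1}rev_setT partition_im ?pP /=; last exact: rev_ord_inj.
apply/crossfreeP => _ _ a b c d /imsetP[U UP ->] /imsetP[W WP ->].
move=> /imsetP[x xU ->] /imsetP[y yW ->] /imsetP[z zU ->] /imsetP[t tW ->] /=.
have rlt (i j : 'I_n) : (n - i.+1 < n - j.+1)%N = (j < i)%N.
  by move: (ltn_ord i) (ltn_ord j); clear; lia.
rewrite !rlt => yx zy tz.
by rewrite (crossfreeP _ cP _ _ _ _ _ _ WP UP tW zU yW xU tz zy yx).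
Qed.

(* Reflecting the circle exchanges the points and their barred copies, which
   makes P |-> reversal (kr P) an involution without any rotation. *)
Lemma kr_reversal_kr P : nc setI P -> kr setI (reversal (kr setI P)) = reversal P.
Proof.
move=> ncP; have /andP[pP _] := ncP.
apply: (@same_block_inj _ _ _ setI); first exact: kr_partition.
  by rewrite -{1}rev_setT partition_im //; apply: rev_ord_inj.
move=> x y; rewrite -[x]rev_ordK -[y]rev_ordK same_block_reversal same_block_kr !inE /=.
(* Reflection turns [a <= i] into [i <= a]: points and cuts exchange roles, and the dual separation
   rule gives back P. *)
have sepE (i a b : 'I_n) : sep (rev_ord i) (rev_ord a) (rev_ord b) = (i <= a)%N (+) (i <= b)%N.
  by rewrite /sep /=; move: (ltn_ord i) (ltn_ord a) (ltn_ord b); clear; lia.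
apply/krelP/(same_block_dual _ _ ncP) => h a b.
  move=> kab; have := h (rev_ord a) (rev_ord b).
  rewrite same_block_reversal same_block_kr !inE kab !sepE => /(_ isT).
  by rewrite /sep; clear; do 4!case: (_ <= _)%N.
rewrite -[a]rev_ordK -[b]rev_ordK same_block_reversal same_block_kr !inE /= => /h.
by rewrite !rev_ordK !sepE /sep; clear; do 4!case: (_ <= _)%N.
Qed.

(** The sum is reindexed along [phi], bijective on non-crossing partitions because it is injective
    on a finite set. It exchanges the two products, since F and G do not see the reversal. *)
Lemma setboxC (R : comPzRingType) (F G : {set 'I_n} -> R) :
  (forall U : {set 'I_n}, F (@rev_ord n @: U) = F U) ->
  (forall U : {set 'I_n}, G (@rev_ord n @: U) = G U) ->
  setbox F G setI = setbox G F setI.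
Proof.
move=> hF hG; rewrite /setbox; pose S := [set P | nc setI P].
pose phi P := reversal (kr setI P).
have prodR (E : {set 'I_n} -> R) P : (forall U : {set 'I_n}, E (@rev_ord n @: U) = E U) ->
    \prod_(U in reversal P) E U = \prod_(U in P) E U.
  move=> hE; rewrite /reversal /im big_imset /=; first exact: eq_bigr.
  by move=> U W _ _; apply: (imset_inj rev_ord_inj).
have phi_inj : {in S &, injective phi}.
  move=> P Q; rewrite !inE => nP nQ /(im_inj rev_ord_inj); exact: kr_inj.
have phiS : phi @: S = S.
  apply/eqP; rewrite eqEcard card_in_imset // leqnn andbT; apply/subsetP => Q.
  by case/imsetP=> P _ ->; rewrite inE nc_reversal ?kr_nc.
rewrite (eq_bigl [in S]); last by move=> P; rewrite !inE.
rewrite -phiS big_imset //=; apply: eq_big => [P|P]; rewrite inE // => nP.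
by rewrite kr_reversal_kr // !prodR // mulrC.
Qed.

End Reversal.

(** In one variable a word is determined by its length, so a series takes the same value on a set of
    positions and on its reversal. *)
Lemma boxed_convC (s : nat) (R : comPzRingType) (f g : series s R) : s = 1%N ->
  boxed_conv f g = boxed_conv g f.
Proof.
move=> s1; subst s; apply/funext => w; have [/size0nil ->//|w0] := posnP (size w).
have inv (h : series 1 R) (U : {set 'I_(size w)}) :
    h (subword (@rev_ord (size w) @: U)) = h (subword U).
  congr h; have : size (subword (@rev_ord (size w) @: U)) = size (subword U).
    by rewrite !size_subword card_imset //; apply: rev_ord_inj.
  elim: (subword _) (subword _) => [|i u IH] [|j v] //= [] e.
  by rewrite (ord1 i) (ord1 j) (IH v).
by rewrite !boxed_conv_setbox // setboxC.
Qed.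

Lemma sum_block_weight n (P : {set {set 'I_n}}) : partition P setT ->
  ((\sum_(U in P) #|U|.-1) + #|P| = n)%N.
Proof.
move=> pP; rewrite -[RHS]card_ord -cardsT (card_partition pP) -sum1_card -big_split /=.
apply: eq_bigr => U UP; rewrite addn1 prednK // card_gt0.
exact: partition_neq0 pP UP.
Qed.

(** A partition Q of n + 1 points has weight n + 1 - |Q|, and a partition and its complement have n
    + 2 blocks together. For words of length n + 1 this leaves n, the weight of X_w. *)
Lemma kr_weight n (P : {set {set 'I_n.+1}}) : nc setT P ->
  ((\sum_(U in P) #|U|.-1) + (\sum_(U in kr setT P) #|U|.-1) = n)%N.
Proof.
move=> ncP; have /andP[pP _] := ncP.
have arith a b p q : (a + p = n.+1 -> b + q = n.+1 -> p + q = n.+2 -> a + b = n)%N by lia.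
exact: arith (sum_block_weight pP) (sum_block_weight (kr_partition setT P)) (card_kr ncP).
Qed.

(** * Two series in two letters that do not commute *)

Section Noncommutative.
Variables (s : nat) (R : comPzRingType) (i j : 'I_s).
Hypothesis ij : i != j.

(** A point of [GGplus] whose only non-zero coefficient beyond the letters is a 1 at the word xy. *)
Definition short_series (x y : 'I_s) : series s R :=
  fun w => ((size w == 1%N) || (w == [:: x; y]))%:R.

Let w := [:: i; j; i].
Let p0 : 'I_(size w) := Ordinal (isT : 0 < 3)%N.
Let p1 : 'I_(size w) := Ordinal (isT : 1 < 3)%N.
Let p2 : 'I_(size w) := Ordinal (isT : 2 < 3)%N.

Lemma pos3P (P : 'I_(size w) -> Prop) : P p0 -> P p1 -> P p2 -> forall x, P x.
Proof.
move=> h0 h1 h2 [[|[|[|x]]] hx] //.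
- by rewrite (_ : Ordinal hx = p0) //; apply: val_inj.
- by rewrite (_ : Ordinal hx = p1) //; apply: val_inj.
- by rewrite (_ : Ordinal hx = p2) //; apply: val_inj.
Qed.

Lemma enum3 (U : {set 'I_(size w)}) : enum U = [seq x <- [:: p0; p1; p2] | x \in U].
Proof.
rewrite {1}/enum_mem -enumT; congr filter; apply: (inj_map val_inj).
by rewrite val_enum_ord.
Qed.

Lemma subword3 (U : {set 'I_(size w)}) : subword U =
  (if p0 \in U then [:: i] else [::]) ++ (if p1 \in U then [:: j] else [::]) ++
  (if p2 \in U then [:: i] else [::]).
Proof. by rewrite /subword enum3 /=; do 3!case: ifP. Qed.

Lemma short_ji U : short_series j i (@subword s w U) =
  (~~ ((p0 \in U) && ((p1 \in U) || (p2 \in U))) && (U != set0))%:R.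
Proof.
have -> : U == set0 = [&& p0 \notin U, p1 \notin U & p2 \notin U].
  apply/eqP/and3P => [->|[h0 h1 h2]]; first by rewrite !inE.
  by apply/setP; apply: pos3P; rewrite inE; apply/negbTE.
rewrite /short_series subword3; congr (nat_of_bool _)%:R.
case: (p0 \in U); case: (p1 \in U); case: (p2 \in U) => //=;
by rewrite ?eqseq_cons ?eqxx ?(negbTE ij) ?andbF // eq_sym (negbTE ij).
Qed.

Lemma short_ij U : short_series i j (@subword s w U) =
  (~~ ((p2 \in U) && ((p0 \in U) || (p1 \in U))) && (U != set0))%:R.
Proof.
have -> : U == set0 = [&& p0 \notin U, p1 \notin U & p2 \notin U].
  apply/eqP/and3P => [->|[h0 h1 h2]]; first by rewrite !inE.
  by apply/setP; apply: pos3P; rewrite inE; apply/negbTE.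
rewrite /short_series subword3; congr (nat_of_bool _)%:R.
case: (p0 \in U); case: (p1 \in U); case: (p2 \in U) => //=;
by rewrite ?eqseq_cons ?eqxx ?(negbTE ij) ?andbF // eq_sym (negbTE ij) ?andbF.
Qed.

(** The series of ji kills each block joining the first letter to another one, since its word is ij,
    ii or iji. If the first letter is alone, the complement joins the first and third barred points;
    the word is then ii or iji, killed by the series of ij. *)
Lemma boxed_conv_ji_ij : boxed_conv (short_series j i) (short_series i j) w = 0.
Proof.
rewrite boxed_conv_setbox // /setbox big1 // => Q _.
have [h|/negP h] := boolP [exists U in Q, (p0 \in U) && ((p1 \in U) || (p2 \in U))].
  have /exists_inP[U UQ hU] := h.
  by rewrite (bigD1 U) //= short_ji hU !mul0r.
have iso y : same_block Q p0 y -> y = p0.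
  move=> /same_blockP[U [UQ p0U]]; move: y; apply: pos3P => // yU; case: h;
  by apply/exists_inP; exists U; rewrite // p0U yU ?orbT.
have k02 : krel Q p0 p2.
  apply/krelP => x y xy; have [x0|x0] := eqVneq x p0.
    by move: xy; rewrite x0 => /iso ->.
  have y0 : y != p0.
    by apply: contra_neq x0 => y0; apply: iso; rewrite -y0 same_blockC.
  have le2 (z : 'I_(size w)) : (z <= 2)%N by have := ltn_ord z.
  by move: x0 y0; rewrite /sep /= !le2 !leqn0 -!val_eqE /= => /negbTE -> /negbTE ->.
have : same_block (kr setT Q) p0 p2 by rewrite same_block_kr !inE.
case/same_blockP => W [WQ p0W p2W].
by rewrite [X in _ * X](bigD1 W) //= short_ij p0W p2W mul0r mulr0.
Qed.

(** Only [Q1], the partition 12|3 with words ij and i, contributes: its complement 1|23 has words i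
    and ji. In any other partition the third letter is joined to another one, or the complement
    joins the first two barred points; either kills the term. *)
Lemma boxed_conv_ij_ji : boxed_conv (short_series i j) (short_series j i) w = 1.
Proof.
pose r : rel 'I_(size w) := fun x y => (x == p2) == (y == p2).
have er : equivalence_rel r by move=> x y z; rewrite /r eqxx; split=> // /eqP ->.
pose Q1 := equivalence_partition r setT.
have pQ1 : partition Q1 setT by apply: partition_equivalence.
have sQ1 x y : same_block Q1 x y = r x y.
  by rewrite same_block_equivalence_partition // !inE.
have ncQ1 : nc setT Q1.
  rewrite /nc pQ1; apply: crossfree_rel => // a b c d ab bc cd.
  by have := ltn_ord d; move: ab bc cd => /=; lia.
rewrite boxed_conv_setbox // /setbox (bigD1 Q1) //= [X in _ + X]big1 => [|Q /andP[ncQ nQ]].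
  rewrite addr0 big1 => [|U UQ]; last first.
    rewrite short_ij (partition_neq0 pQ1 UQ) andbT; case p2U: (p2 \in U) => //=.
    have nU z : z \in U -> z == p2.
      by move=> zU; have := same_block_in UQ p2U zU; rewrite sQ1 /r eqxx => /eqP <-.
    by case p0U: (p0 \in U); [have := nU _ p0U|case p1U: (p1 \in U) => //; have := nU _ p1U].
  rewrite mul1r big1 // => W WQ.
  rewrite short_ji (partition_neq0 (kr_partition _ _) WQ) andbT.
  case p0W: (p0 \in W) => //=.
  have nW z : z \in W -> sep p0 p0 p1 = sep z p0 p1.
    move=> zW; have := same_block_in WQ p0W zW; rewrite same_block_kr => /and3P[_ _ /krelP].
    by apply; rewrite sQ1.
  by case p1W: (p1 \in W); [have := nW _ p1W|case p2W: (p2 \in W) => //; have := nW _ p2W].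
have /andP[pQ _] := ncQ.
have [h|/negP h] := boolP [exists U in Q, (p2 \in U) && ((p0 \in U) || (p1 \in U))].
  have /exists_inP[U UQ hU] := h.
  by rewrite (bigD1 U) //= short_ij hU !mul0r.
have iso y : same_block Q p2 y -> y = p2.
  move=> /same_blockP[U [UQ p2U]]; move: y; apply: pos3P => // yU; case: h;
  by apply/exists_inP; exists U; rewrite // p2U yU ?orbT.
have rfl x : same_block Q x x by rewrite (same_block_refl _ pQ) inE.
have n01 : ~~ same_block Q p0 p1.
  apply: contra nQ => s01; apply/eqP/(same_block_inj pQ pQ1) => x y; rewrite sQ1 /r.
  have s2 z : same_block Q p2 z = (z == p2) by apply/idP/eqP => [/iso|->].
  move: x y; apply: pos3P; apply: pos3P; rewrite ?rfl ?s01 ?s2 //.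
  - by rewrite same_blockC s2.
  - by rewrite same_blockC s01.
  - by rewrite same_blockC s2.
have k01 : krel Q p0 p1.
  apply/krelP; apply: pos3P; apply: pos3P => //.
  - by rewrite (negbTE n01).
  - by rewrite same_blockC (negbTE n01).
  - by rewrite same_blockC => /iso.
  - by move/iso.
have : same_block (kr setT Q) p0 p1 by rewrite same_block_kr !inE.
case/same_blockP => W [WQ p0W p1W].
by rewrite [X in _ * X](bigD1 W) //= short_ji p0W p1W mul0r mulr0.
Qed.

End Noncommutative.

(** * Hopf algebras from group functors *)

Section MakeMorphism.
Variables (k : fieldType) (H : comAlgType k) (T : pzSemiRingType) (sc : k -> T -> T).

Definition alg_hom_for (f : H -> T) : Prop :=
  [/\ {morph f : x y / x + y}, f 0 = 0, f 1 = 1, {morph f : x y / x * y}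
    & forall c x, f (c *: x) = sc c (f x)].

Variables (f : H -> T) (hf : alg_hom_for f).

(** The proof is an argument so that the canonical instances below can be attached to f. *)
Definition hom_fun (_ : alg_hom_for f) : H -> T := f.

Fact hom_fun_nmod : nmod_morphism (hom_fun hf).
Proof. by have [hD h0 _ _ _] := hf; split. Qed.
Fact hom_fun_monoid : monoid_morphism (hom_fun hf).
Proof. by have [_ _ h1 hM _] := hf; split. Qed.
Fact hom_fun_scalable : scalable_for sc (hom_fun hf).
Proof. by have [] := hf. Qed.

HB.instance Definition _ := GRing.isNmodMorphism.Build H T (hom_fun hf) hom_fun_nmod.
HB.instance Definition _ := GRing.isMonoidMorphism.Build H T (hom_fun hf) hom_fun_monoid.
HB.instance Definition _ := GRing.isScalable.Build k H T sc (hom_fun hf) hom_fun_scalable.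

Definition make_lrmorphism : {lrmorphism H -> T | sc} := hom_fun hf.

End MakeMorphism.

(** * Algebra maps and tensor products *)

Section TensorScalar.
Variables (k : fieldType) (A B : comAlgType k).
Local Notation T := (tensor A B).

Fact tensor_scaleAl (c : k) (x y : T) : c *: (x * y) = (c *: x) * y.
Proof.
apply: tensorP => V b hb; rewrite [LHS](tliftZ hb) [LHS]/=.
rewrite [X in _ *: X](tlift_mul _ _ hb) [RHS](tlift_mul _ _ hb).
by rewrite [RHS](tliftZ (bilin_mull y hb)).
Qed.

(** The structure map making the tensor product a possible target of [alg_hom]. *)
Definition tensor_scalar (c : k) : T := c *: (1 : T).

Fact tensor_scalar_nmod : nmod_morphism tensor_scalar.
Proof. by split=> [|a c]; rewrite /tensor_scalar ?scale0r ?scalerDl. Qed.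
Fact tensor_scalar_monoid : monoid_morphism tensor_scalar.
Proof.
split=> [|a c]; rewrite /tensor_scalar ?scale1r //.
by rewrite -tensor_scaleAl mul1r scalerA.
Qed.

HB.instance Definition _ := GRing.isNmodMorphism.Build k T tensor_scalar tensor_scalar_nmod.
HB.instance Definition _ := GRing.isMonoidMorphism.Build k T tensor_scalar tensor_scalar_monoid.

Lemma tensor_scalarE c (x : T) : tensor_scalar c * x = c *: x.
Proof. by rewrite -tensor_scaleAl mul1r. Qed.

End TensorScalar.

(* An alias of [tensor H H] carrying the [comAlgType] structure that makes
   H ⊗ (H ⊗ H) a ring. *)
Definition tensor_square (k : fieldType) (H : comAlgType k) : Type := tensor H H.

Section TensorSquare.
Variables (k : fieldType) (H : comAlgType k).
Local Notation T := (tensor_square H).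

HB.instance Definition _ := GRing.ComPzRing.copy T (tensor H H).
HB.instance Definition _ := GRing.Lmodule.copy T (tensor H H).

Lemma mul_bilinear : is_bilinear (fun a b : H => a * b).
Proof.
split=> [y c a b|x c a b]; first by rewrite mulrDl scalerAl.
by rewrite mulrDr scalerAr.
Qed.

(** The multiplication map to H sends 1 ⊗ 1 to 1. *)
Fact tensor_square_one_neq0 : 1 != 0 :> T.
Proof.
apply/eqP => e; have := tlift_tens 1 1 mul_bilinear.
rewrite -[1 ⊗ 1]/(1 : T) e [LHS](tlift0 mul_bilinear) mulr1 => /esym/eqP.
by rewrite oner_eq0.
Qed.

HB.instance Definition _ := GRing.PzSemiRing_isNonZero.Build T tensor_square_one_neq0.
HB.instance Definition _ := GRing.Lmodule_isLalgebra.Build k T (@tensor_scaleAl k H H).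
HB.instance Definition _ := GRing.Lalgebra_isComAlgebra.Build k T.

End TensorSquare.

(** A predicate on plain functions, with the k-structure of the target given by [iota]; the target
    may be any commutative ring under k, including a tensor product or the zero ring. *)
Definition alg_hom (k : fieldType) (H : comAlgType k) (R : comPzRingType)
    (iota : {rmorphism k -> R}) (f : H -> R) : Prop :=
  alg_hom_for (fun c x => iota c * x) f.

Section AlgHom.
Variables (k : fieldType) (R : comPzRingType) (iota : {rmorphism k -> R}).
Local Notation K := (KAlg iota).

Lemma alg_hom_lrmorphism (H : comAlgType k) (f : H -> R) : alg_hom iota f ->
  exists phi : {lrmorphism H -> K}, phi =1 f.
Proof. by move=> hf; exists (@make_lrmorphism k H (K : pzSemiRingType) *:%R f hf). Qed.

Lemma lrmorphism_alg_hom (H : comAlgType k) (phi : {lrmorphism H -> K}) :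
  alg_hom iota phi.
Proof.
split=> [x y||||c x]; [exact: rmorphD|exact: rmorph0|exact: rmorph1|exact: rmorphM|].
exact: (linearZ_LR phi c x).
Qed.

Variables (A B : comAlgType k) (f : A -> R) (g : B -> R).
Hypotheses (hf : alg_hom iota f) (hg : alg_hom iota g).

Lemma mul_hom_bilinear : is_bilinear (V := K) (fun a b => f a * g b).
Proof.
have [fD _ _ _ fZ] := hf; have [gD _ _ _ gZ] := hg; split=> [y c a b|x c a b].
  by rewrite fD fZ mulrDl -mulrA.
by rewrite gD gZ mulrDr mulrCA.
Qed.

Definition tensor_hom (t : tensor A B) : R := tlift (V := K) (fun a b => f a * g b) t.

Lemma tensor_hom_tens a b : tensor_hom (a ⊗ b) = f a * g b.
Proof. exact: (tlift_tens _ _ mul_hom_bilinear). Qed.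

Lemma tensor_homD : {morph tensor_hom : x y / x + y}.
Proof. exact: (tliftD mul_hom_bilinear). Qed.

Lemma tensor_homZ c t : tensor_hom (c *: t) = iota c * tensor_hom t.
Proof. exact: (tliftZ mul_hom_bilinear). Qed.

Lemma tensor_hom1 : tensor_hom 1 = 1.
Proof.
have [_ _ f1 _ _] := hf; have [_ _ g1 _ _] := hg.
by rewrite [LHS]tensor_hom_tens f1 g1 mulr1.
Qed.

Lemma tensor_homM : {morph tensor_hom : x y / x * y}.
Proof.
have [_ _ _ fM _] := hf; have [_ _ _ gM _] := hg.
move=> x y; rewrite /tensor_hom [LHS](tlift_mul _ _ mul_hom_bilinear).
rewrite /tlift /formal_eval mulr_suml; apply: eq_bigr => p _.
by rewrite mulr_sumr; apply: eq_bigr => q _; rewrite fM gM mulrACA.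
Qed.

End AlgHom.

Lemma alg_hom_algebra (k : fieldType) (H K : comAlgType k) (f : H -> K) :
  alg_hom (in_alg K : {rmorphism k -> K}) f -> exists phi : {lrmorphism H -> K}, phi =1 f.
Proof.
move=> hf; have hS : alg_hom_for (fun c (x : K) => c *: x) f.
  by have [dD d0 d1 dM dZ] := hf; split=> // c x; rewrite dZ mulr_algl.
by exists (@make_lrmorphism k H K *:%R f hS).
Qed.

Lemma alg_hom_comp (k : fieldType) (H K : comAlgType k) (R : comPzRingType)
    (iota : {rmorphism k -> R}) (f : H -> K) (g : K -> R) :
  alg_hom (in_alg K : {rmorphism k -> K}) f -> alg_hom iota g -> alg_hom iota (g \o f).
Proof.
move=> [fD f0 f1 fM fZ] [gD g0 g1 gM gZ]; split=> [x y|||x y|c x] /=.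
- by rewrite fD gD.
- by rewrite f0 g0.
- by rewrite f1 g1.
- by rewrite fM gM.
- by rewrite fZ mulr_algl gZ.
Qed.

Lemma alg_hom_id (k : fieldType) (H : comAlgType k) :
  alg_hom (in_alg H : {rmorphism k -> H}) (@id H).
Proof. by split=> // c x; rewrite mulr_algl. Qed.

Section TensorInjections.
Variables (k : fieldType) (A B : comAlgType k).
Local Notation iota := (tensor_scalar A B : {rmorphism k -> tensor A B}).

Lemma tensl_hom : alg_hom iota (fun a : A => a ⊗ (1 : B)).
Proof.
have tZ c a : (c *: a) ⊗ (1 : B) = c *: (a ⊗ 1) := bilinZl (@tens_bilinear k A B) c a 1.
split=> [x y|||x y|c x].
- exact: (bilinDl (@tens_bilinear k A B)).
- exact: (bilin0l (@tens_bilinear k A B)).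
- by [].
- by rewrite tens_mul mulr1.
- by rewrite tensor_scalarE.
Qed.

Lemma tensr_hom : alg_hom iota (fun b : B => (1 : A) ⊗ b).
Proof.
split=> [x y|||x y|c x].
- exact: (bilinDr (@tens_bilinear k A B)).
- exact: (bilin0r (@tens_bilinear k A B)).
- by [].
- by rewrite tens_mul mulr1.
- by rewrite tensor_scalarE; apply: (bilinZr (@tens_bilinear k A B)).
Qed.

Lemma tens_split (a : A) (b : B) : a ⊗ b = (a ⊗ 1) * (1 ⊗ b).
Proof. by rewrite tens_mul mulr1 mul1r. Qed.

End TensorInjections.

(** What the group functor and the Hopf algebra require of each of the three families. Right
    inverses suffice: [sgroup_inv2] makes them two-sided. *)
Record series_group (k : fieldType) (s : nat)
    (G : forall R : kalg k, series s R -> Prop) : Prop := SeriesGroup {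
  sgroup_nil : forall (R : kalg k) f, G R f -> f [::] = 0;
  sgroup_one : forall R : kalg k, G R (@one_series s R);
  sgroup_mul : forall (R : kalg k) f g, G R f -> G R g -> G R (boxed_conv f g);
  sgroup_inv : forall (R : kalg k) f, G R f ->
    exists2 g, G R g & boxed_conv f g = @one_series s R;
  sgroup_map : forall (R S : kalg k) (phi : kalg_hom R S) f, G R f -> G S (phi \o f)
}.

Section SeriesGroup.
Variables (k : fieldType) (s : nat) (G : forall R : kalg k, series s R -> Prop).
Hypothesis hG : series_group G.

Lemma sgroup_inv2 (R : kalg k) f : G f -> exists g, [/\ G g,
  boxed_conv g f = @one_series s R & boxed_conv f g = @one_series s R].
Proof.
move=> Gf; have [g Gg fg] := sgroup_inv hG Gf; have [h Gh gh] := sgroup_inv hG Gg.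
suff e : f = h by exists g; split=> //; rewrite e.
rewrite -[h]boxed_conv1l ?(sgroup_nil hG Gh) // -fg -boxed_convA gh.
by rewrite boxed_conv1r // (sgroup_nil hG Gf).
Qed.

Lemma series_group_functor : is_group_functor (series_functor G).
Proof.
split.
- move=> R; split=> [f g|f g h _ _ _|]; [exact: sgroup_mul|exact: boxed_convA|].
  exists (@one_series s R); split; first exact: sgroup_one.
    by move=> f /(sgroup_nil hG) f0; split; [exact: boxed_conv1l|exact: boxed_conv1r].
  by move=> f /sgroup_inv2[g [Gg gf fg]]; exists g.
- exact: sgroup_map.
- by move=> R S phi f g _ _; apply: boxed_conv_morph.
- by move=> R phi f e _; apply/funext => w; apply: e.
- by move=> R S T phi psi chi f e _; apply/funext => w; apply: e.
Qed.

End SeriesGroup.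

(** Unfolding [tlift] here writes x as the sum of the pure tensors of a representative, which
    permits computing term by term. *)
Lemma tensor_sum (k : fieldType) (A B : lmodType k) (x : tensor A B) :
  tlift (@tens k A B) x = x.
Proof.
apply: tensorP => V b hb; rewrite (linear_tlift _ _ (tlift_is_linear hb)).
by congr (tlift _ x); apply/funext => u; apply/funext => v; rewrite tlift_tens.
Qed.

(** * Transfer of the group law to a representing algebra *)

Section HopfOfGroup.
Variables (k : fieldType) (s : nat) (G : forall R : kalg k, series s R -> Prop).
Variables (H : comAlgType k) (X : series s H).
Hypothesis hG : series_group G.
Hypothesis rep : @represents k (series_functor G) H (coord_point X).

Lemma point_in (R : comPzRingType) (iota : {rmorphism k -> R}) f :
  alg_hom iota f -> @G (KAlg iota) (f \o X).
Proof.
move=> /alg_hom_lrmorphism[phi e]; have [h _ _ _] := rep.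
by have := h _ phi; rewrite /= /coord_point (funext e).
Qed.

Lemma point_inj (R : comPzRingType) (iota : {rmorphism k -> R}) f g :
  alg_hom iota f -> alg_hom iota g -> f \o X = g \o X -> f =1 g.
Proof.
move=> /alg_hom_lrmorphism[phi e] /alg_hom_lrmorphism[psi e'] fg x.
have [_ h _ _] := rep; rewrite -e -e'; apply: (h (KAlg iota)).
by rewrite /coord_point (funext e) (funext e').
Qed.

Lemma point_surj (R : comPzRingType) (iota : {rmorphism k -> R}) (x : series s R) :
  @G (KAlg iota) x -> exists2 f : H -> R, alg_hom iota f & f \o X = x.
Proof.
have [_ _ h _] := rep => /h[phi e]; exists phi => //.
exact: lrmorphism_alg_hom.
Qed.

Lemma X_nil : X [::] = 0.
Proof.
exact: (sgroup_nil hG (point_in (@alg_hom_id k H))).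
Qed.

Local Notation inl := (fun a : H => a ⊗ (1 : H)).
Local Notation inr := (fun a : H => (1 : H) ⊗ a).

Section WithComul.
Variable D : {lrmorphism H -> tensor H H}.
Hypothesis DX : D \o X = boxed_conv (inl \o X) (inr \o X).

Section Convolution.
Variables (R : comPzRingType) (iota : {rmorphism k -> R}).

Definition conv (f g : H -> R) (x : H) : R := tensor_hom iota f g (D x).

Variables (f g : H -> R).
Hypotheses (hf : alg_hom iota f) (hg : alg_hom iota g).

Lemma conv_hom : alg_hom iota (conv f g).
Proof.
rewrite /conv; split=> [x y|||x y|c x].
- by rewrite rmorphD (tensor_homD hf hg).
- by rewrite rmorph0; apply: (tlift0 (mul_hom_bilinear hf hg)).
- by rewrite rmorph1 (tensor_hom1 hf hg).
- by rewrite rmorphM (tensor_homM hf hg).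
- by rewrite linearZ (tensor_homZ hf hg).
Qed.

(** [tensor_hom] is a ring map sending a ⊗ 1 to f a and 1 ⊗ a to g a, and ring maps commute with
    boxed convolution; it is applied to [DX]. *)
Lemma conv_coord : conv f g \o X = boxed_conv (f \o X) (g \o X).
Proof.
have hh : (tensor_hom iota f g) \o (D \o X) =
    boxed_conv (tensor_hom iota f g \o (inl \o X)) (tensor_hom iota f g \o (inr \o X)).
  rewrite DX; apply/funext => -[|i w] /=; first exact: (tlift0 (mul_hom_bilinear hf hg)).
  rewrite (big_morph _ (tensor_homD hf hg) (tlift0 (mul_hom_bilinear hf hg))).
  apply: eq_bigr => P _; rewrite (tensor_homM hf hg) /part_coef.
  by rewrite !(big_morph _ (tensor_homM hf hg) (tensor_hom1 hf hg)).
rewrite -[LHS]/(tensor_hom iota f g \o (D \o X)) hh.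
have [_ _ f1 _ _] := hf; have [_ _ g1 _ _] := hg.
congr boxed_conv; apply/funext => w /=; rewrite (tensor_hom_tens hf hg).
  by rewrite g1 mulr1.
by rewrite f1 mul1r.
Qed.

End Convolution.

Lemma conv_assoc (R : comPzRingType) (iota : {rmorphism k -> R}) f g h :
  alg_hom iota f -> alg_hom iota g -> alg_hom iota h ->
  conv iota f (conv iota g h) =1 conv iota (conv iota f g) h.
Proof.
move=> hf hg hh; have hfg := conv_hom hf hg; have hgh := conv_hom hg hh.
apply: (point_inj (conv_hom hf hgh) (conv_hom hfg hh)).
by rewrite !conv_coord // boxed_convA.
Qed.

Local Notation T3 := (tensor H (tensor_square H)).
Let iota3 := (tensor_scalar H (tensor_square H) : {rmorphism k -> T3}).
Let i1 (a : H) : T3 := a ⊗ (1 : tensor_square H).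
Let i2 (a : H) : T3 := (1 : H) ⊗ (a ⊗ 1 : tensor_square H).
Let i3 (a : H) : T3 := (1 : H) ⊗ (1 ⊗ a : tensor_square H).

Let i1_hom : alg_hom iota3 i1.
Proof. exact: tensl_hom. Qed.

Let right_hom (f : H -> tensor_square H) :
  alg_hom (tensor_scalar H H : {rmorphism k -> tensor H H}) f ->
  alg_hom iota3 (fun a => (1 : H) ⊗ f a).
Proof.
move=> [fD f0 f1 fM fZ]; have [gD g0 g1 gM gZ] := @tensr_hom k H (tensor_square H).
split=> [x y|||x y|c x].
- by rewrite fD gD.
- by rewrite f0 g0.
- by rewrite f1.
- by rewrite fM gM.
- by rewrite fZ tensor_scalarE gZ.
Qed.

Let i2_hom : alg_hom iota3 i2.
Proof. by apply: right_hom; apply: tensl_hom. Qed.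
Let i3_hom : alg_hom iota3 i3.
Proof. by apply: right_hom; apply: tensr_hom. Qed.

(** Both sides are the product of the three inclusions of H into H ⊗ (H ⊗ H), bracketed in the two
    possible ways. *)
Lemma comul_coassoc x : tassoc (tmap D idfun (D x)) = tmap idfun D (D x).
Proof.
have i123 a b c : a ⊗ (b ⊗ c : tensor_square H) = i1 a * i2 b * i3 c.
  by rewrite /i1 /i2 /i3 !tens_mul !mulr1 !mul1r.
have bil c : is_bilinear (fun a b : H => a ⊗ (b ⊗ c) : tensor H (tensor H H)).
  split=> [b d u v|a d u v]; first exact: (tens_bilinear _ _).1.
  by rewrite (tens_bilinear H H).1 (tens_bilinear _ _).2.
have bil3 : is_bilinear (fun x c => tlift (fun a b : H => a ⊗ (b ⊗ c)) x
    : tensor H (tensor H H)).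
  split=> [c d u v|u d a b]; first exact: (tlift_is_linear (bil c)).
  rewrite /tlift /formal_eval scaler_sumr -big_split; apply: eq_bigr => p _ /=.
  by rewrite (tens_bilinear H H).2 (tens_bilinear _ _).2.
transitivity (conv iota3 (conv iota3 i1 i2) i3 x).
  rewrite /tmap /tassoc (linear_tlift _ _ (tlift_is_linear bil3)).
  rewrite /conv /tensor_hom /tlift /formal_eval; apply: eq_bigr => p _.
  rewrite [LHS](tlift_tens _ _ bil3) /tlift /formal_eval mulr_suml.
  by apply: eq_bigr => q _; rewrite i123.
rewrite -conv_assoc // /conv /tmap /tensor_hom /tlift /formal_eval.
apply: eq_bigr => p _; rewrite -[in RHS](tensor_sum (D p.2)) [in RHS]/tlift /formal_eval.
rewrite mulr_sumr (big_morph _ (bilinDr (tens_bilinear _ _) p.1) (bilin0r (tens_bilinear _ _) p.1)).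
by apply: eq_bigr => q _; rewrite i123 mulrA.
Qed.

End WithComul.

Lemma hopf_of_group : exists h : hopf_algebra H,
  induced_by_boxed_conv h X /\ @hopf_represents k (series_functor G) H h (coord_point X).
Proof.
have idh := @alg_hom_id k H.
have [D0 hD0 DX0] : exists2 f : H -> tensor H H,
    alg_hom (tensor_scalar H H : {rmorphism k -> tensor H H}) f &
    f \o X = boxed_conv (inl \o X) (inr \o X).
  apply: point_surj; apply: (sgroup_mul hG); apply: point_in.
    exact: tensl_hom.
  exact: tensr_hom.
have [D eD] : exists D : {lrmorphism H -> tensor H H}, D =1 D0.
  have hD : alg_hom_for (fun c (x : tensor H H) => c *: x) D0.
    by have [dD d0 d1 dM dZ] := hD0; split=> // c x; rewrite dZ tensor_scalarE.
  by exists (@make_lrmorphism k H (tensor H H : pzSemiRingType) *:%R D0 hD).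
have DX : D \o X = boxed_conv (inl \o X) (inr \o X) by rewrite -DX0 (funext eD).
have [E0 hE0 EX0] : exists2 f : H -> k, alg_hom (idfun : {rmorphism k -> k}) f &
    f \o X = @one_series s k.
  by apply: point_surj; apply: (sgroup_one hG).
have [E eE] : exists E : {lrmorphism H -> k^o}, E =1 E0.
  by exists (@make_lrmorphism k H (k^o : pzSemiRingType) *:%R E0 hE0).
have EX : E \o X = @one_series s k by rewrite -EX0 (funext eE).
(* The counit followed by the unit of H is the identity of the group of H-points, so the counit
   axioms say that convolving the identity map with it changes nothing. *)
pose unitE (x : H) : H := (E x)%:A.
have hunit : alg_hom (in_alg H : {rmorphism k -> H}) unitE.
  rewrite /unitE; split=> [x y|||x y|c x].
  - by rewrite rmorphD scalerDl.
  - by rewrite rmorph0 scale0r.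
  - by rewrite rmorph1 scale1r.
  - by rewrite rmorphM -scalerAl mul1r scalerA.
  - by rewrite linearZ /= -scalerAl mul1r scalerA.
have unitX : unitE \o X = @one_series s H.
  apply/funext => w; rewrite /unitE /= -[E (X w)]/((E \o X) w) EX.
  by case: w => [|i [|j w]]; rewrite /one_series /linear_series ?scale0r ?scale1r.
have [S0 hS XS] : exists2 f : H -> H, alg_hom (in_alg H : {rmorphism k -> H}) f &
    boxed_conv (f \o X) X = @one_series s H /\ boxed_conv X (f \o X) = @one_series s H.
  have [g [Gg gX Xg]] := sgroup_inv2 hG (point_in idh).
  by have [f hf fX] := point_surj Gg; exists f; rewrite // fX.
have [S eS] := alg_hom_algebra hS.
have cl x : tlift (fun a b => E a *: b) (D x) = x.
  transitivity (conv D (in_alg H) unitE id x).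
    rewrite /conv /tensor_hom; congr (tlift _ _); apply/funext => a; apply/funext => b.
    by rewrite mulr_algl.
  apply: (point_inj (conv_hom D hunit idh) idh).
  by rewrite (conv_coord DX hunit idh) unitX boxed_conv1l //=; apply: X_nil.
have cr x : tlift (fun a b => E b *: a) (D x) = x.
  transitivity (conv D (in_alg H) id unitE x).
    rewrite /conv /tensor_hom; congr (tlift _ _); apply/funext => a; apply/funext => b.
    by rewrite mulr_algr.
  apply: (point_inj (conv_hom D idh hunit) idh).
  by rewrite (conv_coord DX idh hunit) unitX boxed_conv1r //=; apply: X_nil.
have al x : tlift (fun a b => S a * b) (D x) = E x *: 1.
  rewrite (funext eS); apply: (point_inj (conv_hom D hS idh) hunit).
  by rewrite (conv_coord DX hS idh) unitX; case: XS.
have ar x : tlift (fun a b => a * S b) (D x) = E x *: 1.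
  rewrite (funext eS); apply: (point_inj (conv_hom D idh hS) hunit).
  by rewrite (conv_coord DX idh hS) unitX; case: XS.
exists (HopfAlgebra (comul_coassoc DX) cl cr al ar); split=> [w w0|] /=.
  split.
    rewrite -[LHS]/((D \o X) w) DX; case: w w0 => // i w _; apply: eq_bigr => P _.
    have [_ _ l1 lM _] := @tensl_hom k H H; have [_ _ r1 rM _] := @tensr_hom k H H.
    by rewrite [RHS]tens_split /part_coef (big_morph _ lM l1) (big_morph _ rM r1).
  by rewrite -[LHS]/((E \o X) w) EX; case: w w0 => [|i []].
split=> // -[R iota] phi psi.
have hphi := lrmorphism_alg_hom phi; have hpsi := lrmorphism_alg_hom psi.
have [chi e] := alg_hom_lrmorphism (conv_hom D hphi hpsi).
exists chi => //; rewrite /coord_point (funext e).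
exact: (conv_coord DX hphi hpsi).
Qed.

End HopfOfGroup.

(** * Points of the coordinate algebras *)

Section MonoidAlgebraMaps.
Variables (k : fieldType) (M : nmodType).
Local Notation A := (monoid_algebra k M).

Lemma mono_scale c (m : M) : c *: mono k m = << c *g m >>.
Proof. by apply/malgP => n; rewrite [LHS]mcoeffZ !mcoeffU mulrnAr mulr1. Qed.

Lemma monoE (x : A) : x = \sum_(m <- msupp x) x@_m *: mono k m.
Proof. by rewrite {1}(monalgE x); apply: eq_bigr => m _; rewrite mono_scale. Qed.

Lemma mono1 : mono k (0 : M) = 1. Proof. by []. Qed.

Section Extension.
Variables (R : comPzRingType) (iota : {rmorphism k -> R}) (phi : M -> R).
Hypotheses (phi0 : phi 0 = 1) (phiD : forall m n, phi (m + n) = phi m * phi n).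

Definition mono_ext (x : A) : R := \sum_(m <- msupp x) iota x@_m * phi m.

Lemma mono_extw (d : {fset M}) (x : A) : (msupp x `<=` d)%fset ->
  mono_ext x = \sum_(m <- d) iota x@_m * phi m.
Proof.
move=> le; apply: big_fset_incl => // m _ /mcoeff_outdom ->.
by rewrite rmorph0 mul0r.
Qed.

Lemma mono_extD : {morph mono_ext : x y / x + y}.
Proof.
move=> x y; rewrite (mono_extw (msuppD_le x y)).
rewrite (mono_extw (fsubsetUl (msupp x) (msupp y))).
rewrite (mono_extw (fsubsetUr (msupp x) (msupp y))) -big_split.
by apply: eq_bigr => m _; rewrite mcoeffD rmorphD mulrDl.
Qed.

Lemma mono_ext0 : mono_ext 0 = 0.
Proof. by rewrite /mono_ext msupp0 big_seq_fset0. Qed.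

Lemma mono_extZ c x : mono_ext (c *: x) = iota c * mono_ext x.
Proof.
rewrite (mono_extw (msuppZ_le c x)) mulr_sumr; apply: eq_bigr => m _.
by rewrite mcoeffZ rmorphM mulrA.
Qed.

Lemma mono_ext_mono m : mono_ext (mono k m) = phi m.
Proof.
by rewrite (mono_extw msuppU_le) big_seq_fset1 mcoeffUU rmorph1 mul1r.
Qed.

Lemma mono_extM : {morph mono_ext : x y / x * y}.
Proof.
have extS (I : Type) (r : seq I) (F : I -> A) :
    mono_ext (\sum_(i <- r) F i) = \sum_(i <- r) mono_ext (F i).
  exact: (big_morph _ mono_extD mono_ext0).
move=> x y; rewrite (monoE x) (monoE y) mulr_suml !extS mulr_suml.
apply: eq_bigr => m _; rewrite mulr_sumr extS mulr_sumr; apply: eq_bigr => n _.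
rewrite -scalerAl -scalerAr mono_mulE !mono_extZ !mono_ext_mono phiD.
by rewrite mulrACA !mulrA.
Qed.

Lemma mono_ext_hom : alg_hom iota mono_ext.
Proof.
split; [exact: mono_extD|exact: mono_ext0| |exact: mono_extM|exact: mono_extZ].
by rewrite -mono1 mono_ext_mono.
Qed.

End Extension.

Lemma eq_mono_hom (R : comPzRingType) (iota : {rmorphism k -> R}) (f g : A -> R) :
  alg_hom iota f -> alg_hom iota g -> (forall m, f (mono k m) = g (mono k m)) -> f =1 g.
Proof.
move=> [fD f0 _ _ fZ] [gD g0 _ _ gZ] e x; rewrite (monoE x).
rewrite (big_morph _ fD f0) (big_morph _ gD g0); apply: eq_bigr => m _.
by rewrite fZ gZ e.
Qed.

End MonoidAlgebraMaps.

Lemma pairD (U V : nmodType) (a c : U) (b d : V) :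
  (a, b) + (c, d) = (a + c, b + d) :> (U * V)%type.
Proof. by []. Qed.

Section PowersWithInverse.
Variables (R : comPzRingType) (u v : R).
Hypothesis uv : u * v = 1.

(** R is any commutative ring, so negative powers are powers of a given inverse v; [Negz n] stands
    for -(n + 1), hence the exponent. *)
Definition zpow (z : int) : R := match z with Posz n => u ^+ n | Negz n => v ^+ n.+1 end.

Lemma zpow_sub (m n : nat) : zpow (m%:Z - n%:Z) = u ^+ m * v ^+ n.
Proof.
have uvn p : u ^+ p * v ^+ p = 1 by rewrite -exprMn uv expr1n.
have [le|lt] := leqP n m.
  by rewrite -(subnK le) PoszD addrK /= exprD -mulrA uvn mulr1.
have -> : m%:Z - n%:Z = Negz (n - m.+1) by rewrite NegzE; lia.
rewrite /= -[in RHS](subnKC lt) addSnnS exprD mulrA uvn mul1r.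
by [].
Qed.

Lemma zpowD a b : zpow (a + b) = zpow a * zpow b.
Proof.
have dec (z : int) : exists m n : nat, z = m%:Z - n%:Z.
  case: z => n; first by exists n, 0%N; rewrite subr0.
  by exists 0%N, n.+1; rewrite NegzE sub0r.
have [[m [n ->]] [p [q ->]]] := (dec a, dec b).
have -> : m%:Z - n%:Z + (p%:Z - q%:Z) = (m + p)%N%:Z - (n + q)%N%:Z by lia.
by rewrite !zpow_sub !exprD mulrACA.
Qed.

End PowersWithInverse.

Section Exponents.
Variables (s : nat).
Local Notation L := (laurent_exp s).
Local Notation W := (poly_exp s).

Lemma laurent_exp_ind (P : L -> Prop) : P 0 -> (forall a b, P a -> P b -> P (a + b)) ->
  (forall a, P a -> P (- a)) -> (forall i, P (unit_exp i)) -> forall a, P a.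
Proof.
move=> P0 PD PN PU a.
have Pn i n : P (unit_exp i *+ n) by elim: n => // n IH; rewrite mulrS; apply: PD.
have -> : a = \sum_i unit_exp i *~ a i.
  apply/ffunP => j; rewrite sum_ffunE (bigD1 j) //= big1 => [|i ij].
    by rewrite ffunMzE ffunE eqxx addr0 -mulrzr mul1r intz.
  by rewrite ffunMzE ffunE eq_sym (negbTE ij) mul0rz.
apply: big_ind => // i _; case: (a i) => n; first exact: Pn.
by rewrite NegzE mulrNz; apply: PN; apply: Pn.
Qed.

Lemma poly_expE (p q : W) (w : long_word s) :
  ((p + q : W) : {cmonom (long_word s)}) w =
  ((p : {cmonom _}) w + (q : {cmonom _}) w)%N.
Proof. exact: cmM. Qed.

Lemma poly_exp_ind (P : W -> Prop) : P 0 -> (forall a b, P a -> P b -> P (a + b)) ->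
  (forall w, P (word_exp w)) -> forall p, P p.
Proof.
move=> P0 PD PU p; have [n] := ubnP (mdeg p); elim: n p => // n IH p hp.
have [p0|] := eqVneq (finsupp (p : {cmonom _})) fset0.
  suff -> : p = 0 by [].
  apply/eqP/cmP => w; rewrite [RHS]cm1; apply/eqP.
  by rewrite cmE_eq0 p0 in_fset0.
case/fset0Pn => w; rewrite -cmE_neq0 => pw.
(* One occurrence of w is divided out of p, which lowers the degree. *)
pose q : W := divcm p (ucm w).
have e : p = word_exp w + q.
  apply/eqP/cmP => z; rewrite poly_expE divcmE /word_exp ucmE.
  by case: eqVneq => [<-|_]; [rewrite subnKC // lt0n|rewrite add0n subn0].
rewrite e; apply: PD => //; apply: IH; rewrite e mdegM mdegU add1n ltnS in hp.
exact: hp.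
Qed.

Definition laurent_eval (R : comPzRingType) (u v : 'I_s -> R) (l : L) : R :=
  \prod_i zpow (u i) (v i) (l i).

Lemma laurent_evalD (R : comPzRingType) (u v : 'I_s -> R) (a b : L) :
  (forall i, u i * v i = 1) ->
  laurent_eval u v (a + b) = laurent_eval u v a * laurent_eval u v b.
Proof.
by move=> uv; rewrite -big_split; apply: eq_bigr => i _; rewrite ffunE zpowD.
Qed.

Lemma laurent_eval0 (R : comPzRingType) (u v : 'I_s -> R) : laurent_eval u v 0 = 1.
Proof. by rewrite /laurent_eval big1 // => i _; rewrite ffunE. Qed.

Lemma laurent_eval_unit (R : comPzRingType) (u v : 'I_s -> R) i :
  laurent_eval u v (unit_exp i) = u i.
Proof.
rewrite /laurent_eval (bigD1 i) //= big1 => [|j ji]; rewrite ffunE ?eqxx ?mulr1 //=.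
by rewrite (negbTE ji).
Qed.

Definition poly_eval (R : comPzRingType) (x : long_word s -> R) (p : W) : R :=
  \prod_(w <- finsupp (p : {cmonom _})) x w ^+ (p : {cmonom _}) w.

Lemma poly_evalw (R : comPzRingType) (x : long_word s -> R) (p : W) d :
  (finsupp (p : {cmonom _}) `<=` d)%fset ->
  poly_eval x p = \prod_(w <- d) x w ^+ (p : {cmonom _}) w.
Proof.
move=> le; apply: big_fset_incl => // w _; rewrite -cmE_eq0 => /eqP ->.
by rewrite expr0.
Qed.

Lemma poly_evalD (R : comPzRingType) (x : long_word s -> R) (p q : W) :
  poly_eval x (p + q) = poly_eval x p * poly_eval x q.
Proof.
have e : finsupp (p + q : {cmonom _}) =
    (finsupp (p : {cmonom _}) `|` finsupp (q : {cmonom _}))%fset.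
  exact: mdomD.
rewrite [LHS]/poly_eval e (poly_evalw x (fsubsetUl _ (finsupp (q : {cmonom _})))).
rewrite (poly_evalw x (fsubsetUr (finsupp (p : {cmonom _})) _)) -big_split.
by apply: eq_bigr => w _; rewrite poly_expE exprD.
Qed.

Lemma poly_eval0 (R : comPzRingType) (x : long_word s -> R) : poly_eval x 0 = 1.
Proof. by rewrite /poly_eval mdom1 big_seq_fset0. Qed.

Lemma poly_eval_word (R : comPzRingType) (x : long_word s -> R) w :
  poly_eval x (word_exp w) = x w.
Proof. by rewrite /poly_eval mdomU big_seq_fset1 cmUU. Qed.

End Exponents.

Section Coordinates.
Variables (k : fieldType) (s : nat).
Implicit Types (i : 'I_s) (v : long_word s).

Lemma coord_letter i :
  coord_series k [:: i] = mono k ((unit_exp i, 0) : laurent_exp s * poly_exp s).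
Proof. by rewrite /coord_series insubN. Qed.

Lemma coord_word v :
  coord_series k (val v) = mono k ((0, word_exp v) : laurent_exp s * poly_exp s).
Proof. by rewrite /coord_series valK. Qed.

Lemma mono_pair (l : laurent_exp s) (p : poly_exp s) :
  mono k ((l, p) : laurent_exp s * poly_exp s) = mono k (l, 0) * mono k (0, p).
Proof. by rewrite mono_mulE pairD addr0 add0r. Qed.

Lemma mono_pairl (a b : laurent_exp s) :
  mono k ((a + b, 0) : laurent_exp s * poly_exp s) = mono k (a, 0) * mono k (b, 0).
Proof. by rewrite mono_mulE pairD addr0. Qed.

Lemma mono_pairr (a b : poly_exp s) :
  mono k ((0, a + b) : laurent_exp s * poly_exp s) = mono k (0, a) * mono k (0, b).
Proof. by rewrite mono_mulE pairD addr0. Qed.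

Lemma bar_letter i : bar_series k [:: i] = 1.
Proof. by rewrite /bar_series insubN. Qed.

Lemma bar_word v : bar_series k (val v) = mono k (word_exp v).
Proof. by rewrite /bar_series valK. Qed.

Lemma wordP (w : seq 'I_s) :
  [\/ w = [::], exists i, w = [:: i] | exists v : long_word s, w = val v].
Proof.
case: w => [|i [|j w]]; [by constructor 1|by constructor 2; exists i|constructor 3].
by exists (exist _ [:: i, j & w] isT).
Qed.

End Coordinates.

Section Points.
Variables (k : fieldType) (s : nat) (R : comPzRingType) (iota : {rmorphism k -> R}).
Implicit Types (x : series s R) (f g : coord_algebra k s -> R).

Lemma inv_uniq (a b c : R) : a * b = 1 -> a * c = 1 -> b = c.
Proof. by move=> ab ac; rewrite -[b]mulr1 -ac mulrCA mulrA ab mul1r. Qed.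

(** Agreement passes from a to - a because inverses in R are unique. *)
Lemma eq_laurent_eval (f g : laurent_exp s -> R) :
  (forall a b, f (a + b) = f a * f b) -> (forall a b, g (a + b) = g a * g b) ->
  f 0 = 1 -> g 0 = 1 -> (forall i, f (unit_exp i) = g (unit_exp i)) -> f =1 g.
Proof.
move=> fD gD f0 g0 fg; apply: laurent_exp_ind; rewrite ?f0 ?g0 //.
  by move=> a b ea eb; rewrite fD gD ea eb.
move=> a ea; apply: (@inv_uniq (f a)); first by rewrite -fD subrr.
by rewrite ea -gD subrr.
Qed.

Lemma coord_hom_inj f g : alg_hom iota f -> alg_hom iota g ->
  (forall w, f (coord_series k w) = g (coord_series k w)) -> f =1 g.
Proof.
move=> hf hg e; have [_ _ f1 fM _] := hf; have [_ _ g1 gM _] := hg.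
apply: (eq_mono_hom hf hg) => -[l p].
rewrite mono_pair.
rewrite fM gM; congr (_ * _).
  apply: (eq_laurent_eval (f := fun l => f (mono k (l, 0)))
    (g := fun l => g (mono k (l, 0)))) => [a b|a b|||i].
  - by rewrite -fM mono_mulE pairD addr0.
  - by rewrite -gM mono_mulE pairD addr0.
  - exact: f1.
  - exact: g1.
  - by rewrite -coord_letter.
elim/poly_exp_ind: p => [|a b ea eb|w]; first by rewrite [mono _ _]mono1 f1 g1.
  rewrite mono_pairr.
  by rewrite [LHS]fM [RHS]gM; congr (_ * _).
by rewrite -coord_word.
Qed.

Lemma coord_hom_surj x : x [::] = 0 -> (forall i, invertible (x [:: i])) ->
  exists2 f, alg_hom iota f & f \o @coord_series k s = x.
Proof.
move=> x0 inv; have [y xy] := choice inv.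
pose phi (m : laurent_exp s * poly_exp s) :=
  laurent_eval (fun i => x [:: i]) y m.1 * poly_eval (fun v : long_word s => x (val v)) m.2.
have phi0 : phi 0 = 1 by rewrite /phi laurent_eval0 poly_eval0 mulr1.
have phiD m n : phi (m + n) = phi m * phi n.
  by rewrite /phi laurent_evalD // poly_evalD mulrACA.
exists (mono_ext iota phi); first exact: mono_ext_hom.
apply/funext => w /=; have [->|[i ->]|[v ->]] := wordP w.
- by rewrite x0 /coord_series insubN // mono_ext0.
- by rewrite coord_letter mono_ext_mono /phi laurent_eval_unit poly_eval0 mulr1.
- by rewrite coord_word mono_ext_mono /phi laurent_eval0 poly_eval_word mul1r.
Qed.

Lemma laurent_hom_inj (f g : laurent_algebra k s -> R) : alg_hom iota f -> alg_hom iota g ->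
  (forall w, f (laurent_series k w) = g (laurent_series k w)) -> f =1 g.
Proof.
move=> hf hg e; have [_ _ f1 fM _] := hf; have [_ _ g1 gM _] := hg.
apply: (eq_mono_hom hf hg); apply: eq_laurent_eval => [a b|a b|||i].
- by rewrite -fM mono_mulE.
- by rewrite -gM mono_mulE.
- exact: f1.
- exact: g1.
- exact: (e [:: i]).
Qed.

Lemma laurent_hom_surj (a : 'I_s -> R) : (forall i, invertible (a i)) ->
  exists2 f, alg_hom iota f & f \o @laurent_series k s = linear_series a.
Proof.
move=> inv; have [y xy] := choice inv.
have phiD m n := laurent_evalD m n xy.
exists (mono_ext iota (laurent_eval a y)).
  by apply: mono_ext_hom => //; apply: laurent_eval0.
apply/funext => -[|i [|j w]] /=; rewrite ?mono_ext0 //.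
by rewrite mono_ext_mono laurent_eval_unit.
Qed.

Lemma bar_hom_inj (f g : bar_algebra k s -> R) : alg_hom iota f -> alg_hom iota g ->
  (forall w, f (bar_series k w) = g (bar_series k w)) -> f =1 g.
Proof.
move=> hf hg e; have [_ _ f1 fM _] := hf; have [_ _ g1 gM _] := hg.
apply: (eq_mono_hom hf hg); apply: poly_exp_ind => [|a b ea eb|w].
- by rewrite [mono _ _]mono1 f1 g1.
- rewrite -(mono_mulE k a b). rewrite [LHS]fM [RHS]gM; exact: (congr2 *%R ea eb).
- by rewrite -bar_word.
Qed.

Lemma bar_hom_surj x : x [::] = 0 -> (forall i, x [:: i] = 1) ->
  exists2 f, alg_hom iota f & f \o @bar_series k s = x.
Proof.
move=> x0 x1; pose phi := poly_eval (fun v : long_word s => x (val v)).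
have hphi : alg_hom iota (mono_ext iota phi).
  by apply: mono_ext_hom; [exact: poly_eval0|exact: poly_evalD].
exists (mono_ext iota phi) => //.
apply/funext => w /=; have [->|[i ->]|[v ->]] := wordP w.
- by rewrite x0 /bar_series insubN // mono_ext0.
- by rewrite bar_letter x1; have [_ _ ->] := hphi.
- by rewrite bar_word mono_ext_mono /phi poly_eval_word.
Qed.

End Points.

(** * Representability of the three functors *)

Section Representability.
Variables (k : fieldType) (s : nat).

(** Passing between bundled morphisms and plain functions is settled here once for the three
    functors; naturality is automatic, points being compositions with X. *)
Lemma represents_points (G : forall R : kalg k, series s R -> Prop) (H : comAlgType k)
    (X : series s H) :
  (forall (R : comPzRingType) (iota : {rmorphism k -> R}) (f : H -> R),
     alg_hom iota f -> @G (KAlg iota) (f \o X)) ->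
  (forall (R : comPzRingType) (iota : {rmorphism k -> R}) (f g : H -> R),
     alg_hom iota f -> alg_hom iota g -> (forall w, f (X w) = g (X w)) -> f =1 g) ->
  (forall (R : comPzRingType) (iota : {rmorphism k -> R}) (x : series s R),
     @G (KAlg iota) x -> exists2 f : H -> R, alg_hom iota f & f \o X = x) ->
  @represents k (series_functor G) H (coord_point X).
Proof.
move=> hin hinj hsurj; split.
- by move=> [R iota] phi; apply: hin; apply: lrmorphism_alg_hom.
- move=> [R iota] phi psi e; apply: (hinj R iota); try exact: lrmorphism_alg_hom.
  by move=> w; have := congr1 (fun f => f w) e.
- move=> [R iota] x /hsurj[f hf fX]; have [phi e] := alg_hom_lrmorphism hf.
  by exists phi; rewrite /coord_point (funext e).
- by move=> R S f phi psi e; apply/funext => w /=; rewrite /coord_point /= e.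
Qed.

Lemma invertible_map (R S : comPzRingType) (f : {rmorphism R -> S}) x :
  invertible x -> invertible (f x).
Proof. by case=> y xy; exists (f y); rewrite -rmorphM xy rmorph1. Qed.

Lemma GG_group : series_group (fun R : kalg k => @fin k (GG k s) R).
Proof.
split.
- by move=> R f [].
- by move=> R; split=> // i; exists 1; rewrite mulr1.
- move=> R f g [_ fi] [_ gi]; split=> // i; rewrite boxed_conv_letter.
  have [[y fy] [z gz]] := (fi i, gi i); exists (y * z).
  by rewrite mulrACA fy gz mulr1.
- move=> R f [f0 fi]; have [g g0 fg] := boxed_conv_invr fi; exists g => //.
  split=> // i; have [y _] := fi i; exists (f [:: i]); rewrite mulrC.
  by rewrite -boxed_conv_letter fg.
- by move=> R S phi f [f0 fi]; split=> [|i] /=; rewrite ?f0 ?rmorph0 //; apply: invertible_map.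
Qed.

Lemma GG_represents : represents (F := GG k s) (coord_point (@coord_series k s)).
Proof.
apply: represents_points; last first.
- by move=> R iota x [x0 xi]; apply: coord_hom_surj.
- exact: coord_hom_inj.
move=> R iota f [_ f0 f1 fM _]; split=> [|i] /=; first by rewrite /coord_series insubN.
exists (f (mono k ((- unit_exp i, 0) : laurent_exp s * poly_exp s))).
by rewrite coord_letter -[LHS]fM mono_mulE pairD subrr addr0 -[RHS]f1.
Qed.

Lemma GG1_group : series_group (fun R : kalg k => @fin k (GG1 k s) R).
Proof.
split.
- by move=> R f [a _ ->].
- by move=> R; exists (fun _ => 1) => // i; exists 1; rewrite mulr1.
- move=> R f g [a ai ->] [b bi ->]; exists (fun i => a i * b i).
    move=> i; have [[y fy] [z gz]] := (ai i, bi i); exists (y * z).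
    by rewrite mulrACA fy gz mulr1.
  exact: boxed_conv_linear.
- move=> R f [a ai ->]; have [y ay] := choice ai; exists (linear_series y).
    by exists y => // i; exists (a i); rewrite mulrC.
  by rewrite boxed_conv_linear; congr linear_series; apply/funext => i.
- move=> R S phi f [a ai ->]; exists (phi \o a) => [i|]; first exact: invertible_map.
  by apply/funext => -[|i [|j w]] //=; rewrite rmorph0.
Qed.

Lemma GG1_represents : represents (F := GG1 k s) (coord_point (@laurent_series k s)).
Proof.
apply: represents_points; last first.
- by move=> R iota x [a ai ->]; apply: laurent_hom_surj.
- exact: laurent_hom_inj.
move=> R iota f [_ f0 f1 fM _]; exists (fun i => f (mono k (unit_exp i))) => [i|].
  exists (f (mono k (- unit_exp i))).
  by rewrite -[LHS]fM mono_mulE subrr -[RHS]f1.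
by apply/funext => -[|i [|j w]].
Qed.

Lemma GGplus_group : series_group (fun R : kalg k => @fin k (GGplus k s) R).
Proof.
split.
- by move=> R f [].
- by move=> R; split.
- by move=> R f g [_ fi] [_ gi]; split=> // i; rewrite boxed_conv_letter fi gi mulr1.
- move=> R f [f0 fi]; have inv i : invertible (f [:: i]) by exists 1; rewrite fi mulr1.
  have [g g0 fg] := boxed_conv_invr inv; exists g => //; split=> // i.
  by rewrite -[LHS]mul1r -(fi i) -boxed_conv_letter fg.
- by move=> R S phi f [f0 fi]; split=> [|i] /=; rewrite ?f0 ?fi ?rmorph0 ?rmorph1.
Qed.

Lemma GGplus_represents : represents (F := GGplus k s) (coord_point (@bar_series k s)).
Proof.
apply: represents_points; last first.
- by move=> R iota x [x0 x1]; apply: bar_hom_surj.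
- exact: bar_hom_inj.
move=> R iota f [_ f0 f1 _ _]; split=> [|i] /=; first by rewrite /bar_series insubN.
by rewrite bar_letter.
Qed.

End Representability.

(** * Filtrations and co-connectedness *)

Section LinSpan.
Variables (k : fieldType) (V : lmodType k).
Implicit Types (S : V -> Prop) (u v : V).

Lemma lin_span_gen S u : S u -> lin_span S u.
Proof.
by move=> Su; exists 1%N, (fun _ => 1), (fun _ => u); rewrite big_ord1 scale1r.
Qed.

Lemma lin_span0 S : lin_span S 0.
Proof. by exists 0%N, (fun _ => 0), (fun _ => 0); split=> [[]|] //; rewrite big_ord0. Qed.

Lemma lin_spanD S u v : lin_span S u -> lin_span S v -> lin_span S (u + v).
Proof.
move=> [m [c [x [Sx ->]]]] [n [d [y [Sy ->]]]].
exists (m + n)%N, (fun i => match split i with inl j => c j | inr j => d j end),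
  (fun i => match split i with inl j => x j | inr j => y j end).
split=> [i|]; first by case: split.
rewrite big_split_ord /=; congr (_ + _); apply: eq_bigr => i _.
  by have := unsplitK (inl i : 'I_m + 'I_n); rewrite /= => ->.
by have := unsplitK (inr i : 'I_m + 'I_n); rewrite /= => ->.
Qed.

Lemma lin_spanZ S c u : lin_span S u -> lin_span S (c *: u).
Proof.
move=> [m [d [x [Sx ->]]]]; exists m, (fun i => c * d i), x; split=> //.
by rewrite scaler_sumr; apply: eq_bigr => i _; rewrite scalerA.
Qed.

Lemma lin_span_sum S (I : Type) (r : seq I) (P : pred I) (F : I -> V) :
  (forall i, P i -> lin_span S (F i)) -> lin_span S (\sum_(i <- r | P i) F i).
Proof. by move=> h; apply: big_ind => //; [exact: lin_span0|exact: lin_spanD]. Qed.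

Lemma lin_span_subspace S : is_subspace (lin_span S).
Proof.
split=> [|c u v Su Sv]; first exact: lin_span0.
by apply: lin_spanD => //; apply: lin_spanZ.
Qed.

Lemma subspace_sum (F : V -> Prop) n (c : 'I_n -> k) (u : 'I_n -> V) :
  is_subspace F -> (forall i, F (u i)) -> F (\sum_(i < n) c i *: u i).
Proof.
move=> [F0 FD] Fu; elim: n c u Fu => [|n IH] c u Fu; first by rewrite big_ord0.
by rewrite big_ord_recl; apply: FD => //; apply: IH.
Qed.

Lemma lin_span_min S (F : V -> Prop) u : is_subspace F -> (forall v, S v -> F v) ->
  lin_span S u -> F u.
Proof. by move=> hF SF [n [c [x [Sx ->]]]]; apply: subspace_sum => // i; apply: SF. Qed.

End LinSpan.

Section Filtrations.
Variables (k : fieldType) (H : comAlgType k) (F : nat -> H -> Prop).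
Hypotheses (Fsub : forall n, is_subspace (F n)) (FS : forall n x, F n x -> F n.+1 x).
Hypotheses (F1 : F 0%N 1) (FM : forall m n x y, F m x -> F n y -> F (m + n)%N (x * y)).

Lemma filtration_le m n x : (m <= n)%N -> F m x -> F n x.
Proof.
by move=> /subnK <-; elim: (n - m)%N => [|d IH] // /IH; rewrite addSn; apply: FS.
Qed.

Lemma filtration_prod (I : Type) (r : seq I) (P : pred I) (x : I -> H) (d : I -> nat) :
  (forall i, P i -> F (d i) (x i)) ->
  F (\sum_(i <- r | P i) d i)%N (\prod_(i <- r | P i) x i).
Proof.
move=> h; elim: r => [|i r IH]; first by rewrite !big_nil.
by rewrite !big_cons; case: ifP => // Pi; apply: FM => //; apply: h.
Qed.

Lemma tensor_filtration_tens m n a b : F m a -> F n b ->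
  tensor_filtration F (m + n) (a ⊗ b).
Proof.
by move=> Fa Fb; apply: lin_span_gen; exists m, a, b; rewrite leq_addr addKn.
Qed.

Lemma tensor_filtrationM m n x y : tensor_filtration F m x -> tensor_filtration F n y ->
  tensor_filtration F (m + n) (x * y).
Proof.
move=> [p [c [u [hu ->]]]] [q [d [v [hv ->]]]]; rewrite mulr_suml.
apply: lin_span_sum => i _; rewrite mulr_sumr; apply: lin_span_sum => j _.
have [i' [a [b [im Fa Fb ->]]]] := hu i; have [j' [a' [b' [jn Fa' Fb' ->]]]] := hv j.
rewrite -tensor_scaleAl mulrC -tensor_scaleAl tens_mul; do 2!apply: lin_spanZ.
rewrite -(subnKC im) -(subnKC jn) addnACA [a' * a]mulrC [b' * b]mulrC.
by apply: tensor_filtration_tens; apply: FM.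
Qed.

Lemma tensor_filtration1 : tensor_filtration F 0 1.
Proof. exact: (tensor_filtration_tens F1 F1). Qed.

Lemma tensor_filtration_le m n x : (m <= n)%N ->
  tensor_filtration F m x -> tensor_filtration F n x.
Proof.
move=> mn; apply: lin_span_min; first exact: lin_span_subspace.
move=> _ [j [a [b [jm Fa Fb ->]]]]; apply: lin_span_gen; exists j, a, b; split=> //.
  exact: leq_trans mn.
by apply: filtration_le Fb; apply: leq_sub2r.
Qed.

(** A block of m letters has degree m - 1, so [kr_weight] gives each term of the coproduct of X_w
    the total degree |w| - 1. *)
Lemma comul_coord_filtration (h : hopf_algebra H) s (X : series s H) :
  induced_by_boxed_conv h X -> (forall w, F (size w).-1 (X w)) ->
  forall w, (0 < size w)%N -> tensor_filtration F (size w).-1 (comul h (X w)).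
Proof.
move=> ind FX w w0; have [-> _] := ind w w0; apply: lin_span_sum => P ncP.
have partF (Q : {set {set 'I_(size w)}}) : F (\sum_(U in Q) #|U|.-1)%N (part_coef X Q).
  by apply: filtration_prod => U UQ; rewrite -size_subword.
case: w w0 P ncP partF => // i w _ P ncP partF.
rewrite -[(size (i :: w)).-1](kr_weight ncP) krewerasE //.
by apply: tensor_filtration_tens; apply: partF.
Qed.

End Filtrations.

Section MonomialFiltration.
Variables (k : fieldType) (M : nmodType) (wt : M -> nat).
Hypotheses (wt0 : wt 0 = 0%N) (wtD : forall a b, wt (a + b) = (wt a + wt b)%N).
Local Notation A := (monoid_algebra k M).

(** Serves two algebras: for [weight] it is [weight_filtration] by conversion, and for [poly_weight]
    it filters [bar_algebra]. *)
Definition mono_filtration (j : nat) : A -> Prop :=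
  lin_span (fun x => exists2 m, (wt m <= j)%N & x = mono k m).
Local Notation F := mono_filtration.

Lemma mono_filtration_mono m j : (wt m <= j)%N -> F j (mono k m).
Proof. by move=> mj; apply: lin_span_gen; exists m. Qed.

Lemma mono_filtration_subspace j : is_subspace (F j).
Proof. exact: lin_span_subspace. Qed.

Lemma mono_filtrationS j x : F j x -> F j.+1 x.
Proof.
apply: lin_span_min; first exact: lin_span_subspace.
by move=> _ [m mj ->]; apply/mono_filtration_mono/ltnW.
Qed.

Lemma mono_filtrationM i j x y : F i x -> F j y -> F (i + j)%N (x * y).
Proof.
move=> [p [c [u [hu ->]]]] [q [d [v [hv ->]]]]; rewrite mulr_suml.
apply: lin_span_sum => a _; rewrite mulr_sumr; apply: lin_span_sum => b _.
have [m mi ->] := hu a; have [n nj ->] := hv b.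
rewrite -scalerAl -scalerAr mono_mulE; do 2!apply: lin_spanZ.
by apply: mono_filtration_mono; rewrite wtD leq_add.
Qed.

Lemma mono_filtration_exhaustive x : exists j, F j x.
Proof.
exists (\sum_(m <- msupp x) wt m)%N; rewrite [x in F _ x]monoE [X in F _ X]big_seq.
apply: lin_span_sum => m mx; apply/lin_spanZ/mono_filtration_mono.
by rewrite (big_fsetD1 m) //= leq_addr.
Qed.

Lemma mono_filtration1 : F 0 1.
Proof. by rewrite -mono1; apply: mono_filtration_mono; rewrite wt0. Qed.

Lemma mono_hopf_filtration (h : hopf_algebra A) :
  (forall m, tensor_filtration F (wt m) (comul h (mono k m))) -> hopf_filtration h F.
Proof.
move=> hm; split; last exact: mono_filtrationM.
split; [exact: mono_filtration_subspace|exact: mono_filtrationS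
       |exact: mono_filtration_exhaustive|move=> n x [p [c [u [hu ->]]]]].
rewrite linear_sum; apply: lin_span_sum => i _; rewrite linearZ; apply: lin_spanZ.
have [m mn ->] := hu i; apply: (tensor_filtration_le _ mn (hm m)).
exact: mono_filtrationS.
Qed.

End MonomialFiltration.

Section GroupLike.
Variables (k : fieldType) (H : comAlgType k) (h : hopf_algebra H).

Lemma group_like1 : group_like h 1.
Proof. by split; rewrite rmorph1. Qed.

Lemma group_likeM x y : group_like h x -> group_like h y -> group_like h (x * y).
Proof.
move=> [dx ex] [dy ey]; split; first by rewrite rmorphM /= dx dy tens_mul.
by rewrite rmorphM /= ex ey mulr1.
Qed.

(** [comul h y] and y ⊗ y are both inverse to [comul h x]. *)
Lemma group_like_inv x y : x * y = 1 -> group_like h x -> group_like h y.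
Proof.
move=> xy [dx ex]; split.
  apply: (@inv_uniq _ (comul h x)); first by rewrite -rmorphM xy rmorph1.
  by rewrite dx tens_mul xy.
by have := rmorphM (counit h) x y; rewrite xy rmorph1 /= ex mul1r.
Qed.

Variables (s : nat) (X : series s H).
Hypothesis ind : induced_by_boxed_conv h X.

Lemma comul_boxed w : (0 < size w)%N -> comul h (X w) =
  boxed_conv ((fun a => a ⊗ (1 : H)) \o X) ((fun a => (1 : H) ⊗ a) \o X) w.
Proof.
move=> w0; have [-> _] := ind w0; case: w w0 => // i w _; apply: eq_bigr => P _.
have [_ _ l1 lM _] := @tensl_hom k H H; have [_ _ r1 rM _] := @tensr_hom k H H.
by rewrite tens_split /part_coef (big_morph _ lM l1) (big_morph _ rM r1).
Qed.

Lemma group_like_letter i : group_like h (X [:: i]).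
Proof.
split; last by have [|_ ->] := ind (w := [:: i]).
by rewrite comul_boxed // boxed_conv_letter /= tens_mul mulr1 mul1r.
Qed.

End GroupLike.

(** * Group-like monomials under a co-connected filtration *)

Section Separation.
Variables (k : fieldType) (M : nmodType).
Local Notation A := (monoid_algebra k M).

Lemma mcoeff_scaleD (m : M) (c : k) (x y : A) : (c *: x + y)@_m = c * x@_m + y@_m.
Proof. by rewrite [LHS]mcoeffD [X in X + _]mcoeffZ. Qed.

Lemma mcoeff_sumZ (m : M) n (c : 'I_n -> k) (x : 'I_n -> A) :
  (\sum_(i < n) c i *: x i)@_m = \sum_(i < n) c i * (x i)@_m.
Proof.
elim: n c x => [|n IH] c x; first by rewrite !big_ord0 mcoeff0.
by rewrite !big_ord_recl mcoeff_scaleD IH.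
Qed.

(* Only finitely many monomials occur in g and the a i, so that a separating
   functional comes from linear algebra over k in finite dimension. *)
Lemma separating_functional (g : A) n (a : 'I_n -> A) :
  (forall c : 'I_n -> k, g <> \sum_(i < n) c i *: a i) ->
  exists f : A -> k, [/\ forall c x y, f (c *: x + y) = c * f x + f y,
    f g = 1 & forall i, f (a i) = 0].
Proof.
move=> indep.
pose D : seq M :=
  (enum_fset (msupp g) ++ flatten [seq enum_fset (msupp (a i)) | i <- enum 'I_n])%SEQ.
have Dg m : m \notin D -> g@_m = 0.
  by rewrite mem_cat negb_or => /andP[mg _]; apply: mcoeff_outdom.
have Da i m : m \notin D -> (a i)@_m = 0.
  rewrite mem_cat negb_or => /andP[_ ma]; apply: mcoeff_outdom.
  apply: contra ma => mi; apply/flattenP; exists (enum_fset (msupp (a i))) => //.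
  by apply: map_f; rewrite mem_enum.
pose coords x : 'rV[k]_(size D) := \row_j (x : A)@_(tnth (in_tuple D) j).
pose B : 'M[k]_(n, size D) := \matrix_i coords (a i).
have nsub : ~~ (coords g <= B)%MS.
  apply/negP => /submxP[u e]; apply: (indep (fun i => u 0 i)).
  apply/malgP => m; rewrite mcoeff_sumZ; have [mD|mD] := boolP (m \in D); last first.
    by rewrite Dg // big1 // => i _; rewrite Da // mulr0.
  have /tnthP[j ->] : m \in in_tuple D by [].
  have := congr1 (fun r : 'rV[k]_(size D) => r 0 j) e; rewrite !mxE => ->.
  by apply: eq_bigr => i _; rewrite !mxE.
(* Column j of the cokernel matrix kills every row of B but not [coords g]; dividing by its value on
   [coords g] normalises f. *)
have [j cj] : exists j, (coords g *m cokermx B) 0 j != 0.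
  apply/existsP; apply: contraR nsub; rewrite negb_exists => /forallP z.
  rewrite submxE; apply/eqP/rowP => j; rewrite [RHS]mxE; apply/eqP.
  by rewrite -[_ == _]negbK.
pose f x := (coords x *m cokermx B) 0 j / (coords g *m cokermx B) 0 j.
have coordsD c x y : coords (c *: x + y) = c *: coords x + coords y.
  by apply/rowP => l; rewrite !mxE mcoeff_scaleD.
exists f; split=> [c x y||i]; last 1 first.
- have -> : f (a i) = (row i B *m cokermx B) 0 j / (coords g *m cokermx B) 0 j.
    by rewrite rowK.
  by rewrite -row_mul mulmx_coker !mxE mul0r.
- by rewrite /f coordsD mulmxDl -scalemxAl !mxE mulrDl mulrA.
- by rewrite /f divff.
Qed.

(** The filtration index of g can always be lowered. If g is in F (n + 1) but not in F n, take a
    functional with value 1 on g that kills the left factors lying in F n, and apply it to the left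
    of g ⊗ g. Only terms with right factor in F 0 survive, so g is in F 0 after all. Hence g is a
    scalar, and a monomial is a scalar only for m = 0. *)
Lemma mono_group_like_trivial (h : hopf_algebra A) (m : M) :
  comul h (mono k m) = mono k m ⊗ mono k m -> co_connected h -> m = 0.
Proof.
move=> gl [F [[Fsub FS Fex FD] F0]]; set g := mono k m in gl.
have F0n n x : F 0%N x -> F n x by move=> F0x; apply: (filtration_le FS (leq0n n)).
have down n : F n.+1 g -> F n g.
  move=> /FD; rewrite gl => -[N [c [t [ht e]]]].
  have ht' i : exists p : A * A, exists j, [/\ (j <= n.+1)%N, F j p.1,
      F (n.+1 - j)%N p.2 & t i = p.1 ⊗ p.2].
    by have [j [a [b hj]]] := ht i; exists (a, b), j.
  have [ab hab] := choice ht'.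
  (* Left factors outside [F n] are replaced by 0, so that the span of the [a i] stays in [F n] and
     cannot contain g. *)
  pose a i := if `[< F n (ab i).1 >] then (ab i).1 else 0.
  have Fa i : F n (a i) by rewrite /a; case: asboolP => // _; have [] := Fsub n.
  have [//|nFg] := pselect (F n g).
  have [f [flin fg fa]] : exists f : A -> k, [/\ forall c x y, f (c *: x + y) = c * f x + f y,
      f g = 1 & forall i, f (a i) = 0].
    apply: separating_functional => d eg; apply: nFg; rewrite eg.
    exact: subspace_sum.
  have bil : is_bilinear (fun x y : A => f x *: y).
    split=> [y d u v|x d u v]; first by rewrite flin scalerDl scalerA.
    by rewrite scalerDr !scalerA mulrC.
  apply: F0n; have := congr1 (tlift (fun x y : A => f x *: y)) e.
  rewrite (tlift_tens _ _ bil) fg scale1r => ->.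
  have tl := tlift_is_linear bil.
  have -> : tlift (fun x y : A => f x *: y) (\sum_(i < N) c i *: t i) =
      \sum_(i < N) c i *: tlift (fun x y : A => f x *: y) (t i).
    elim: N c t {ht ht' e ab hab a Fa fa} => [|N IH] c t.
      by rewrite !big_ord0; apply: (tlift0 bil).
    by rewrite !big_ord_recl tl IH.
  apply: subspace_sum => [|i]; first exact: Fsub.
  have [j [jn Fj Fnj ->]] := hab i; rewrite (tlift_tens _ _ bil).
  have F00 : F 0%N 0 by have [] := Fsub 0%N.
  have FZ d x : F 0%N x -> F 0%N (d *: x).
    by move=> Fx; have [_ /(_ d x 0 Fx F00)] := Fsub 0%N; rewrite addr0.
  (* For j = n + 1 the right factor is in [F 0]; for j <= n the left factor is in [F n] and f kills
     it. *)
  move: jn; rewrite leq_eqVlt => /orP[/eqP ej|jn].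
    by apply: FZ; rewrite ej subnn in Fnj.
  have := fa i; rewrite /a; case: asboolP => [_ ->|nF _]; first by rewrite scale0r.
  by case: nF; apply: (filtration_le FS _ Fj).
have F0g : F 0%N g.
  by have [n] := Fex g; elim: n => // n IH /down /IH.
have /F0[c /(congr1 (fun x : A => x@_m))] := F0g.
rewrite -mono1 [in RHS]mono_scale mcoeffUU mcoeffU; case: eqVneq => [->//|_].
by rewrite mulr0n => /eqP; rewrite oner_eq0.
Qed.

End Separation.

(** * Weights of monomials and the resulting filtrations *)

Section Weights.
Variables (k : fieldType) (s : nat).
Local Notation L := (laurent_exp s).
Local Notation W := (poly_exp s).

Definition poly_weight (p : W) : nat :=
  (\sum_(w <- finsupp (p : {cmonom _})) (p : {cmonom _}) w * (size (val w)).-1)%N.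

Lemma poly_weightw (p : W) d : (finsupp (p : {cmonom _}) `<=` d)%fset ->
  poly_weight p = (\sum_(w <- d) (p : {cmonom _}) w * (size (val w)).-1)%N.
Proof.
by move=> le; apply: big_fset_incl => // w _; rewrite -cmE_eq0 => /eqP ->.
Qed.

Lemma poly_weightD p q : poly_weight (p + q) = (poly_weight p + poly_weight q)%N.
Proof.
have e : finsupp (p + q : {cmonom _}) =
    (finsupp (p : {cmonom _}) `|` finsupp (q : {cmonom _}))%fset.
  exact: mdomD.
rewrite [LHS]/poly_weight e (poly_weightw (fsubsetUl _ (finsupp (q : {cmonom _})))).
rewrite (poly_weightw (fsubsetUr (finsupp (p : {cmonom _})) _)) -big_split.
by apply: eq_bigr => w _; rewrite poly_expE mulnDl.
Qed.

Lemma poly_weight0 : poly_weight 0 = 0%N.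
Proof. by rewrite /poly_weight mdom1 big_seq_fset0. Qed.

Lemma poly_weight_word w : poly_weight (word_exp w) = (size (val w)).-1.
Proof. by rewrite /poly_weight mdomU big_seq_fset1 cmUU mul1n. Qed.

(** Words of length at least 2 have positive weight. Hence degree 0 of the filtration of
    [bar_algebra] is k, whereas in [coord_algebra] all Laurent monomials have weight 0. *)
Lemma poly_weight_eq0 p : (poly_weight p <= 0)%N -> p = 0.
Proof.
move=> p0; apply/eqP/cmP => w; rewrite [RHS]cm1; apply/eqP.
rewrite cmE_eq0; apply: contraTN p0 => wp; rewrite -ltnNge.
rewrite /poly_weight (big_fsetD1 w) //= addn_gt0 muln_gt0 lt0n cmE_neq0 wp /=.
by have := valP w; rewrite /=; case: (size (val w)) => [|[|]].
Qed.

Lemma weightE (m : L * W) : weight m = poly_weight m.2. Proof. by []. Qed.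

Lemma weight0 : weight (0 : L * W) = 0%N.
Proof. exact: poly_weight0. Qed.

Lemma weightD (m n : L * W) : weight (m + n) = (weight m + weight n)%N.
Proof. exact: poly_weightD. Qed.

Lemma coord_series_weight w : @weight_filtration k s (size w).-1 (coord_series k w).
Proof.
have [->|[i ->]|[v ->]] := wordP w.
- by rewrite /coord_series insubN //; apply: lin_span0.
- rewrite coord_letter; apply: (@mono_filtration_mono k _ (@weight s)).
  by rewrite weightE poly_weight0.
- rewrite coord_word; apply: (@mono_filtration_mono k _ (@weight s)).
  by rewrite weightE poly_weight_word.
Qed.

Lemma bar_series_weight w : mono_filtration poly_weight (size w).-1 (bar_series k w).
Proof.
have [->|[i ->]|[v ->]] := wordP w.
- by rewrite /bar_series insubN //; apply: lin_span0.
- rewrite bar_letter -mono1; apply: mono_filtration_mono; by rewrite poly_weight0.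
- by rewrite bar_word; apply: mono_filtration_mono; rewrite poly_weight_word.
Qed.

End Weights.

Section CoordinateFiltrations.
Variables (k : fieldType) (s : nat).

Lemma laurent_group_like (h : hopf_algebra (laurent_algebra k s)) :
  induced_by_boxed_conv h (@laurent_series k s) -> forall l, group_like h (mono k l).
Proof.
move=> ind; apply: laurent_exp_ind => [|a b ha hb|a ha|i].
- exact: group_like1.
- by rewrite -mono_mulE; apply: group_likeM.
- by apply: (group_like_inv _ ha); rewrite mono_mulE subrr.
- exact: (group_like_letter ind).
Qed.

Lemma coord_laurent_group_like (h : hopf_algebra (coord_algebra k s)) :
  induced_by_boxed_conv h (@coord_series k s) ->
  forall l, group_like h (mono k ((l, 0) : laurent_exp s * poly_exp s)).
Proof.
move=> ind; apply: laurent_exp_ind => [|a b ha hb|a ha|i].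
- exact: group_like1.
- rewrite mono_pairl.
  exact: group_likeM.
- by apply: (group_like_inv _ ha); rewrite mono_mulE pairD subrr addr0.
- by rewrite -coord_letter; apply: group_like_letter.
Qed.

(** A monomial is a Laurent part, group-like of weight 0, times a product of coordinates X_w, so
    multiplicativity reduces the claim to these factors. *)
Lemma coord_filtration (h : hopf_algebra (coord_algebra k s)) :
  induced_by_boxed_conv h (@coord_series k s) ->
  hopf_filtration h (@weight_filtration k s).
Proof.
move=> ind; apply: (mono_hopf_filtration (weightD (s := s))) => -[l p].
have cM x y : comul h (x * y) = comul h x * comul h y := rmorphM (comul h) x y.
have FM := mono_filtrationM (k := k) (weightD (s := s)).
have F1 := mono_filtration1 k (weight0 s).
rewrite mono_pair.
rewrite cM -[weight _]add0n; apply: (tensor_filtrationM FM).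
  have [-> _] := coord_laurent_group_like ind l.
  rewrite -[X in tensor_filtration _ X]addn0.
  by apply: tensor_filtration_tens;
    apply: (@mono_filtration_mono k _ (@weight s)); rewrite weightE poly_weight0.
rewrite weightE [(_, _).2]/=; pose T := tensor_filtration (@weight_filtration k s).
apply: (poly_exp_ind (P := fun p => T (poly_weight p)
  (comul h (mono k ((0, p) : laurent_exp s * poly_exp s))))) => [|a b ea eb|w]; rewrite /T.
- by rewrite poly_weight0 [mono _ _]mono1 rmorph1; apply: tensor_filtration1.
- rewrite mono_pairr.
  rewrite cM poly_weightD; exact: (tensor_filtrationM FM ea eb).
- rewrite -coord_word poly_weight_word.
  apply: (comul_coord_filtration F1 FM ind (@coord_series_weight k s)).
  exact: ltnW (valP w).
Qed.

Lemma bar_filtration (h : hopf_algebra (bar_algebra k s)) :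
  induced_by_boxed_conv h (@bar_series k s) ->
  hopf_filtration h (mono_filtration (k := k) (@poly_weight s)).
Proof.
move=> ind; apply: (mono_hopf_filtration (poly_weightD (s := s))).
have cM x y : comul h (x * y) = comul h x * comul h y := rmorphM (comul h) x y.
have FM := mono_filtrationM (k := k) (poly_weightD (s := s)).
have F1 := mono_filtration1 k (poly_weight0 s).
apply: poly_exp_ind => [|a b ea eb|w].
- by rewrite poly_weight0 [mono _ _]mono1 rmorph1; apply: tensor_filtration1.
- rewrite -(mono_mulE k a b) cM poly_weightD; exact: (tensor_filtrationM FM ea eb).
- rewrite -bar_word poly_weight_word.
  apply: (comul_coord_filtration F1 FM ind (@bar_series_weight k s)).
  exact: ltnW (valP w).
Qed.

Lemma bar_co_connected (h : hopf_algebra (bar_algebra k s)) :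
  induced_by_boxed_conv h (@bar_series k s) -> co_connected h.
Proof.
move=> ind; exists (mono_filtration (k := k) (@poly_weight s)).
split=> [|x]; first by have [] := bar_filtration ind.
split=> [|[c ->]]; last by apply: lin_spanZ; apply: mono_filtration1; apply: poly_weight0.
move=> [n [c [u [hu ->]]]]; exists (\sum_i c i); rewrite scaler_suml.
apply: eq_bigr => i _; have [m m0 ->] := hu i.
by rewrite (poly_weight_eq0 m0) mono1.
Qed.

Lemma coord_not_co_connected (h : hopf_algebra (coord_algebra k s)) : (0 < s)%N ->
  induced_by_boxed_conv h (@coord_series k s) -> ~ co_connected h.
Proof.
move=> s0 ind cc; pose i : 'I_s := Ordinal s0.
have [gl _] := group_like_letter ind i; rewrite coord_letter in gl.
have /(congr1 fst) /= /ffunP/(_ i) := mono_group_like_trivial gl cc.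
by rewrite !ffunE eqxx.
Qed.

End CoordinateFiltrations.

(** * Co-commutativity and the quotient map *)

Section Cocommutativity.
Variables (k : fieldType) (s : nat).
Local Notation H := (bar_algebra k s).
Variable h : hopf_algebra H.
Hypothesis ind : induced_by_boxed_conv h (@bar_series k s).

Lemma bar_comul : comul h \o @bar_series k s =
  boxed_conv ((fun a => a ⊗ (1 : H)) \o @bar_series k s)
    ((fun a => (1 : H) ⊗ a) \o @bar_series k s).
Proof.
apply/funext => -[|i w]; last exact: (comul_boxed ind).
by rewrite /= /bar_series insubN // rmorph0.
Qed.

Lemma tensor_hom_swap (R : comPzRingType) (iota : {rmorphism k -> R}) (f g : H -> R) :
  alg_hom iota f -> alg_hom iota g ->
  forall t : tensor H H, tensor_hom iota f g (tswap t) = tensor_hom iota g f t.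
Proof.
move=> hf hg t; rewrite /tensor_hom /tswap.
rewrite (linear_tlift _ _ (tlift_is_linear (mul_hom_bilinear hf hg))).
rewrite /tlift /formal_eval; apply: eq_bigr => p _.
by rewrite [LHS](tlift_tens _ _ (mul_hom_bilinear hf hg)) mulrC.
Qed.

(** The coproduct is the product of the two inclusions as points over H ⊗ H, and its swap is their
    product in the opposite order; [boxed_convC] identifies them. *)
Lemma bar_cocommutative : s = 1%N -> cocommutative h.
Proof.
move=> s1 x; pose iota := (tensor_scalar H H : {rmorphism k -> tensor H H}).
have hl := @tensl_hom k H H; have hr := @tensr_hom k H H.
have id_split t : tensor_hom iota (fun a => a ⊗ (1 : H)) (fun a => (1 : H) ⊗ a) t = t.
  by rewrite -[RHS]tensor_sum; apply: eq_bigr => p _; rewrite -tens_split.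
rewrite -[LHS]id_split tensor_hom_swap // -[RHS]id_split.
apply: (bar_hom_inj (conv_hom (comul h) hr hl) (conv_hom (comul h) hl hr)) => w.
have e1 := congr1 (fun f => f w) (conv_coord bar_comul hr hl).
have e2 := congr1 (fun f => f w) (conv_coord bar_comul hl hr).
by rewrite [LHS]e1 [RHS]e2 boxed_convC.
Qed.

(** Co-commutativity would make the convolution of k-points commutative, but the points
    [short_series i j] and [short_series j i] have products with coefficients 1 and 0 at iji. *)
Lemma bar_not_cocommutative : (2 <= s)%N -> ~ cocommutative h.
Proof.
move=> s2 cc; pose i : 'I_s := Ordinal (ltnW s2); pose j : 'I_s := Ordinal s2.
have ij : i != j by [].
pose iota := (idfun : {rmorphism k -> k}).
have pt a b : exists2 f : H -> k, alg_hom iota f & f \o @bar_series k s = @short_series s k a b.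
  by apply: bar_hom_surj.
have [f hf fX] := pt i j; have [g hg gX] := pt j i.
pose w := [:: i; j; i].
have e1 := congr1 (fun f => f w) (conv_coord bar_comul hf hg).
have e2 := congr1 (fun f => f w) (conv_coord bar_comul hg hf).
move: e1 e2; rewrite fX gX (boxed_conv_ij_ji k ij) (boxed_conv_ji_ij k ij) /= /conv.
rewrite -(cc (bar_series k w)) (tensor_hom_swap hf hg) cc => -> /eqP.
by rewrite oner_eq0.
Qed.

End Cocommutativity.

(** * The quotient by the elements X_i - 1 *)

Section Ideals.
Variables (R : comPzRingType) (n : nat) (g : 'I_n -> R).

Definition in_ideal (x : R) := exists a : 'I_n -> R, x = \sum_(i < n) a i * g i.

Lemma ideal0 : in_ideal 0.
Proof. by exists (fun _ => 0); rewrite big1 // => i _; rewrite mul0r. Qed.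

Lemma ideal_gen i : in_ideal (g i).
Proof.
exists (fun j => (j == i)%:R); rewrite (bigD1 i) //= eqxx mul1r.
by rewrite big1 ?addr0 // => j /negbTE ->; rewrite mul0r.
Qed.

Lemma idealD x y : in_ideal x -> in_ideal y -> in_ideal (x + y).
Proof.
move=> [a ->] [b ->]; exists (fun i => a i + b i).
by rewrite -big_split; apply: eq_bigr => i _; rewrite mulrDl.
Qed.

Lemma idealM c x : in_ideal x -> in_ideal (c * x).
Proof.
move=> [a ->]; exists (fun i => c * a i).
by rewrite mulr_sumr; apply: eq_bigr => i _; rewrite mulrA.
Qed.

Lemma ideal_sub1M x y : in_ideal (x - 1) -> in_ideal (y - 1) -> in_ideal (x * y - 1).
Proof.
move=> hx hy; rewrite (_ : x * y - 1 = x * (y - 1) + (x - 1)).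
  exact: (idealD (idealM x hy) hx).
by rewrite mulrBr mulr1 addrA subrK.
Qed.

Lemma ideal_sub1Z c x : in_ideal (x - 1) -> in_ideal (c * x - c).
Proof. by move=> hx; rewrite -[X in _ - X]mulr1 -mulrBr; apply: idealM. Qed.

Lemma ideal_sub1V x y : x * y = 1 -> in_ideal (x - 1) -> in_ideal (y - 1).
Proof.
move=> xy hx; rewrite (_ : y - 1 = - y * (x - 1)); first exact: idealM.
by rewrite mulrBr mulr1 mulNr [y * x]mulrC xy opprK addrC.
Qed.

End Ideals.

Section Quotient.
Variables (k : fieldType) (s : nat).
Local Notation A := (coord_algebra k s).
Local Notation B := (bar_algebra k s).

Local Notation in_ideal := (in_ideal (fun i : 'I_s => coord_series k [:: i] - 1)).

Lemma ideal_laurent (l : laurent_exp s) :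
  in_ideal (mono k ((l, 0) : laurent_exp s * poly_exp s) - 1).
Proof.
move: l; apply: laurent_exp_ind => [|a b ha hb|a ha|i].
- rewrite [mono _ _]mono1 subrr; exact: ideal0.
- rewrite mono_pairl.
  exact: ideal_sub1M ha hb.
- apply: ideal_sub1V ha; by rewrite mono_mulE pairD subrr addr0.
- by rewrite -coord_letter; apply: (ideal_gen (fun i : 'I_s => coord_series k [:: i] - 1)).
Qed.

(** The map t is a section of q sending bar X_w back to X_w for |w| >= 2. Each z - t (q z) lies in
    the ideal, as is seen on monomials, so an element killed by q lies in the ideal. *)
Lemma bar_quotient : exists q : {lrmorphism A -> B},
  is_quotient_map (fun i : 'I_s => coord_series k [:: i] - 1) q /\
  forall w, q (coord_series k w) = bar_series k w.
Proof.
pose iA := (in_alg A : {rmorphism k -> A}); pose iB := (in_alg B : {rmorphism k -> B}).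
have [q0 hq0 q0X] : exists2 f : A -> B, alg_hom iB f &
    f \o @coord_series k s = @bar_series k s.
  apply: coord_hom_surj => [|i]; first by rewrite /bar_series insubN.
  by exists 1; rewrite bar_letter mulr1.
have [q eq] := alg_hom_algebra hq0.
have qX w : q (coord_series k w) = bar_series k w.
  by rewrite eq -[LHS]/((q0 \o @coord_series k s) w) q0X.
have [t ht tX] : exists2 f : B -> A, alg_hom iA f & f \o @bar_series k s =
    fun w => if size w == 1%N then 1 else coord_series k w.
  by apply: bar_hom_surj; rewrite //= /coord_series insubN.
have tXw w : t (bar_series k w) = if size w == 1%N then 1 else coord_series k w.
  by rewrite -[LHS]/((t \o @bar_series k s) w) tX.
have [tD t0 t1 tM tZ] := ht; have [qD _ q1 qM qZ] := hq0.
have qtK y : q (t y) = y.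
  rewrite eq; apply: (bar_hom_inj (alg_hom_comp ht hq0) (@alg_hom_id k B)) => w.
  rewrite /= tXw; case: eqP => [|_]; last by rewrite -eq qX.
  by case: w => [|i []] // _; rewrite bar_letter q1.
have qB1 x : q (x - 1) = q x - 1 by rewrite rmorphB rmorph1.
have qD2 x y : q (x * y) = q x * q y := rmorphM q x y.
have q_ideal x : in_ideal x -> q x = 0.
  move=> [a ->]; rewrite rmorph_sum big1 // => i _.
  by rewrite rmorphM rmorphB rmorph1 /= qX bar_letter subrr mulr0.
have qlau l : q (mono k ((l, 0) : laurent_exp s * poly_exp s)) = 1.
  by apply: subr0_eq; rewrite -qB1; apply: q_ideal (ideal_laurent l).
have tqpol : forall p : poly_exp s, t (q (mono k ((0, p) : laurent_exp s * poly_exp s))) =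
    mono k ((0, p) : laurent_exp s * poly_exp s).
  apply: poly_exp_ind => [|a b ea eb|w].
  - by rewrite [mono _ _]mono1 rmorph1 t1.
  - rewrite mono_pairr.
    exact: (etrans (congr1 t (qD2 _ _)) (etrans (tM _ _) (congr2 *%R ea eb))).
  - rewrite -coord_word qX tXw; have := valP w => /=.
    by case: (size (val w)) => [|[]].
have tqm m : in_ideal (mono k m - t (q (mono k m))).
  case: m => l p.
  have e : t (q (mono k ((l, p) : laurent_exp s * poly_exp s))) = mono k (0, p).
    rewrite mono_pair.
    exact: etrans (congr1 t (etrans (qD2 _ _) (etrans (congr1 ( *%R^~ _) (qlau l))
      (mul1r _)))) (tqpol p).
  (* The difference is the polynomial part times the Laurent part minus 1. *)
  rewrite e mono_pair mulrC; exact: ideal_sub1Z (ideal_laurent l).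
have tqZ c x : t (q (c *: x)) = c *: t (q x).
  by rewrite [q _](linearZ_LR q c x) tZ mulr_algl.
have scaleI c x y : in_ideal (x - y) -> in_ideal (c *: x - c *: y).
  by move=> hxy; rewrite -scalerBr -mulr_algl; apply: idealM.
have tq z : in_ideal (z - t (q z)).
  rewrite (monoE z) rmorph_sum (big_morph _ tD t0) -sumrB.
  apply: big_ind => [|x y|m _]; [exact: ideal0|exact: idealD|].
  have -> : t (q (z@_m *: mono k m)) = z@_m *: t (q (mono k m)) := tqZ _ _.
  exact: scaleI (tqm m).
exists q; split=> //; split=> [y|x]; first by exists (t y).
by split=> [qx|]; [have := tq x; rewrite qx t0 subr0|exact: q_ideal].
Qed.

End Quotient.

Theorem theorem6p15 (k : fieldType) (s : nat) (hs : (1 <= s)%N) :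
  [/\ affine_group_scheme (GG k s),
      affine_group_scheme (GG1 k s)
    & affine_group_scheme (GGplus k s)] /\
  [/\
    exists h : hopf_algebra (coord_algebra k s),
      [/\ induced_by_boxed_conv h (@coord_series k s),
          @hopf_represents k (GG k s) _ h (coord_point (@coord_series k s)),
          hopf_filtration h (@weight_filtration k s)
        & ~ co_connected h],
    exists h : hopf_algebra (laurent_algebra k s),
      [/\ induced_by_boxed_conv h (@laurent_series k s),
          @hopf_represents k (GG1 k s) _ h (coord_point (@laurent_series k s))
        & forall x, lin_span (group_like h) x]
  & (exists q : {lrmorphism coord_algebra k s -> bar_algebra k s},
       is_quotient_map (fun i : 'I_s => coord_series k [:: i] - 1) q /\
       forall w, q (coord_series k w) = bar_series k w) /\
    exists h : hopf_algebra (bar_algebra k s),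
      [/\ induced_by_boxed_conv h (@bar_series k s),
          @hopf_represents k (GGplus k s) _ h (coord_point (@bar_series k s)),
          co_connected h,
          s = 1%N -> cocommutative h
        & (2 <= s)%N -> ~ cocommutative h]].
Proof.
split; split.
- split; first exact: (series_group_functor (GG_group k s)).
  by exists (coord_algebra k s), (coord_point (@coord_series k s)); apply: GG_represents.
- split; first exact: (series_group_functor (GG1_group k s)).
  by exists (laurent_algebra k s), (coord_point (@laurent_series k s)); apply: GG1_represents.
- split; first exact: (series_group_functor (GGplus_group k s)).
  by exists (bar_algebra k s), (coord_point (@bar_series k s)); apply: GGplus_represents.
- have [h [ind hrep]] := hopf_of_group (GG_group k s) (GG_represents k s).
  exists h; split=> //; first exact: coord_filtration.
  exact: (coord_not_co_connected hs ind).
- have [h [ind hrep]] := hopf_of_group (GG1_group k s) (GG1_represents k s).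
  exists h; split=> // x; rewrite (monoE x); apply: lin_span_sum => m _.
  by apply/lin_spanZ/lin_span_gen/laurent_group_like.
split; first exact: bar_quotient.
have [h [ind hrep]] := hopf_of_group (GGplus_group k s) (GGplus_represents k s).
exists h; split=> //; first exact: bar_co_connected.
- exact: bar_cocommutative.
- exact: bar_not_cocommutative.
Qed.
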